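(* Let $\mathcal H=L(\Lambda;\Delta^+)$ be unitary with respect to $\omega$, where $\Delta^+$ is an $\omega$-adapted positive system (of sign $\varepsilon$), and write $\mathcal H|_{\mathfrak g_{\bar0}}\cong\bigoplus_{\mu\in\Lambda-\Gamma(\Lambda)}L_0(\mu)^{\oplus m_\mu}$ with $m_\mu\in\mathbb Z_{\ge0}$. Then $m_\Lambda=1$, and for every $\mu\in(\Lambda-\Gamma(\Lambda))\setminus\{\Lambda\}$, $$m_\mu=d(\mu)-\sum_{\substack{\nu\in\Lambda-\Gamma(\Lambda)\\ \nu>\mu}}m_\nu a_{\nu,\mu}=\sum_{\substack{\nu\in\Lambda-\Gamma(\Lambda)\\ \nu>\mu}}B_{\mu,\nu}(\Lambda)\,m_\nu,$$ where $$B_{\mu,\nu}(\Lambda)=\frac{2\displaystyle\sum_{\alpha\in\Delta^+}\sum_{k\ge1}(-1)^{(k+1)p(\alpha)}(\mu+k\alpha,\alpha)\,a_{\nu,\mu+k\alpha}}{(\Lambda+2\rho,\Lambda)-(\mu+2\rho,\mu)}-a_{\nu,\mu}.$$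
   Context: Lie superalgebra. $\mathfrak g=\mathfrak g_{\bar0}\oplus\mathfrak g_{\bar1}$ is one of the complex Lie superalgebras $\mathfrak{sl}(m|n)$ ($m,n\ge1$, $m\neq n$; for $m=n$ one works with $\mathfrak{gl}(n|n)$ instead of $\mathfrak{sl}(n|n)$), $\mathfrak{osp}(m|2n)$ ($m,n\ge1$), or the exceptional $F(4)$ ($\mathfrak g_{\bar0}=\mathfrak{so}(7)\oplus\mathfrak{sl}(2)$, $\mathfrak g_{\bar1}=$ spin $\otimes\,\mathbb C^2$). The invariant form $(X,Y)$ is $\mathrm{str}(XY)$, $\frac12\mathrm{str}(XY)$, $\frac16\mathrm{str}_{\mathfrak g}(\mathrm{ad}X\,\mathrm{ad}Y)$, respectively; it induces a form $(\cdot,\cdot)$ on $\mathfrak h^*$. With $\Omega_n=\begin{pmatrix}0&I_n\\-I_n&0\end{pmatrix}$, $\mathfrak{osp}(m|2n)$ consists of the block matrices $\begin{pmatrix}A&B\\C&D\end{pmatrix}\in\mathfrak{gl}(m|2n)$ with $A=-A^T$, $D=\Omega_nD^T\Omega_n$, $C=-\Omega_nB^T$. Cartan subalgebra $\mathfrak h\subseteq\mathfrak g_{\bar0}$: diagonal matrices for $\mathfrak{sl},\mathfrak{gl}$, with coordinates $\epsilon_i$ (entry $i\leq m$), $\delta_a$ (entry $m+a$); for $\mathfrak{osp}(m|2n)$, $r=\lfloor m/2\rfloor$, the matrices $H=\mathrm{diag}(t_1K,\dots,t_rK,0_{m-2r},i\Omega_n\mathrm{diag}(D,D))$ with $K=\begin{pmatrix}0&i\\-i&0\end{pmatrix}$,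 $D=\mathrm{diag}(d_1,\dots,d_n)$, $\epsilon_i(H)=t_i$, $\delta_a(H)=d_a$; for $F(4)$ the complexification of a Cartan subalgebra of a maximal compact subalgebra of the even real form below, with $\epsilon_1,\epsilon_2,\epsilon_3$ for $\mathfrak{so}(7)$ and $\delta$ the root of $\mathfrak{sl}(2)$. Roots $\Delta=\Delta_{\bar0}\sqcup\Delta_{\bar1}$; $p(\alpha)\in\{0,1\}$ is the parity of $\alpha$. Fixed even positive system $\Delta_{\bar0}^+$: $\{\epsilon_i-\epsilon_j,\delta_a-\delta_b:i<j,a<b\}$ for $\mathfrak{sl},\mathfrak{gl}$; $\{\delta_a\pm\delta_b\ (a<b),2\delta_a,\epsilon_i\pm\epsilon_j\ (i<j)\}$, plus $\{\epsilon_i\}$ if $m$ is odd, for $\mathfrak{osp}$; $\{\delta,\epsilon_i,\epsilon_i\pm\epsilon_j\ (i<j)\}$ for $F(4)$. A positive system $\Delta^+=\Delta_{\bar0}^+\sqcup\Delta_{\bar1}^+$ extends this; $\rho=\rho_{\bar0}-\rho_{\bar1}$, $\rho_{\bar z}=\frac12\sum_{\alpha\in\Delta_{\bar z}^+}\alpha$; $\mathfrak n_{\bar1}^\pm=\bigoplus_{\alpha\in\Delta_{\bar1}^+}\mathfrak g^{\pm\alpha}$. Real forms. $\omega$ is a conjugate-linear anti-involution of $\mathfrak g$ (parity preserving, $\omega^2=\mathrm{id}$, $\omega([X,Y])=[\omega(Y),\omega(X)]$) of one of these types: $\omega(X)=J^{-1}\overline X^{\,t}J$ with $J=\mathrm{diag}(I_p,-I_q,\pm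 I_n)$, $p+q=m$, for $\mathfrak{sl},\mathfrak{gl}$; $J=\mathrm{diag}(\pm I_m,i\Omega_n)$ for $\mathfrak{osp}(m|2n)$, or, if $m=2r$, $J=\mathrm{diag}(i\bigoplus_{i=1}^r\Omega_1,\pm I_{2n})$; for $F(4)$, an anti-involution defining a real form with even part $\mathfrak{so}(7)\oplus\mathfrak{sl}(2,\mathbb R)$ or $\mathfrak{so}(2,5)\oplus\mathfrak{su}(2)$. The even real form is $\mathfrak g_{\bar0,\mathbb R}=\{X\in\mathfrak g_{\bar0}:\omega(X)=-X\}$. $\Delta^+$ is $\omega$-adapted with sign $\varepsilon\in\{\pm1\}$ if there are bases $\{\partial_i\}$ of $\mathfrak n_{\bar1}^+$ and $\{x_i\}$ of $\mathfrak n_{\bar1}^-$ with $(\partial_i,x_j)=\delta_{ij}$ and $\omega(x_i)=\varepsilon\partial_i$ for all $i,j$. A $\mathfrak g$-representation $\mathcal H$ is unitary if it carries a positive definite Hermitian form with $\langle\mathcal H_{\bar0},\mathcal H_{\bar1}\rangle=0$ and $\langle Xv,w\rangle=\langle v,\omega(X)w\rangle$; similarly for $\mathfrak g_{\bar0}$-modules. Branching data. $L(\Lambda;\Delta^+)$ is the simple highest weight $\mathfrak g$-representation of highest weight $\Lambda$; $L_0(\mu)$ the simple highest weight $\mathfrak g_{\bar0}$-module with respect to $\Delta_{\bar0}^+$. $\nu>\mu$ means $\nu-\mu\in Q^+\setminus\{0\}$, $Q^+=\sum_{\alpha\in\Delta^+}\mathbb Z_{\ge0}\alpha$. Let $\mathfrak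 k$ be a maximal compact subalgebra of $\mathfrak g_{\bar0,\mathbb R}$ with $\mathfrak h\subseteq\mathfrak k^{\mathbb C}$ and $\Delta^+_{\bar0,nc}$ the positive even roots $\beta$ with $\mathfrak g^\beta\not\subseteq\mathfrak k^{\mathbb C}$. $\Gamma$ is the set of all weights $\sum_{\alpha\in S}\alpha+\sum_{\beta\in\Delta_{\bar0,nc}^+}n_\beta\beta$ with $S\subseteq\Delta_{\bar1}^+$, $n_\beta\in\mathbb Z_{\ge0}$; for $\mathfrak{sl}(m|n)$, $\mathfrak{gl}(m|n)$ one takes all $n_\beta=0$. Then $\Gamma(\Lambda)$ is the set of $\gamma\in\Gamma$ such that $L_0(\Lambda-\gamma)$ is unitary and, if $\gamma\ne0$, $-\varepsilon\big((\Lambda-\gamma+2\rho,\Lambda-\gamma)-(\Lambda+2\rho,\Lambda)\big)>0$. For unitary $\mathcal H$, $\mathcal H|_{\mathfrak g_{\bar0}}$ (grading forgotten) is a finite direct sum of modules $L_0(\Lambda-\gamma)$ with $\gamma\in\Gamma(\Lambda)$; $m_\mu\in\mathbb Z_{\geq 0}$ is the multiplicity of $L_0(\mu)$ (possibly $0$). $d(\mu)=\dim\mathcal H^\mu$ (with $d(\mu)=0$ if $\mu$ is not a weight of $\mathcal H$) and $a_{\nu,\mu}=\dim L_0(\nu)^\mu$. *)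

(* Defs.v *)
From HB Require Import structures.
From mathcomp Require Import all_boot all_order all_algebra.
From mathcomp Require Import sesquilinear.
From mathcomp Require Import mxtens complex.
From mathcomp Require Import boolp classical_sets functions cardinality fsbigop.
From mathcomp Require Import reals.

Set Implicit Arguments.
Unset Strict Implicit.
Unset Printing Implicit Defensive.

Import Order.TTheory GRing.Theory Num.Theory.
Local Open Scope classical_set_scope.
Local Open Scope ring_scope.

(* Everything is developed over a numClosedFieldType C, which the theorem
   instantiates with R[i] for R : realType. The real numbers inside C are
   Num.real, and 0 < z in C means that z is real and positive. *)

Section Generalities.
Variable C : numClosedFieldType.

(* The subspace cut out by a linearly closed predicate; see vs_ofP. *)
Definition vs_of (L : vectType C) (P : set L) : {vspace L} :=
  xget 0%VS [set U : {vspace L} | forall X, (X \in U) <-> P X].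

Lemma vs_ofP (L : vectType C) (P : set L) :
  P 0 -> (forall (a : C) X Y, P X -> P Y -> P (a *: X + Y)) ->
  forall X, (X \in vs_of P) <-> P X.
Proof.
move=> P0 Plin.
suff [U HU] : exists U : {vspace L}, forall X, (X \in U) <-> P X.
  exact: (@xgetPex _ 0%VS [set U : {vspace L} | forall X, (X \in U) <-> P X]
           (ex_intro _ U HU)).
pose Q n := `[< exists2 U : {vspace L},
  \dim U = n & forall X, X \in U -> P X >].
have Q0 : exists n, Q n.
  exists 0%N; apply/asboolP; exists 0%VS; first exact: dimv0.
  by move=> X; rewrite memv0 => /eqP ->.
have Qb n : Q n -> (n <= \dim {: L})%N.
  by move=> /asboolP[U <- _]; apply/dimvS/subvf.
case: (ex_maxnP Q0 Qb) => n /asboolP[U dU UP] nmax.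
exists U => X; split; first exact: UP.
move=> PX; have UXP Y : Y \in (U + <[X]>)%VS -> P Y.
  move=> /memv_addP[u Uu [v /vlineP[a ->] ->]].
  by rewrite addrC; apply: Plin => //; exact: UP.
have le : (\dim (U + <[X]>) <= \dim U)%N.
  by rewrite dU; apply: nmax; apply/asboolP; exists (U + <[X]>)%VS.
have /eqP -> : (U == U + <[X]>)%VS by rewrite eqEdim addvSl le.
by apply: (subvP (addvSr U <[X]>)); exact: memv_line.
Qed.

Definition lin_subspace (V : lmodType C) (W : set V) : Prop :=
  W 0 /\ forall (a : C) u v, W u -> W v -> W (a *: u + v).

Definition basis_for (V : lmodType C) (W : set V) (n : nat) (e : 'I_n -> V) :
    Prop :=
  set_bij [set: 'rV[C]_n] W (fun c => \sum_(i < n) c 0 i *: e i).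

(* Dimension of a finite-dimensional subspace of a possibly
   infinite-dimensional space (junk value 0 in infinite dimension). *)
Definition fdim (V : lmodType C) (W : set V) : nat :=
  xget 0%N [set n | exists e : 'I_n -> V, basis_for W e].

Definition trace_on (L : vectType C) (U : {vspace L}) (f : L -> L) : C :=
  \sum_(i < \dim U) coord (vbasis U) i (f (vbasis U)`_i).

Definition commutator n (X Y : 'M[C]_n) : 'M[C]_n := X *m Y - Y *m X.

Definition adjoint_mx n (X : 'M[C]_n) : 'M[C]_n := map_mx Num.conj X^T.

Definition mx_entry m n (A : 'M[C]_(m, n)) (i j : nat) : C :=
  if (insub i, insub j) is (Some i', Some j') then A i' j' else 0.

End Generalities.

Section LieSuperalgebras.
Variable C : numClosedFieldType.

(* A Lie superalgebra g = hpart false (+) hpart true sitting inside an ambient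
   finite-dimensional space, with a Cartan subalgebra and a bilinear form.
   hpart true is the odd part. Only the values of brk and sform on g matter. *)
Record superData := SuperData {
  ambient :> vectType C;
  brk : ambient -> ambient -> ambient;
  hpart : bool -> {vspace ambient};
  cartan : {vspace ambient};
  sform : ambient -> ambient -> C
}.

Section Basics.
Variable D : superData.

Definition galg : {vspace D} := (hpart D false + hpart D true)%VS.

Definition weight := 'Hom(subvs_of (cartan D), C^o).

(* The restriction to the Cartan subalgebra of a linear form on the ambient
   space; see wt_ofE. *)
Definition wt_of (f : D -> C) : weight :=
  linfun (fun H : subvs_of (cartan D) => f (vsval H) : C^o).

Lemma wt_ofE (f : D -> C) (H : subvs_of (cartan D)) :
  (forall a X Y, f (a *: X + Y) = a * f X + f Y) -> wt_of f H = f (vsval H).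
Proof.
move=> flin.
have glin : linear (fun H : subvs_of (cartan D) => f (vsval H) : C^o).
  by move=> a X Y; rewrite linearP flin.
pose g := HB.pack (fun H : subvs_of (cartan D) => f (vsval H) : C^o)
  (GRing.isLinear.Build _ _ _ _ _ glin)
  : {linear subvs_of (cartan D) -> C^o}.
exact: (lfunE g).
Qed.

Definition coweight (la : weight) : subvs_of (cartan D) :=
  xget 0 [set H | forall H', sform (vsval H) (vsval H') = la H'].

Definition wform (la mu : weight) : C :=
  sform (vsval (coweight la)) (vsval (coweight mu)).

Definition root_space (p : bool) (al : weight) : set D :=
  [set X | X \in hpart D p /\
           forall H : subvs_of (cartan D), brk (vsval H) X = al H *: X].

Definition sroot (p : bool) : set weight :=
  [set al | al != 0 /\ exists2 X, root_space p al X & X != 0].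

Definition sroots : set weight := sroot false `|` sroot true.

Definition root_parity (al : weight) : nat := `[< sroot true al >].

(* Positive systems are the sets of roots that are positive at a regular
   point of the Cartan subalgebra on which all roots are real. *)
Definition positive_system (P : set weight) : Prop :=
  exists H0 : subvs_of (cartan D),
    (forall al, sroots al -> al H0 \is Num.real /\ al H0 != 0) /\
    P = [set al | sroots al /\ 0 < al H0].

Section WithPositiveSystem.
Variable P : set weight.

Definition rho : weight :=
  2^-1 *: (\sum_(al \in P `&` sroot false) al -
           \sum_(al \in P `&` sroot true) al).

Definition weight_gt (nu mu : weight) : Prop :=
  nu - mu != 0 /\
  exists n : weight -> nat, nu - mu = \sum_(al \in P) al *+ n al.

Definition odd_nilradical (s : C) : set D :=
  [set X | exists Y : weight -> D,
     (forall al, (P `&` sroot true) al -> root_space true (s *: al) (Y al)) /\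
     X = \sum_(al \in P `&` sroot true) Y al].

End WithPositiveSystem.

Section RealForm.
Variable omega : D -> D.

Definition antiinvolution : Prop :=
  [/\ forall p X, X \in hpart D p -> omega X \in hpart D p,
      forall (a : C) X Y, X \in galg -> Y \in galg ->
        omega (a *: X + Y) = a^* *: omega X + omega Y,
      forall X, X \in galg -> omega (omega X) = X &
      forall X Y, X \in galg -> Y \in galg ->
        omega (brk X Y) = brk (omega Y) (omega X)].

Definition even_real_form : set D :=
  [set X | X \in hpart D false /\ omega X = - X].

Definition complexification (k : set D) : set D :=
  [set X + 'i *: Y | X in k & Y in k].

(* Compact subalgebras are those whose adjoint action on the even real form
   preserves a Euclidean inner product; the centres occurring here are compact,
   so maximal ones contain them. *)
Definition compact_subalgebra (k : set D) : Prop :=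
  [/\ k `<=` even_real_form,
      k 0,
      forall (a : C) X Y, a \is Num.real -> k X -> k Y -> k (a *: X + Y),
      forall X Y, k X -> k Y -> k (brk X Y) &
      exists B : D -> D -> C,
        [/\ forall X Y, even_real_form X -> even_real_form Y ->
              B X Y \is Num.real /\ B X Y = B Y X,
            forall (a : C) X Y Z, a \is Num.real -> even_real_form X ->
              even_real_form Y -> even_real_form Z ->
              B (a *: X + Y) Z = a * B X Z + B Y Z,
            forall X, even_real_form X -> X != 0 -> 0 < B X X &
            forall X Y Z, k X -> even_real_form Y -> even_real_form Z ->
              B (brk X Y) Z = - B Y (brk X Z)]].

Definition maximal_compact (k : set D) : Prop :=
  compact_subalgebra k /\
  forall k', compact_subalgebra k' -> k `<=` k' -> k' = k.

Definition adapted (P : set weight) (eps : C) : Prop :=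
  (eps = 1 \/ eps = -1) /\
  exists (N : nat) (dl x : 'I_N -> D),
    [/\ basis_for (odd_nilradical P 1) dl,
        basis_for (odd_nilradical P (-1)) x,
        forall i j, sform (dl i) (x j) = (i == j)%:R &
        forall i, omega (x i) = eps *: dl i].

End RealForm.

(* Representations of g. The action is a total function on the ambient space;
   only its values on g matter. *)
Record srep := SRep {
  srep_sp :> lmodType C;
  sact : D -> srep_sp -> srep_sp;
  sgrade : bool -> set srep_sp;
  sact_linl : forall v, linear (sact^~ v);
  sact_linr : forall X, linear (sact X);
  sgrade_sub : forall p, lin_subspace (sgrade p);
  sgrade_sum : forall v, exists u w,
    [/\ sgrade false u, sgrade true w & v = u + w];
  sgrade_cap : forall v, sgrade false v -> sgrade true v -> v = 0;
  sact_grade : forall p q X v,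
    X \in hpart D p -> sgrade q v -> sgrade (p (+) q) (sact X v);
  sact_brk : forall p q X Y v, X \in hpart D p -> Y \in hpart D q ->
    sact (brk X Y) v =
      sact X (sact Y v) - (-1) ^+ (p && q) *: sact Y (sact X v)
}.

Record erep := ERep {
  erep_sp :> lmodType C;
  eact : D -> erep_sp -> erep_sp;
  eact_linl : forall v, linear (eact^~ v);
  eact_linr : forall X, linear (eact X);
  eact_brk : forall X Y v, X \in hpart D false -> Y \in hpart D false ->
    eact (brk X Y) v = eact X (eact Y v) - eact Y (eact X v)
}.

Definition weight_space (V : lmodType C) (act : D -> V -> V) (mu : weight) :
    set V :=
  [set v | forall H : subvs_of (cartan D), act (vsval H) v = mu H *: v].

Definition simple_hw (P : set weight) (La : weight) (V : srep) : Prop :=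
  (exists v : V, [/\ v != 0, weight_space (@sact V) La v &
     forall p al X, P al -> root_space p al X -> sact X v = 0]) /\
  (forall W : set V, lin_subspace W ->
     (forall v u w, W v -> sgrade false u -> sgrade true w -> v = u + w ->
        W u /\ W w) ->
     (forall X v, X \in galg -> W v -> W (sact X v)) ->
     W = [set 0] \/ W = setT).

Definition simple_hw0 (P0 : set weight) (mu : weight) (V : erep) : Prop :=
  (exists v : V, [/\ v != 0, weight_space (@eact V) mu v &
     forall al X, P0 al -> root_space false al X -> eact X v = 0]) /\
  (forall W : set V, lin_subspace W ->
     (forall X v, X \in hpart D false -> W v -> W (eact X v)) ->
     W = [set 0] \/ W = setT).

Definition unitary_rep (omega : D -> D) (V : srep) : Prop :=
  exists f : {dot V for @Num.conj C},
    (forall v w, sgrade false v -> sgrade true w -> f v w = 0) /\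
    (forall X v w, X \in galg -> f (sact X v) w = f v (sact (omega X) w)).

Definition unitary_rep0 (omega : D -> D) (V : erep) : Prop :=
  exists f : {dot V for @Num.conj C},
    forall X v w, X \in hpart D false ->
      f (eact X v) w = f v (eact (omega X) w).

(* The restriction of V to the even part is isomorphic to the finite direct
   sum, over mu in S, of m mu copies of L0 mu: the summands are listed as
   L0 (wt i), i < N, and phi is the isomorphism. *)
Definition decomposition (V : srep) (L0 : weight -> erep) (m : weight -> nat)
    (S : set weight) : Prop :=
  exists (N : nat) (wt : 'I_N -> weight) (phi : forall i, L0 (wt i) -> V),
    [/\ forall i, S (wt i),
        forall i, linear (@phi i),
        forall i X v, X \in hpart D false -> phi i (eact X v) = sact X (phi i v),
        forall v, exists! x : forall i, L0 (wt i), v = \sum_(i < N) phi i (x i) &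
        forall mu, m mu = #|[set i | wt i == mu]%SET|].

Section Branching.
Variables (omega : D -> D) (P : set weight) (eps : C) (k : set D).

Definition noncompact_pos : set weight :=
  [set be | (P `&` sroot false) be /\
            ~ (root_space false be `<=` complexification k)].

(* nc tells whether noncompact even roots are allowed to contribute. *)
Definition Gam (nc : bool) : set weight :=
  [set ga | exists (S : set weight) (n : weight -> nat),
     [/\ S `<=` P `&` sroot true,
         ~~ nc -> forall be, n be = 0%N &
         ga = \sum_(al \in S) al + \sum_(be \in noncompact_pos) be *+ n be]].

Definition casimir_value (mu : weight) : C := wform (mu + rho P *+ 2) mu.

Variable L0 : weight -> erep.

Definition GamLa (nc : bool) (La : weight) : set weight :=
  [set ga | [/\ Gam nc ga, unitary_rep0 omega (L0 (La - ga)) &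
     ga != 0 -> 0 < - eps * (casimir_value (La - ga) - casimir_value La)]].

Definition LaGam (nc : bool) (La : weight) : set weight :=
  [set La - ga | ga in GamLa nc La].

Definition hw_mult (nu mu : weight) : nat := fdim (weight_space (@eact (L0 nu)) mu).

Definition Bcoef (La mu nu : weight) : C :=
  (2 * \sum_(al \in P) \sum_(j \in [set j : nat | (1 <= j)%N])
         (-1) ^+ (j.+1 * root_parity al) * wform (mu + al *+ j) al *
         (hw_mult nu (mu + al *+ j))%:R)
    / (casimir_value La - casimir_value mu)
  - (hw_mult nu mu)%:R.

End Branching.
End Basics.

Section Matrices.
Variables m n : nat.

Definition block_parity (p : bool) (X : 'M[C]_(m + n)) : Prop :=
  if p then ulsubmx X = 0 /\ drsubmx X = 0
  else ursubmx X = 0 /\ dlsubmx X = 0.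

Definition mx_odd (X : 'M[C]_(m + n)) : 'M[C]_(m + n) :=
  block_mx 0 (ursubmx X) (dlsubmx X) 0.

(* XY - (-1)^(p(X)p(Y)) YX, extended bilinearly. *)
Definition supercommutator (X Y : 'M[C]_(m + n)) : 'M[C]_(m + n) :=
  X *m Y - Y *m X + (mx_odd Y *m mx_odd X) *+ 2.

Definition supertrace (X : 'M[C]_(m + n)) : C :=
  \tr (ulsubmx X) - \tr (drsubmx X).

End Matrices.

Section SL.
Variables m n : nat.

(* When m = n the supertrace condition is vacuous and this is gl(n|n). *)
Definition sl_data : superData := {|
  ambient := 'M[C]_(m + n);
  brk := @supercommutator m n;
  hpart := fun p => vs_of [set X : 'M[C]_(m + n) |
    block_parity p X /\ (m != n -> supertrace X = 0)];
  cartan := vs_of [set X : 'M[C]_(m + n) |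
    is_diag_mx X /\ (m != n -> supertrace X = 0)];
  sform := fun X Y => supertrace (X *m Y)
|}.

Definition sl_eps (i : 'I_m) : weight sl_data :=
  @wt_of sl_data (fun H : 'M[C]_(m + n) => H (lshift n i) (lshift n i)).

Definition sl_delta (a : 'I_n) : weight sl_data :=
  @wt_of sl_data (fun H : 'M[C]_(m + n) => H (rshift m a) (rshift m a)).

Definition sl_even_pos : set (weight sl_data) :=
  [set al | (exists i j : 'I_m, (i < j)%N /\ al = sl_eps i - sl_eps j) \/
            (exists a b : 'I_n, (a < b)%N /\ al = sl_delta a - sl_delta b)].

Definition sl_J (p : nat) (s : C) : 'M[C]_(m + n) :=
  block_mx (diag_mx (\row_(i < m) (if (i < p)%N then 1 else -1))) 0 0 s%:M.

Definition sl_omega_type (omega : sl_data -> sl_data) : Prop :=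
  exists (p : nat) (s : C),
    [/\ (p <= m)%N, s = 1 \/ s = -1 &
        forall X : 'M[C]_(m + n), X \in galg sl_data ->
          omega X = invmx (sl_J p s) *m adjoint_mx X *m sl_J p s].

End SL.

Definition Omega n : 'M[C]_(n + n) := block_mx 0 1%:M (- 1%:M) 0.

(* diag(t_0 K, ..., t_(r-1) K, 0), with r = floor (m / 2) and
   K = (0, i; -i, 0). *)
Definition K_blocks m (t : nat -> C) : 'M[C]_m :=
  \matrix_(k < m, l < m)
    if ~~ odd k && (l == k.+1 :> nat) then 'i * t k./2
    else if ~~ odd l && (k == l.+1 :> nat) then - 'i * t l./2
    else 0.

Section OSP.
Variables m n : nat.

Definition osp_mx (X : 'M[C]_(m + (n + n))) : Prop :=
  [/\ ulsubmx X = - (ulsubmx X)^T,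
      drsubmx X = Omega n *m (drsubmx X)^T *m Omega n &
      dlsubmx X = - (Omega n *m (ursubmx X)^T)].

Definition osp_cartan_mx (t : nat -> C) (d : 'rV[C]_n) : 'M[C]_(m + (n + n)) :=
  block_mx (K_blocks m t) 0 0
    ('i *: (Omega n *m block_mx (diag_mx d) 0 0 (diag_mx d))).

Definition osp_data : superData := {|
  ambient := 'M[C]_(m + (n + n));
  brk := @supercommutator m (n + n);
  hpart := fun p => vs_of [set X : 'M[C]_(m + (n + n)) |
    block_parity p X /\ osp_mx X];
  cartan := vs_of [set X : 'M[C]_(m + (n + n)) |
    exists t d, X = osp_cartan_mx t d];
  sform := fun X Y => 2^-1 * supertrace (X *m Y)
|}.

(* In osp_cartan_mx t d, the entry of the upper left block at (2i, 2i+1) is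
   'i * t_i, and that of the lower right block at (a, n + a) is 'i * d_a. *)
Definition osp_eps (i : 'I_(m./2)) : weight osp_data :=
  @wt_of osp_data (fun H : 'M[C]_(m + (n + n)) =>
    - 'i * mx_entry (ulsubmx H) i.*2 i.*2.+1).

Definition osp_delta (a : 'I_n) : weight osp_data :=
  @wt_of osp_data (fun H : 'M[C]_(m + (n + n)) =>
    - 'i * drsubmx H (lshift n a) (rshift n a)).

Definition osp_even_pos : set (weight osp_data) :=
  [set al |
    (exists a b : 'I_n, (a < b)%N /\
       (al = osp_delta a - osp_delta b \/ al = osp_delta a + osp_delta b)) \/
    (exists a : 'I_n, al = osp_delta a *+ 2) \/
    (exists i j : 'I_(m./2), (i < j)%N /\
       (al = osp_eps i - osp_eps j \/ al = osp_eps i + osp_eps j)) \/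
    (odd m /\ exists i : 'I_(m./2), al = osp_eps i)].

(* i * (direct sum of copies of Omega_1) is K_blocks with all t_i = 1. *)
Definition osp_omega_type (omega : osp_data -> osp_data) : Prop :=
  exists2 J : 'M[C]_(m + (n + n)),
    exists2 s : C, s = 1 \/ s = -1 &
      J = block_mx s%:M 0 0 ('i *: Omega n) \/
      (~~ odd m /\ J = block_mx (K_blocks m (fun _ => 1)) 0 0 s%:M) &
    forall X : 'M[C]_(m + (n + n)), X \in galg osp_data ->
      omega X = invmx J *m adjoint_mx X *m J.

End OSP.

Section F4.

Definition mx2 (a b c d : C) : 'M[C]_2 :=
  block_mx (a%:M : 'M_1) (b%:M : 'M_1) (c%:M : 'M_1) (d%:M : 'M_1).

Definition sigma_x : 'M[C]_2 := mx2 0 1 1 0.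
Definition sigma_y : 'M[C]_2 := mx2 0 (- 'i) 'i 0.
Definition sigma_z : 'M[C]_2 := mx2 1 0 0 (-1).

(* Generators of the Clifford algebra of C^7:
   gamma_i gamma_j + gamma_j gamma_i = 2 delta_ij. *)
Definition gamma (i : 'I_7) : 'M[C]_8 :=
  nth 0 [:: sigma_x *t 1%:M     *t (1%:M : 'M_2);
            sigma_y *t 1%:M     *t (1%:M : 'M_2);
            sigma_z *t sigma_x  *t (1%:M : 'M_2);
            sigma_z *t sigma_y  *t (1%:M : 'M_2);
            sigma_z *t sigma_z  *t sigma_x;
            sigma_z *t sigma_z  *t sigma_y;
            sigma_z *t sigma_z  *t sigma_z] i.

(* For A in so(7), [spin A, gamma v] = gamma (A v), so this is the spin
   representation. *)
Definition spin (A : 'M[C]_7) : 'M[C]_8 :=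
  4^-1 *: \sum_(i < 7) \sum_(j < 7) A i j *: (gamma i *m gamma j).

(* (s, t) |-> s^T spin_form t is an so(7)-invariant symmetric form on the spin
   representation. *)
Definition spin_form : 'M[C]_8 := gamma (inord 1) *m gamma (inord 3) *m gamma (inord 5).

Definition F4_space : vectType C := ('M[C]_7 * 'M[C]_2 * 'M[C]_(8, 2))%type.

(* An odd element Q stands for a tensor in spin (x) C^2, with
   s (x) u = s u^T. For Q = s (x) u, P = t (x) v and the symplectic form
   w(u, v) = u^T Omega_1 v, the two components of [Q, P] below are
   2 w(u, v) (s^T spin_form gamma_i gamma_j t)_(i != j) in so(7) and
   3 (s^T spin_form t) (u v^T + v u^T) Omega_1 in sl(2). The ratio 2 : 3 is the
   one forced by the Jacobi identity on odd elements. *)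
Definition F4_odd_so7 (Q P : 'M[C]_(8, 2)) : 'M[C]_7 :=
  2 *: \matrix_(i < 7, j < 7)
    (if i == j then 0
     else \tr (Q^T *m spin_form *m gamma i *m gamma j *m P *m (Omega 1)^T)).

Definition F4_odd_sl2 (Q P : 'M[C]_(8, 2)) : 'M[C]_2 :=
  3 *: ((Q^T *m spin_form *m P + P^T *m spin_form *m Q) *m Omega 1).

Definition F4_act (A : 'M[C]_7) (a : 'M[C]_2) (Q : 'M[C]_(8, 2)) :
    'M[C]_(8, 2) :=
  spin A *m Q + Q *m a^T.

Definition F4_brk (X Y : F4_space) : F4_space :=
  let: (A, a, Q) := X in
  let: (B, b, P) := Y in
  (commutator A B + F4_odd_so7 Q P,
   commutator a b + F4_odd_sl2 Q P,
   F4_act A a P - F4_act B b Q).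

Definition F4_hpart (p : bool) : {vspace F4_space} :=
  vs_of (if p then [set X : F4_space | X.1.1 = 0 /\ X.1.2 = 0]
         else [set X : F4_space | [/\ X.1.1 = - X.1.1^T, \tr X.1.2 = 0 & X.2 = 0]]).

Definition F4_data : superData := {|
  ambient := F4_space;
  brk := F4_brk;
  hpart := F4_hpart;
  cartan := vs_of [set X : F4_space |
    exists t c, X = (K_blocks 7 t, mx2 c 0 0 (- c), 0)];
  sform := fun X Y =>
    let f := fun Z => F4_brk X (F4_brk Y Z) in
    6^-1 * (trace_on (F4_hpart false) f - trace_on (F4_hpart true) f)
|}.

Definition F4_eps (i : 'I_3) : weight F4_data :=
  @wt_of F4_data (fun H : F4_space => - 'i * mx_entry H.1.1 i.*2 i.*2.+1).

Definition F4_delta : weight F4_data :=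
  @wt_of F4_data (fun H : F4_space => H.1.2 0 0 - H.1.2 1 1).

Definition F4_even_pos : set (weight F4_data) :=
  [set al | al = F4_delta \/ (exists i, al = F4_eps i) \/
    (exists i j : 'I_3, (i < j)%N /\
       (al = F4_eps i - F4_eps j \/ al = F4_eps i + F4_eps j))].

Definition real_so_sl (p : nat) (S2 : set 'M[C]_2) : set ('M[C]_7 * 'M[C]_2) :=
  let I_pq := diag_mx (\row_(i < 7) (if (i < p)%N then 1 else -1)) in
  [set X | [/\ X.1 \is a mxOver Num.real,
               X.1^T *m I_pq + I_pq *m X.1 = 0 & S2 X.2]].

Definition real_sl2 : set 'M[C]_2 :=
  [set a | a \is a mxOver Num.real /\ \tr a = 0].

Definition su2 : set 'M[C]_2 := [set a | adjoint_mx a = - a /\ \tr a = 0].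

Definition F4_even_iso (omega : F4_data -> F4_data)
    (S : set ('M[C]_7 * 'M[C]_2)) : Prop :=
  exists phi : 'M[C]_7 * 'M[C]_2 -> F4_data,
    [/\ set_bij S (even_real_form omega) phi,
        forall (a : C) X Y, a \is Num.real -> S X -> S Y ->
          phi (a *: X + Y) = a *: phi X + phi Y &
        forall X Y, S X -> S Y ->
          phi (commutator X.1 Y.1, commutator X.2 Y.2) =
          brk (phi X) (phi Y)].

(* The Cartan subalgebra is fixed, so the second clause is a condition on
   omega. *)
Definition F4_omega_type (omega : F4_data -> F4_data) : Prop :=
  (F4_even_iso omega (real_so_sl 7 real_sl2) \/
   F4_even_iso omega (real_so_sl 2 su2)) /\
  exists2 k : set F4_data, maximal_compact omega k &
    [set H | H \in cartan F4_data] =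
    complexification (k `&` [set H | H \in cartan F4_data]).

End F4.

Inductive super_type := SL (m n : nat) | OSP (m n : nat) | F4.

Definition admissible_type (t : super_type) : Prop :=
  match t with
  | SL m n | OSP m n => (1 <= m)%N /\ (1 <= n)%N
  | F4 => True
  end.

Definition data (t : super_type) : superData :=
  match t with
  | SL m n => sl_data m n
  | OSP m n => osp_data m n
  | F4 => F4_data
  end.

Definition even_pos (t : super_type) : set (weight (data t)) :=
  match t with
  | SL m n => @sl_even_pos m n
  | OSP m n => @osp_even_pos m n
  | F4 => F4_even_pos
  end.

Definition omega_type (t : super_type) : (data t -> data t) -> Prop :=
  match t with
  | SL m n => @sl_omega_type m n
  | OSP m n => @osp_omega_type m n
  | F4 => F4_omega_type
  end.

Definition nc_allowed (t : super_type) : bool :=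
  if t is SL _ _ then false else true.

End LieSuperalgebras.

(* Main.v *)
(* The Casimir element attached to an invariant form acts on V by the scalar
   c(La) = (La + 2 rho, La). Computing its trace on the weight space of weight mu
   gives Freudenthal's formula, (c(La) - c(mu)) d(mu) as twice the sum of the signed
   (mu + k al, al) d(mu + k al). Since m La = 1, a_{mu,mu} = 1, and mu is a weight of
   L0 nu only for nu = mu or nu > mu, splitting the dimensions d along the
   decomposition turns this into the recursion; c(La) - c(mu) does not vanish for mu
   in S because of the Casimir inequality in the definition of GamLa.

   Only root vectors, the Cartan subalgebra and the form enter this argument. For
   osp(m|2n) a change of basis diagonalises the Cartan subalgebra; on F(4) the form is
   tr(AB)/2 - 2 tr(ab)/3 on the even part and -4 tr(Q^T S P Omega) on the odd part,
   where S = spin_form. *)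
Require Import Defs.
From HB Require Import structures.
From mathcomp Require Import all_boot all_order all_algebra.
From mathcomp Require Import mxtens complex ring.
From mathcomp Require Import boolp classical_sets functions cardinality fsbigop.
From mathcomp Require Import reals.

Set Implicit Arguments.
Unset Strict Implicit.
Unset Printing Implicit Defensive.

Import Order.TTheory GRing.Theory Num.Theory.
Local Open Scope classical_set_scope.
Local Open Scope ring_scope.

(** * Coordinates and traces *)

(** The traces need finite-dimensional weight spaces, and the root strings need a common stopping
    point. Both come from the regular element [H0] that cuts out the positive system: a weight of
    the module is [La] minus a sum of positive roots, each positive at [H0], and the archimedean
    property then bounds the number of roots.

    Traces are ordinary, not super: for an odd root, exchanging a root vector with its dual reverses
    the sign of the remaining trace, which builds up the factor (-1)^((k+1)p) along a string. A
    positive root and its opposite climb the same string, one from k = 0, the other from k = 1. The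
    k = 0 term cancels the 2 rho part of c(mu), and the rest occurs twice.

    The three families share a [root_datum]: a nondegenerate invariant form and one-dimensional root
    spaces. For osp the algebra is the super exterior square of the standard representation, so its
    roots are sums of two weights, and multiplicity one means recovering an unordered pair from its
    sum. *)

Section UnbundledLinear.
Variables (C : numClosedFieldType) (U V : lmodType C) (f : U -> V).
Hypothesis flin : linear f.

Let f' : {linear U -> V} := HB.pack f (GRing.isLinear.Build _ _ _ _ _ flin).

Lemma lin0 : f 0 = 0. Proof. exact: (linear0 f'). Qed.
Lemma linD u v : f (u + v) = f u + f v. Proof. exact: (linearD f'). Qed.
Lemma linN u : f (- u) = - f u. Proof. exact: (linearN f'). Qed.
Lemma linB u v : f (u - v) = f u - f v. Proof. exact: (linearB f'). Qed.
Lemma linZ c u : f (c *: u) = c *: f u. Proof. exact: (linearZZ f'). Qed.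
Lemma lin_sum (J : Type) (r : seq J) (Q : pred J) (g : J -> U) :
  f (\sum_(i <- r | Q i) g i) = \sum_(i <- r | Q i) f (g i).
Proof. exact: (linear_sum f'). Qed.
Lemma lin_comb (J : Type) (r : seq J) (Q : pred J) (c : J -> C) (g : J -> U) :
  f (\sum_(i <- r | Q i) c i *: g i) = \sum_(i <- r | Q i) c i *: f (g i).
Proof. by rewrite lin_sum; apply: eq_bigr => i _; rewrite linZ. Qed.

End UnbundledLinear.

Section FiniteBases.
Variable C : numClosedFieldType.
Variable V : lmodType C.
Implicit Types W : set V.

(** [V] may be infinite-dimensional, so subspaces are predicates and only some of them have such a
    basis. The index type is any finite type, since the basis of a direct sum is indexed by
    dependent pairs. *)
Definition fbasis (I : finType) W (e : I -> V) : Prop :=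
  [/\ forall i, W (e i),
      forall w, W w -> exists c : I -> C, w = \sum_i c i *: e i &
      forall c : I -> C, \sum_i c i *: e i = 0 -> forall i, c i = 0].

Lemma lin_subspace_sum W (I : finType) (Q : pred I) (g : I -> V) (c : I -> C) :
  lin_subspace W -> (forall i, Q i -> W (g i)) ->
  W (\sum_(i | Q i) c i *: g i).
Proof.
move=> [W0 Wl] Wg; elim/big_rec: _ => // i x Qi Wx.
by apply: Wl => //; apply: Wg.
Qed.

Lemma lin_subspaceZ W c w : lin_subspace W -> W w -> W (c *: w).
Proof. by move=> [W0 Wl] Ww; rewrite -[_ *: _]addr0; apply: Wl. Qed.

Lemma lin_subspaceD W u w : lin_subspace W -> W u -> W w -> W (u + w).
Proof. by move=> [W0 Wl] Wu Ww; rewrite -[u]scale1r; apply: Wl. Qed.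

Lemma fbasis_uniq (I : finType) W (e : I -> V) (c c' : I -> C) :
  fbasis W e -> \sum_i c i *: e i = \sum_i c' i *: e i -> c =1 c'.
Proof.
move=> [_ _ ind] /eqP; rewrite -subr_eq0 -sumrB => /eqP h i.
apply/eqP; rewrite -subr_eq0; apply/eqP.
apply: (ind (fun i => c i - c' i)); rewrite -[RHS]h; apply: eq_bigr => j _.
by rewrite scalerBl.
Qed.

(** Zero is a default for vectors outside the span. *)
Definition coordf (I : finType) (e : I -> V) (w : V) : I -> C :=
  xget (fun=> 0) [set c : I -> C | w = \sum_i c i *: e i].

Lemma coordfK (I : finType) W (e : I -> V) w :
  fbasis W e -> W w -> w = \sum_i coordf e w i *: e i.
Proof.
by move=> [_ gen _] /gen[c wc]; rewrite /coordf; case: xgetP => [c' _ //|/(_ c)].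
Qed.

Lemma coordfE (I : finType) W (e : I -> V) w c :
  fbasis W e -> w = \sum_i c i *: e i -> coordf e w =1 c.
Proof.
move=> be we; apply: (fbasis_uniq be); rewrite -we /coordf.
by case: xgetP => [c' _ <-//|/(_ c)].
Qed.

Definition tracef (I : finType) (e : I -> V) (f : V -> V) : C :=
  \sum_i coordf e (f (e i)) i.

(** Both sides are the sum of A_ij B_ji for the matrices of [f] and [g]. The two subspaces may
    differ: later they are the weight spaces of [mu] and [mu + a i]. *)
Lemma tracef_comp (I J : finType) W W' (e : I -> V) (e' : J -> V) (f g : V -> V) :
  fbasis W e -> fbasis W' e' -> linear f -> linear g ->
  (forall w, W w -> W' (f w)) -> (forall w, W' w -> W (g w)) ->
  tracef e (g \o f) = tracef e' (f \o g).
Proof.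
move=> be be' lf lg fW gW.
have [We _ _] := be; have [We' _ _] := be'.
pose A i := coordf e' (f (e i)); pose B j := coordf e (g (e' j)).
have fe i : f (e i) = \sum_j A i j *: e' j by apply: (coordfK be'); apply: fW.
have ge j : g (e' j) = \sum_i B j i *: e i by apply: (coordfK be); apply: gW.
transitivity (\sum_i \sum_j A i j * B j i).
  apply: eq_bigr => i _; apply: (coordfE (c := fun k => \sum_j A i j * B j k) be).
  rewrite /= fe lin_comb //.
  under [LHS]eq_bigr do rewrite ge scaler_sumr.
  rewrite exchange_big /=; apply: eq_bigr => k _; rewrite scaler_suml.
  by apply: eq_bigr => j _; rewrite scalerA.
rewrite exchange_big /=; apply: eq_bigr => j _; symmetry.
rewrite (coordfE (c := fun k => \sum_i B j i * A i k) be') /=.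
  by apply: eq_bigr => i _; rewrite mulrC.
rewrite ge lin_comb //.
under [LHS]eq_bigr do rewrite fe scaler_sumr.
rewrite exchange_big /=; apply: eq_bigr => k _; rewrite scaler_suml.
by apply: eq_bigr => i _; rewrite scalerA.
Qed.

Lemma tracefD (I : finType) W (e : I -> V) (f g : V -> V) :
  fbasis W e -> (forall w, W w -> W (f w)) -> (forall w, W w -> W (g w)) ->
  tracef e (fun w => f w + g w) = tracef e f + tracef e g.
Proof.
move=> be fW gW; have [We _ _] := be; rewrite -big_split /=.
apply: eq_bigr => i _.
apply: (coordfE (c := fun k => coordf e (f (e i)) k + coordf e (g (e i)) k) be).
rewrite {1}(coordfK be (fW _ (We i))) {1}(coordfK be (gW _ (We i))) -big_split.
by apply: eq_bigr => j _; rewrite scalerDl.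
Qed.

Lemma tracefZ (I : finType) W (e : I -> V) (f : V -> V) c :
  fbasis W e -> (forall w, W w -> W (f w)) ->
  tracef e (fun w => c *: f w) = c * tracef e f.
Proof.
move=> be fW; have [We _ _] := be; rewrite mulr_sumr.
apply: eq_bigr => i _.
apply: (coordfE (c := fun k => c * coordf e (f (e i)) k) be).
rewrite {1}(coordfK be (fW _ (We i))) scaler_sumr.
by apply: eq_bigr => j _; rewrite scalerA.
Qed.

Lemma tracef_sum (J : finType) (Q : pred J) (I : finType) W (e : I -> V)
    (f : J -> V -> V) :
  fbasis W e -> lin_subspace W -> (forall j w, Q j -> W w -> W (f j w)) ->
  tracef e (fun w => \sum_(j | Q j) f j w) = \sum_(j | Q j) tracef e (f j).
Proof.
move=> be sW fW; have [We _ _] := be; rewrite exchange_big /=.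
apply: eq_bigr => i _.
apply: (coordfE (c := fun k => \sum_(j | Q j) coordf e (f j (e i)) k) be).
under eq_bigr => j Qj do rewrite (coordfK be (fW j _ Qj (We i))).
by rewrite exchange_big /=; apply: eq_bigr => j _; rewrite scaler_suml.
Qed.

Lemma eq_tracef (I : finType) W (e : I -> V) (f g : V -> V) :
  fbasis W e -> (forall w, W w -> f w = g w) -> tracef e f = tracef e g.
Proof. by move=> [We _ _] fg; apply: eq_bigr => i _; rewrite fg. Qed.

Lemma tracef_scalar (I : finType) W (e : I -> V) (c : C) :
  fbasis W e -> tracef e (fun w => c *: w) = c * #|I|%:R.
Proof.
move=> be; rewrite -sumr_const mulr_sumr; apply: eq_bigr => i _; rewrite mulr1.
rewrite (coordfE (c := fun k => (k == i)%:R * c) be) ?eqxx ?mul1r //.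
rewrite (bigD1 i) //= eqxx mul1r big1 ?addr0 // => k /negPf ->.
by rewrite mul0r scale0r.
Qed.

(** Apply [tracef_comp] to two identity maps: the traces are the two cardinalities, and the field
    has characteristic zero. *)
Lemma fbasis_card (I J : finType) W (e : I -> V) (e' : J -> V) :
  fbasis W e -> fbasis W e' -> #|I| = #|J|.
Proof.
move=> be be'; apply/eqP; rewrite -(eqr_nat C); apply/eqP.
have lid : linear (fun w : V => w) by [].
have := tracef_comp be be' lid lid (fun w Ww => Ww) (fun w Ww => Ww).
have id1 (K : finType) (h : K -> V) : tracef h ((fun w => w) \o (fun w => w)) =
    tracef h (fun w => 1 *: w).
  by apply: eq_bigr => i _ /=; rewrite scale1r.
by rewrite !id1 (tracef_scalar 1 be) (tracef_scalar 1 be') !mul1r.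
Qed.

Lemma fbasis_reindex (I J : finType) W (e : I -> V) (h : J -> I) :
  bijective h -> fbasis W e -> fbasis W (e \o h).
Proof.
move=> bh [We gen ind]; have [h' hK h'K] := bh; split => [j|w /gen[c ->]|c sc j] /=.
- exact: We.
- by exists (c \o h); rewrite (reindex h) //=; apply: onW_bij.
rewrite -[j]hK; apply: (ind (c \o h')); rewrite -[RHS]sc (reindex h) /=.
  by apply: eq_bigr => i _; rewrite hK.
exact: onW_bij.
Qed.

Lemma fbasis_basis_for n W (e : 'I_n -> V) :
  lin_subspace W -> (fbasis W e <-> basis_for W e).
Proof.
move=> sW; split=> [be|[fun_e inj_e surj_e]].
  have [We gen _] := be; split.
  - by move=> c _; apply: lin_subspace_sum.
  - move=> c c' _ _ /(fbasis_uniq be) cc'.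
    by apply/rowP => i; apply: cc'.
  - move=> w /gen[c ->]; exists (\row_i c i) => //.
    by apply: eq_bigr => i _; rewrite mxE.
have inj c c' : \sum_(i < n) c i *: e i = \sum_(i < n) c' i *: e i -> c =1 c'.
  move=> cc' i; have := inj_e (\row_j c j) (\row_j c' j).
  move=> /(_ (mem_set I) (mem_set I)).
  under eq_bigr do rewrite mxE.
  under [X in _ = X -> _]eq_bigr do rewrite mxE.
  by move=> /(_ cc') /rowP /(_ i); rewrite !mxE.
split=> [i|w /surj_e[c _ <-]|c c0].
- have := fun_e (delta_mx 0 i) I; rewrite (bigD1 i) //= mxE !eqxx scale1r big1.
    by rewrite addr0.
  by move=> j /negPf ji; rewrite mxE ji andbF scale0r.
- by exists (c 0).
apply: (inj _ (fun=> 0)); rewrite c0 big1 // => i _; exact: scale0r.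
Qed.

Lemma fbasis_fdim (I : finType) W (e : I -> V) :
  lin_subspace W -> fbasis W e -> fdim W = #|I|.
Proof.
move=> sW be.
have be' : fbasis W (e \o enum_val (A := I)).
  by apply: fbasis_reindex be; apply: enum_val_bij.
have ex : exists n, [set n | exists e : 'I_n -> V, basis_for W e] n.
  by exists #|I|, (e \o enum_val (A := I)); apply/fbasis_basis_for.
have [e' /(fbasis_basis_for _ sW) be''] := xgetPex 0%N ex.
by rewrite (fbasis_card be be'') card_ord.
Qed.

(** A spanning family of minimal size is independent: a vector with nonzero coefficient in a
    relation is a combination of the others and could be dropped. *)
Lemma span_fbasis (I : finType) W (g : I -> V) :
  lin_subspace W -> (forall i, W (g i)) ->
  (forall w, W w -> exists c : I -> C, w = \sum_i c i *: g i) ->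
  exists n (e : 'I_n -> V), fbasis W e.
Proof.
move=> sW Wg gen.
pose Q n := `[< exists g : 'I_n -> V, (forall i, W (g i)) /\
  (forall w, W w -> exists c : 'I_n -> C, w = \sum_i c i *: g i) >].
have exQ : exists n, Q n.
  exists #|I|; apply/asboolP; exists (g \o enum_val (A := I)); split=> [i|w].
    exact: Wg.
  move=> /gen[c ->]; exists (c \o enum_val (A := I)).
  by rewrite (reindex (enum_val (A := I))) //; apply: onW_bij; apply: enum_val_bij.
case: (ex_minnP exQ) => n /asboolP[e [We gene]] minn.
exists n, e; split=> // c c0 i; apply: contrapT => /eqP ci.
case: n i e We gene minn c c0 ci => [[]//|n] i e We gene minn c c0 ci.
have /minn : Q n; last by rewrite ltnn.
apply/asboolP; exists (e \o lift i); split=> [j|w /gene[b ->]]; first exact: We.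
have ei : e i = \sum_j (- (c i)^-1 * c (lift i j)) *: e (lift i j).
  move: c0; rewrite (bigD1_ord i) //= => /eqP; rewrite addr_eq0 => /eqP e1.
  rewrite -[LHS]scale1r -(mulVf ci) -scalerA e1 scalerN scaler_sumr -sumrN.
  by apply: eq_bigr => j _; rewrite scalerA mulNr scaleNr.
exists (fun j => b (lift i j) + b i * (- (c i)^-1 * c (lift i j))).
rewrite (bigD1_ord i) //= ei scaler_sumr -big_split /=; apply: eq_bigr => j _.
by rewrite scalerDl scalerA addrC.
Qed.

End FiniteBases.

Lemma fbasis_dsum (C : numClosedFieldType) (V : lmodType C) (N : nat)
    (U : 'I_N -> lmodType C) (phi : forall i, U i -> V) (W : set V)
    (WU : forall i, set (U i)) (n : 'I_N -> nat) (e : forall i, 'I_(n i) -> U i) :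
  (forall i, linear (phi i)) ->
  (forall v, exists! x : forall i, U i, v = \sum_(i < N) phi i (x i)) ->
  (forall x : forall i, U i,
     W (\sum_(i < N) phi i (x i)) <-> forall i, WU i (x i)) ->
  (forall i, lin_subspace (WU i)) ->
  (forall i, fbasis (WU i) (e i)) ->
  fbasis W (fun p : {i : 'I_N & 'I_(n i)} => phi (tag p) (e _ (tagged p))).
Proof.
move=> lphi dec WP sU be.
have phi0 i : phi i 0 = 0 by apply: lin0.
have sumE (c : {i : 'I_N & 'I_(n i)} -> C) :
   \sum_p c p *: phi (tag p) (e _ (tagged p)) =
   \sum_i phi i (\sum_j c (Tagged (fun i => 'I_(n i)) j) *: e i j).
  under [RHS]eq_bigr => i _ do rewrite (lin_comb (lphi i)).
  rewrite (sig_big_dep (fun=> true) (fun _ => xpredT)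
    (fun i j => c (Tagged (fun i => 'I_(n i)) j) *: phi i (e i j))) /=.
  by apply: eq_bigr => -[i j] _.
split.
(* The family supported at [i]. Since the summands have different types, its nonzero component is
   cast along the equality of indices. *)
- case=> i j /=; pose x i' : U i' :=
    match eqVneq i i' with
    | EqNotNeq p => ecast z (U z) p (e i j) | NeqNotEq _ => 0 end.
  suff -> : phi i (e i j) = \sum_(i < N) phi i (x i).
    apply/WP => i'; rewrite /x; case: eqVneq => [p|_]; last by case: (sU i').
    by case: i' / p => /=; case: (be i).
  rewrite (bigD1 i) //= big1 => [|i' i'i].
    rewrite addr0 /x; case: eqVneq => [p|/eqP//].
    by rewrite (eq_axiomK p).
  rewrite /x; case: eqVneq => [p|_//]; by rewrite p eqxx in i'i.
- move=> w Ww; have [x [wx _]] := dec w; rewrite wx in Ww.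
  have /WP xU := Ww.
  have /fin_all_exists[c cP] i : exists c : {ffun 'I_(n i) -> C}, x i = \sum_j c j *: e i j.
    have [_ /(_ _ (xU i)) [c xc] _] := be i.
    by exists (finfun c); rewrite xc; apply: eq_bigr => j _; rewrite ffunE.
  exists (fun p => c (tag p) (tagged p)); rewrite sumE wx.
  by apply: eq_bigr => i _; rewrite cP.
- move=> c; rewrite sumE => c0 [i j].
  pose x i := \sum_j c (Tagged (fun i => 'I_(n i)) j) *: e i j.
  have x0 : x = fun=> 0.
    have [y [_ yu]] := dec 0; transitivity y; first by rewrite -(yu x).
    by apply: yu; rewrite big1.
  have := f_equal (fun f => f i) x0.
  by have [_ _ ind] := be i => /ind /(_ j).
Qed.

(** * Root data *)

(** [F] is separate from [sform] and compared with it only on the Cartan subalgebra, where [wform]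
    is computed. For F(4) the trace form then has to be evaluated on Cartan elements only. *)
Record invariant_form (C : numClosedFieldType) (D : superData C)
    (F : D -> D -> C) : Prop := InvariantForm {
  brk_linl : forall Y, linear (fun X : D => brk X Y);
  brk_linr : forall X : D, linear (brk X);
  brk_part : forall p p' (X Y : D), X \in hpart D p -> Y \in hpart D p' ->
    brk X Y \in hpart D (p (+) p');
  brk_skew : forall p p' (X Y : D), X \in hpart D p -> Y \in hpart D p' ->
    brk Y X = - ((-1) ^+ (p && p') *: brk X Y);
  cartan_even : (cartan D <= hpart D false)%VS;
  cartan_abelian : forall H H' : D, H \in cartan D -> H' \in cartan D ->
    brk H H' = 0;
  form_linl : forall Y, linear (fun X : D => F X Y : C^o);
  form_linr : forall X : D, linear (F X : D -> C^o);
  form_sym : forall p p' (X Y : D), X \in hpart D p -> Y \in hpart D p' ->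
    F Y X = (-1) ^+ (p && p') * F X Y;
  form_even : forall X Y : D, X \in hpart D false -> Y \in hpart D true ->
    F X Y = 0;
  form_inv : forall p p' p'' (X Y Z : D), X \in hpart D p ->
    Y \in hpart D p' -> Z \in hpart D p'' -> F (brk X Y) Z = F X (brk Y Z);
  form_nondeg : forall p (X : D), X \in hpart D p ->
    (forall Y : D, Y \in hpart D p -> F X Y = 0) -> X = 0;
  form_cartan : forall H H' : D, H \in cartan D -> H' \in cartan D ->
    F H H' = sform H H'
}.

(** Injectivity of [a], together with [part_span], encodes that root spaces are lines and that no
    root is both even and odd. *)
Record root_datum (C : numClosedFieldType) (D : superData C) (I : finType)
    (a : I -> weight D) (e : I -> D) (q : I -> bool) (F : D -> D -> C) : Prop :=
  RootDatum {
  root_form :> invariant_form F;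
  rootv_part : forall i, e i \in hpart D (q i);
  rootv_neq0 : forall i, e i != 0;
  rootv_wt : forall i (H : subvs_of (cartan D)),
    brk (vsval H) (e i) = a i H *: e i;
  root_neq0 : forall i, a i != 0;
  root_inj : injective a;
  part_span : forall p X, X \in hpart D p -> exists H (c : I -> C),
    [/\ H \in cartan D, p -> H = 0 & X = H + \sum_(i | q i == p) c i *: e i]
}.

(* A family of weight vectors that spans g modulo the Cartan subalgebra, possibly
   with zero or repeated vectors, suffices to build a root datum. *)
Lemma root_datum_of_family (C : numClosedFieldType) (D : superData C)
    (F : D -> D -> C) (J : finType) (a : J -> weight D) (e : J -> D)
    (q : J -> bool) :
  invariant_form F ->
  (forall j, e j \in hpart D (q j)) ->
  (forall j (H : subvs_of (cartan D)), brk (vsval H) (e j) = a j H *: e j) ->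
  (forall j, e j != 0 -> a j = 0 -> q j = false /\ e j \in cartan D) ->
  (forall i j, e i != 0 -> e j != 0 -> a i != 0 -> a i = a j ->
     q i = q j /\ exists c, e j = c *: e i) ->
  (forall p X, X \in hpart D p -> exists H (c : J -> C),
    [/\ H \in cartan D, p -> H = 0 & X = H + \sum_(j | q j == p) c j *: e j]) ->
  exists (I : finType) (a' : I -> weight D) e' q', root_datum a' e' q' F.
Proof.
move=> BF ep ew e0 mult span.
pose R j := (a j != 0) && (e j != 0).
(* The roots are the distinct nonzero weights of nonzero vectors. [rep] chooses one vector for each,
   and [co'] writes the others of the same weight as multiples of it. *)
pose s := [seq a j | j <- enum J & R j].
have repP (i : seq_sub s) : exists j, R j && (a j == val i).
  case: i => x /= xs; have /mapP[j + ->] := xs; rewrite mem_filter => /andP[Rj _].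
  by exists j; rewrite Rj eqxx.
pose rep i := xchoose (repP i).
have aR i : a (rep i) = val i by have /andP[_ /eqP] := xchooseP (repP i).
have RR i : R (rep i) by have /andP[] := xchooseP (repP i).
have co j : exists c : C, forall i, R j -> val i = a j ->
    e j = c *: e (rep i) /\ q j = q (rep i).
  case: (boolP (R j)) => [Rj|nR]; last by exists 0.
  have js : a j \in s by rewrite map_f // mem_filter Rj mem_enum.
  have [/andP[aj ej] /andP[_ ei]] := (Rj, RR (SeqSub js)).
  have [qq [c ec]] : q (rep (SeqSub js)) = q j /\
      exists c, e j = c *: e (rep (SeqSub js)).
    by apply: mult => //; rewrite aR.
  exists c => i _ ia; have -> : i = SeqSub js by apply: val_inj.
  by rewrite qq.
have /fin_all_exists[co' coP] := co.
exists (seq_sub s), val, (e \o rep), (q \o rep); split=> //.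
- by move=> i; apply: ep.
- by move=> i /=; case/andP: (RR i).
- by move=> i H; rewrite /= ew aR.
- by move=> i; rewrite -aR; case/andP: (RR i).
move=> p X /span[H [c [HH pH ->]]].
(* The members of weight zero; by [e0] they are even and are absorbed into the Cartan part. *)
pose Z j := (q j == p) && (e j != 0) && (a j == 0).
exists (H + \sum_(j | Z j) c j *: e j).
exists (fun i => \sum_(j | (q j == p) && R j && (a j == val i)) c j * co' j).
have ZP j : Z j -> p = false /\ e j \in cartan D.
  by move=> /andP[/andP[/eqP <- ej] /eqP aj]; apply: e0.
split.
- by rewrite memvD // memv_suml // => j /ZP[_ ej]; rewrite memvZ.
- move=> pT; rewrite pH // add0r big_pred0 // => j.
  by apply/negP => /ZP[]; rewrite pT.
rewrite -addrA; congr (_ + _).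
rewrite (bigID Z) /=; congr (_ + _).
  by apply: eq_bigl => j; rewrite /Z; case: (q j == p).
rewrite (bigID R) /= [X in _ + X]big1 ?addr0; last first.
  move=> j /andP[/andP[qj nZ] nR]; apply/eqP; rewrite scaler_eq0.
  by move: nZ nR; rewrite /Z /R qj /= orbC; case: (e j == 0); case: (a j == 0).
under [RHS]eq_bigr do rewrite scaler_suml.
rewrite (exchange_big_dep (fun j => (q j == p) && R j)) /=; last by move=> i j _ /andP[].
apply: eq_big => [j|j /andP[/andP[qj nZ] Rj]].
  by rewrite /Z /R; case: (q j == p); case: (e j == 0); case: (a j == 0).
have js : a j \in s by rewrite map_f // mem_filter Rj mem_enum.
rewrite (bigD1 (SeqSub js)) /=.
  rewrite -scalerA -(coP j (SeqSub js) Rj erefl).1 big1 ?addr0 // => i.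
  by rewrite -andbA => /and3P[_ /andP[_ /eqP ai] /eqP ni]; case: ni; apply/val_inj/esym/ai.
by rewrite eqxx qj Rj -(coP j (SeqSub js) Rj erefl).2 qj.
Qed.

Section WeightSpaces.
Variables (C : numClosedFieldType) (D : superData C) (V : lmodType C).
Variable act : D -> V -> V.
Hypothesis act_linr : forall X, linear (act X).

Lemma weight_lin_subspace mu : lin_subspace (weight_space act mu).
Proof.
split=> [H|c u w Wu Ww H]; first by rewrite (lin0 (act_linr _)) scaler0.
rewrite act_linr Wu Ww scalerDr !scalerA; congr (_ *: _ + _); exact: mulrC.
Qed.

Lemma weight_spaceZ mu c w :
  weight_space act mu w -> weight_space act mu (c *: w).
Proof. exact: (lin_subspaceZ _ (weight_lin_subspace mu)). Qed.

Lemma weight_spaceD mu u w :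
  weight_space act mu u -> weight_space act mu w -> weight_space act mu (u + w).
Proof. exact: (lin_subspaceD (weight_lin_subspace mu)). Qed.

Lemma weight_space_sum mu (J : finType) (Q : pred J) (g : J -> V) :
  (forall j, Q j -> weight_space act mu (g j)) ->
  weight_space act mu (\sum_(j | Q j) g j).
Proof.
move=> Wg; elim/big_rec: _ => [|j w Qj Ww]; first by case: (weight_lin_subspace mu).
by apply: weight_spaceD => //; apply: Wg.
Qed.

(** Let [nu] be the first weight and choose [H] on which it differs from a given [mu]. The operator
    [H] - nu(H) removes the first term and scales the term of [mu] by a nonzero number. *)
Lemma weight_space_indep (s : seq (weight D)) (f : weight D -> V) :
  uniq s -> (forall mu, mu \in s -> weight_space act mu (f mu)) ->
  \sum_(mu <- s) f mu = 0 -> forall mu, mu \in s -> f mu = 0.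
Proof.
elim: s f => [//|nu s IH] f /= /andP[nus us] fP sum0.
have fs0 mu : mu \in s -> f mu = 0.
  move=> mus; have munu : mu - nu != 0.
    by rewrite subr_eq0; apply: contraNneq nus => <-.
  have [H HP] : exists H, (mu - nu) H != 0.
    apply: contrapT => /forallNP h; move/eqP: munu; apply.
    by apply/lfunP => H; rewrite zero_lfunE; apply/eqP/negPn/negP/h.
  suff /eqP : (mu - nu) H *: f mu = 0.
    by rewrite scaler_eq0 (negPf HP) => /eqP.
  apply: (IH (fun mu => (mu - nu) H *: f mu) us) => // [mu' mu's|].
    have Wf : weight_space act mu' (f mu') by apply: fP; rewrite inE mu's orbT.
    exact: lin_subspaceZ (weight_lin_subspace mu') Wf.
  have : act (vsval H) (\sum_(mu <- nu :: s) f mu) -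
      nu H *: \sum_(mu <- nu :: s) f mu = 0.
    by rewrite sum0 scaler0 subr0 (lin0 (act_linr _)).
  rewrite !big_cons (linD (act_linr _)) fP ?mem_head // scalerDr.
  rewrite opprD addrACA subrr add0r => sum0'; rewrite -[RHS]sum0'.
  rewrite (lin_sum (act_linr _)) scaler_sumr -sumrB.
  apply: eq_big_seq => be bes.
  by rewrite fP ?inE ?bes ?orbT // add_lfunE opp_lfunE scalerBl.
move=> mu; rewrite inE => /predU1P[->|]; last exact: fs0.
by move: sum0; rewrite big_cons big_seq big1 ?addr0.
Qed.

End WeightSpaces.

(** * Pairing of root spaces under the invariant form *)

Section Roots.
Variables (C : numClosedFieldType) (D : superData C) (I : finType).
Variables (a : I -> weight D) (e : I -> D) (q : I -> bool) (F : D -> D -> C).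
Hypothesis B : root_datum a e q F.
Implicit Types (H : subvs_of (cartan D)) (X Y Z : D) (la mu : weight D).

Let Fl := form_linl B.
Let Fr := form_linr B.

Lemma cartan_part H : vsval H \in hpart D false.
Proof. by apply: (subvP (cartan_even B)); apply: subvsP. Qed.

Lemma rform0r X : F X 0 = 0. Proof. exact: (lin0 (Fr X)). Qed.
Lemma rformZl c X Y : F (c *: X) Y = c * F X Y. Proof. exact: (linZ (Fl Y)). Qed.
Lemma rformZr c X Y : F X (c *: Y) = c * F X Y. Proof. exact: (linZ (Fr X)). Qed.
Lemma rformDl X X' Y : F (X + X') Y = F X Y + F X' Y.
Proof. exact: (linD (Fl Y)). Qed.
Lemma rformDr X Y Y' : F X (Y + Y') = F X Y + F X Y'.
Proof. exact: (linD (Fr X)). Qed.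
Lemma rformNl X Y : F (- X) Y = - F X Y. Proof. exact: (linN (Fl Y)). Qed.
Lemma rform_suml (J : finType) (Q : pred J) (g : J -> D) Y :
  F (\sum_(j | Q j) g j) Y = \sum_(j | Q j) F (g j) Y.
Proof. exact: (lin_sum (Fl Y)). Qed.
Lemma rform_sumr (J : finType) (Q : pred J) (g : J -> D) X :
  F X (\sum_(j | Q j) g j) = \sum_(j | Q j) F X (g j).
Proof. exact: (lin_sum (Fr X)). Qed.

Lemma form_parity p p' X Y : X \in hpart D p -> Y \in hpart D p' ->
  F X Y != 0 -> p = p'.
Proof.
case: p p' => [] [] // XD YD; last by rewrite (form_even B XD YD) eqxx.
by rewrite (form_sym B YD XD) (form_even B YD XD) mulr0 eqxx.
Qed.

(** Moving a Cartan element from one argument to the other by invariance shows that al + be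
    annihilates [F X Y]. *)
Lemma form_weight p p' al be X Y : root_space p al X -> root_space p' be Y ->
  F X Y != 0 -> al = - be.
Proof.
move=> [XD Xal] [YD Ybe] FXY; apply/eqP; rewrite -addr_eq0; apply/eqP/lfunP => H.
rewrite zero_lfunE add_lfunE; apply: (mulIf FXY); rewrite mul0r mulrDl.
rewrite -rformZl -rformZr -Xal -Ybe -(form_inv B XD (cartan_part H) YD).
rewrite (brk_skew B XD (cartan_part H)) andbF expr0 scale1r rformNl.
exact: addNr.
Qed.

Lemma root_space_rootv i : root_space (q i) (a i) (e i).
Proof. by split; [exact: rootv_part B i | exact: rootv_wt B i]. Qed.

Lemma root_space_cartan X : X \in cartan D -> root_space false 0 X.
Proof.
move=> XH; split=> [|H]; first exact: (subvP (cartan_even B)).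
by rewrite (cartan_abelian B) ?subvsP // zero_lfunE scale0r.
Qed.

Lemma form_root_cartan i X : X \in cartan D -> F (e i) X = 0 /\ F X (e i) = 0.
Proof.
move=> /root_space_cartan X0; have ei := root_space_rootv i.
by split; apply/eqP; apply: contraNT (root_neq0 B i) => h;
  [rewrite (form_weight ei X0 h) oppr0|
   rewrite -oppr_eq0 -(form_weight X0 ei h)].
Qed.

(** Otherwise e_i would be orthogonal to all root vectors and to the Cartan subalgebra, against
    nondegeneracy on its parity component. *)
Lemma form_rootP i : exists j, [/\ a j = - a i, q j = q i & F (e j) (e i) != 0].
Proof.
have ei := root_space_rootv i.
have := rootv_neq0 B i; apply: contra_neqP => /forallNP h.
have Fij0 j : F (e i) (e j) = 0.
  apply/eqP/negPn/negP => Fij; apply: (h j).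
  have ej := root_space_rootv j; split.
  - by rewrite (form_weight ei ej Fij) opprK.
  - exact/esym/(form_parity ei.1 ej.1).
  - by rewrite (form_sym B ei.1 ej.1) mulf_neq0 ?signr_eq0.
apply: (form_nondeg B (rootv_part B i)) => Y /(part_span B) [H [c [HH _ ->]]].
rewrite rformDr rform_sumr big1 => [|j _]; last by rewrite rformZr Fij0 mulr0.
by rewrite (form_root_cartan _ HH).1 addr0.
Qed.

Definition oproot i : I := sval (cid (form_rootP i)).

Lemma oprootE i : a (oproot i) = - a i.
Proof. by rewrite /oproot; case: cid => j []. Qed.

Lemma oproot_parity i : q (oproot i) = q i.
Proof. by rewrite /oproot; case: cid => j []. Qed.

Lemma form_oproot i : F (e (oproot i)) (e i) != 0.
Proof. by rewrite /oproot; case: cid => j []. Qed.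

Lemma oprootK : involutive oproot.
Proof. by move=> i; apply: (root_inj B); rewrite !oprootE opprK. Qed.

(** Normalised with the dual vector in the first argument. The order matters for odd roots, where
    [F] is skew. *)
Definition dual_rootv i : D := (F (e (oproot i)) (e i))^-1 *: e (oproot i).

Lemma form_dual_rootv i j : F (dual_rootv i) (e j) = (i == j)%:R.
Proof.
rewrite rformZl; case: eqP => [<-|/eqP ij]; first by rewrite mulVf ?form_oproot.
have /eqP -> : F (e (oproot i)) (e j) == 0; last by rewrite mulr0.
apply: contraNT ij => /(form_weight (root_space_rootv _) (root_space_rootv _)).
by rewrite oprootE => /oppr_inj/(root_inj B) ->.
Qed.

Lemma form_cartan_nondeg X : X \in cartan D ->
  (forall Y, Y \in cartan D -> F X Y = 0) -> X = 0.
Proof.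
move=> XH FX; apply: (form_nondeg B (subvP (cartan_even B) _ XH)) => Y.
move=> /(part_span B) [H [c [HH _ ->]]]; rewrite rformDr FX // add0r rform_sumr.
rewrite big1 // => i _.
by rewrite rformZr (form_root_cartan _ XH).2 mulr0.
Qed.

Local Notation hb := (fun r : 'I_(\dim (cartan D)) => (vbasis (cartan D))`_r).

Lemma cartan_basis_mem r : hb r \in cartan D.
Proof. by apply: vbasis_mem; apply: mem_nth; rewrite size_tuple. Qed.

Lemma dual_cartanP : exists h' : 'I_(\dim (cartan D)) -> D,
  (forall r, h' r \in cartan D) /\ forall r s, F (h' r) (hb s) = (r == s)%:R.
Proof.
pose G := \matrix_(r, s) F (hb r) (hb s).
have Gu : G \in unitmx.
  (* A row in the kernel of the Gram matrix gives a Cartan element orthogonal to the whole Cartan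
     subalgebra. *)
  rewrite -row_free_unit -kermx_eq0; apply/eqP/row_matrixP => k.
  rewrite row0; set c := row k _.
  have cG : c *m G = 0 by apply/eqP; rewrite -sub_kermx row_sub.
  have X0 : \sum_r c 0 r *: hb r = 0.
    apply: form_cartan_nondeg => [|Y].
      by apply: memv_suml => r _; rewrite memvZ // cartan_basis_mem.
    move=> /coord_vbasis ->; rewrite rform_sumr big1 // => s _; rewrite rformZr.
    move/rowP/(_ s): cG; rewrite mxE [RHS]mxE => cG; rewrite rform_suml.
    suff -> : \sum_i F (c 0 i *: hb i) (hb s) = 0 by rewrite mulr0.
    by rewrite -[RHS]cG; apply: eq_bigr => r _; rewrite rformZl [X in _ = _ * X]mxE.
  have /freeP fr := basis_free (vbasisP (cartan D)).
  by apply/rowP => r; rewrite [RHS]mxE; apply: (fr (c 0)).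
exists (fun r => \sum_s invmx G r s *: hb s); split=> [r|r s].
  by apply: memv_suml => s _; rewrite memvZ // cartan_basis_mem.
have /matrixP/(_ r s) := mulVmx Gu; rewrite mxE [RHS]mxE => <-.
by rewrite rform_suml; apply: eq_bigr => t _; rewrite rformZl [X in _ = _ * X]mxE.
Qed.

Definition dual_cartan := sval (cid dual_cartanP).

Lemma dual_cartan_mem r : dual_cartan r \in cartan D.
Proof. by rewrite /dual_cartan; case: cid => h' [] /=. Qed.

Lemma form_dual_cartan r s : F (dual_cartan r) (hb s) = (r == s)%:R.
Proof. by rewrite /dual_cartan; case: cid => h' [] /=. Qed.

Lemma coweightP mu H : F (vsval (coweight mu)) (vsval H) = mu H.
Proof.
rewrite (form_cartan B) ?subvsP // /coweight.
(* To exclude the default 0 of [coweight], a representing element is written down in the dual basis: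
   its coefficients are the values of [mu] on the basis. *)
case: xgetP => [H0 _ ->//|/(_ (\sum_r mu (vsproj (cartan D) (hb r)) *:
  vsproj (cartan D) (dual_cartan r)))[]] H' /=.
rewrite -(form_cartan B) ?subvsP // linear_sum rform_suml.
have {2}-> : H' = \sum_r coord (vbasis (cartan D)) r (vsval H') *:
    vsproj (cartan D) (hb r).
  apply: val_inj; rewrite /= {1}(coord_vbasis (subvsP H')) linear_sum.
  by apply: eq_bigr => r _; rewrite linearZ /= vsprojK ?cartan_basis_mem.
rewrite linear_sum; apply: eq_bigr => r _.
rewrite linearZ /= vsprojK ?dual_cartan_mem // rformZl linearZ /= mulrC.
congr (_ * _); rewrite {1}(coord_vbasis (subvsP H')) rform_sumr (bigD1 r) //=.
rewrite rformZr form_dual_cartan eqxx mulr1 big1 ?addr0 // => s /negPf rs.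
by rewrite rformZr form_dual_cartan eq_sym rs mulr0.
Qed.

Lemma wformE la mu : wform la mu = la (coweight mu).
Proof. by rewrite /wform -(form_cartan B) ?subvsP // coweightP. Qed.

Lemma wformC la mu : wform la mu = wform mu la.
Proof.
rewrite /wform -!(form_cartan B) ?subvsP //.
by rewrite (form_sym B (cartan_part _) (cartan_part _)) mul1r.
Qed.

Lemma wformDl la la' mu : wform (la + la') mu = wform la mu + wform la' mu.
Proof. by rewrite !wformE add_lfunE. Qed.

Lemma wformNl la mu : wform (- la) mu = - wform la mu.
Proof. by rewrite !wformE opp_lfunE. Qed.

Lemma wformNr la mu : wform la (- mu) = - wform la mu.
Proof. by rewrite wformC wformNl wformC. Qed.

Lemma sroot_rootv p i : q i = p -> sroot p (a i).
Proof.
move=> <-; split; first exact: root_neq0 B i.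
by exists (e i); [exact: root_space_rootv | exact: rootv_neq0 B i].
Qed.

(** A root vector [X] of any root al pairs nontrivially with something, and this can only be some
    e_i with a_i = -al. Hence al is the weight of the opposite index, so the datum lists all
    roots. *)
Lemma srootP p al : sroot p al <-> exists2 i, q i = p & al = a i.
Proof.
split=> [[al0 [X Xal]]|[i qi ->]]; last exact: sroot_rootv.
apply: contra_neqP => /forall2NP noal; apply: (form_nondeg B Xal.1) => Y.
move=> /(part_span B) [H [c [HH _ ->]]]; rewrite rformDr rform_sumr.
have -> : F X H = 0.
  apply/eqP; apply: contraNT al0 => /(form_weight Xal (root_space_cartan HH)) ->.
  by rewrite oppr0.
rewrite add0r big1 // => i _; rewrite rformZr; apply/eqP; rewrite mulf_eq0.
apply/orP; right; apply/negPn/negP => FXi; have ei := root_space_rootv i.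
case: (noal (oproot i)); apply.
  by rewrite oproot_parity -(form_parity Xal.1 ei.1).
by rewrite oprootE (form_weight Xal ei).
Qed.

End Roots.

(** * Highest weight modules *)

Lemma fsbig_image_pred (C : numClosedFieldType) (M : nmodType) (D : superData C)
    (I : finType) (a : I -> weight D) (P : set (weight D)) (R : pred I)
    (f : weight D -> M) :
  injective a -> (forall al, P al <-> exists2 i, R i & al = a i) ->
  \sum_(al \in P) f al = \sum_(i | R i) f (a i).
Proof.
move=> inja PR; have -> : P = a @` [set` R].
  by apply/seteqP; split=> al; rewrite PR => -[i Ri e]; exists i.
rewrite fsbig_image => [|i j _ _ /inja//].
by rewrite -(@bigfs _ _ _ _ (index_enum I)) ?index_enum_uniq // => i _; rewrite mem_index_enum.
Qed.

(** * Modules spanned by lowering words *)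

Section HighestWeight.
Variables (C : numClosedFieldType) (D : superData C) (I : finType).
Variables (a : I -> weight D) (e : I -> D) (q : I -> bool) (F : D -> D -> C).
Hypothesis B : root_datum a e q F.
Hypothesis arch : forall x y : C, 0 < x -> y \is Num.real ->
  exists n, y < x *+ n.
Variable H0 : subvs_of (cartan D).
Hypothesis H0_regular : forall i, a i H0 \is Num.real /\ a i H0 != 0.
Let pos i := 0 < a i H0.

Variable P : set (weight D).
Hypothesis P_pos : P = [set al | sroots al /\ 0 < al H0].

Lemma posP p al : (P `&` sroot p) al <-> exists2 i, pos i && (q i == p) & al = a i.
Proof.
split=> [|[i /andP[posi /eqP qi] ->]].
  rewrite P_pos => -[[_ al0] /(srootP B)[i qi ali]].
  by exists i => //; rewrite /pos -ali al0 qi eqxx.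
have si := sroot_rootv B qi; split=> //; rewrite P_pos; split=> //.
by case: {qi} p si; [right | left].
Qed.

Lemma rootsP al : P al <-> exists2 i, pos i & al = a i.
Proof.
split=> [Pal|[i posi ->]].
  have [sal _] : (sroots al /\ 0 < al H0) by move: Pal; rewrite P_pos.
  have [p sp] : exists p, sroot p al by case: sal; [exists false | exists true].
  by have /posP[i /andP[posi _] ->] : (P `&` sroot p) al by []; exists i.
by have [] : (P `&` sroot (q i)) (a i) by apply/posP; exists i; rewrite ?posi ?eqxx.
Qed.

Lemma sum_pos (M : nmodType) (f : weight D -> M) :
  \sum_(al \in P) f al = \sum_(i | pos i) f (a i).
Proof. exact: fsbig_image_pred (root_inj B) rootsP. Qed.

Lemma root_parity_root i : root_parity (a i) = q i.
Proof.
congr nat_of_bool; apply/asboolP/idP => [/(srootP B)[j qj /(root_inj B) ->//]|].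
exact: (sroot_rootv B (p := true)).
Qed.

Lemma rhoE : rho P *+ 2 = \sum_(i | pos i) (-1) ^+ q i *: a i.
Proof.
have sumE p : \sum_(al \in P `&` sroot p) al = \sum_(i | pos i && (q i == p)) a i.
  exact: fsbig_image_pred (root_inj B) (posP p).
rewrite /rho -scaler_nat scalerA divff ?pnatr_eq0 // scale1r !sumE.
rewrite [RHS](bigID (fun i => q i == false)) /= -sumrN; congr (_ + _).
  by apply: eq_bigr => i /andP[_ /eqP ->]; rewrite scale1r.
apply: eq_big => [i|i /andP[_ /eqP ->]]; last by rewrite expr1 scaleN1r.
by case: (q i).
Qed.

(* [full] selects g itself or its even part. *)
Variables (full : bool) (V : lmodType C) (act : D -> V -> V).
Hypothesis act_linl : forall v, linear (act^~ v).
Hypothesis act_linr : forall X, linear (act X).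
Hypothesis act_brk : forall p p' X Y v, X \in hpart D p -> Y \in hpart D p' ->
  (p -> full) -> (p' -> full) ->
  act (brk X Y) v = act X (act Y v) - (-1) ^+ (p && p') *: act Y (act X v).
Variables (La : weight D) (v : V).
Hypothesis v_weight : weight_space act La v.
Hypothesis v_singular : forall i, (q i -> full) -> pos i -> act (e i) v = 0.

Implicit Types (H : subvs_of (cartan D)) (s : seq I) (la mu : weight D).

Lemma pos_oproot i : pos (oproot B i) = ~~ pos i.
Proof.
rewrite /pos oprootE opp_lfunE oppr_gt0.
have [r n] := H0_regular i; case: (real_ltgtP r (real0 C)) => //.
by move=> ai0; rewrite ai0 eqxx in n.
Qed.

Lemma not_pos i : ~~ pos i -> 0 < - a i H0.
Proof. by rewrite -pos_oproot /pos oprootE opp_lfunE. Qed.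

Definition lowering s := all (fun i => (q i ==> full) && ~~ pos i) s.
Definition word s : V := foldr (fun i w => act (e i) w) v s.
Definition word_weight s : weight D := La + \sum_(i <- s) a i.

Lemma act_brkE p p' X Y w : X \in hpart D p -> Y \in hpart D p' ->
  (p -> full) -> (p' -> full) ->
  act X (act Y w) = act (brk X Y) w + (-1) ^+ (p && p') *: act Y (act X w).
Proof. by move=> Xp Yp pf pf'; rewrite (act_brk w Xp Yp pf pf') subrK. Qed.

Lemma act_cartan_brk H p X w : X \in hpart D p -> (p -> full) ->
  act (vsval H) (act X w) = act (brk (vsval H) X) w + act X (act (vsval H) w).
Proof.
move=> Xp pf; have := act_brkE w (cartan_part B H) Xp => /(_ _ pf) -> //.
by rewrite andFb expr0 scale1r.
Qed.

Lemma act_rootv_weight i mu w : (q i -> full) -> weight_space act mu w ->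
  weight_space act (mu + a i) (act (e i) w).
Proof.
move=> qf Ww H; rewrite (act_cartan_brk _ _ (rootv_part B i) qf) Ww.
rewrite (rootv_wt B) (linZ (act_linl _)) (linZ (act_linr _)).
by rewrite -scalerDl add_lfunE addrC.
Qed.

Lemma word_weightP s : lowering s -> weight_space act (word_weight s) (word s).
Proof.
elim: s => [_|i s IH /= /andP[/andP[/implyP qf _] /IH Ws]].
  by rewrite /word_weight big_nil addr0.
rewrite /word_weight big_cons addrCA addrC.
by rewrite -[La + _]/(word_weight s); apply: act_rootv_weight.
Qed.

Definition word_span (w : V) : Prop :=
  exists2 l : seq (C * seq I), all (fun x => lowering x.2) l &
    w = \sum_(x <- l) x.1 *: word x.2.

Lemma word_span_subspace : lin_subspace word_span.
Proof.
split=> [|c u w [l ll ->] [l' ll' ->]]; first by exists [::]; rewrite ?big_nil.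
exists ([seq (c * x.1, x.2) | x <- l] ++ l').
  by rewrite all_cat ll' andbT all_map.
rewrite big_cat big_map scaler_sumr; congr (_ + _).
by apply: eq_bigr => x _; rewrite scalerA.
Qed.

Lemma word_in_span s : lowering s -> word_span (word s).
Proof.
by move=> ls; exists [:: (1, s)]; rewrite /= ?ls // big_seq1 scale1r.
Qed.

Lemma act_rootv_span i w : (q i -> full) -> ~~ pos i -> word_span w ->
  word_span (act (e i) w).
Proof.
move=> qf npos [l ll ->]; rewrite (lin_comb (act_linr _)).
exists [seq (x.1, i :: x.2) | x <- l]; last by rewrite big_map.
rewrite all_map; apply: sub_all ll => x /= lx; rewrite lx npos !andbT.
exact/implyP.
Qed.

(** Induction on the word, for all [X] at once. A positive root vector moves past the first letter,
    leaving its bracket with that letter to act on the shorter word, until it reaches [v] and kills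
    it. Cartan elements act by scalars, and negative root vectors only lengthen the word. *)
Lemma act_word_span s p X : lowering s -> X \in hpart D p -> (p -> full) ->
  word_span (act X (word s)).
Proof.
have sW := word_span_subspace.
elim: s p X => [|j s IH] p X ls Xp pf;
  have [H [c [HH _ ->]]] := part_span B Xp;
  rewrite (linD (act_linl _)) (lin_comb (act_linl _)) -(vsprojK HH).
all: apply: lin_subspaceD => //; first by
  rewrite (word_weightP ls); apply: lin_subspaceZ => //; apply: word_in_span.
all: apply: lin_subspace_sum => // i /eqP qi; have qf : q i -> full by rewrite qi.
all: case: (boolP (pos i)) => [posi|npos];
  last by apply: act_rootv_span => //; apply: word_in_span.
  by rewrite v_singular //; case: sW.
have /= /andP[/andP[/implyP qjf nposj] ls'] := ls.
rewrite /= (act_brkE _ (rootv_part B i) (rootv_part B j) qf qjf).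
apply: lin_subspaceD => //.
  apply: (IH _ _ ls' (brk_part B (rootv_part B i) (rootv_part B j))).
  by case: (q i) (q j) qf qjf => [] [].
apply: lin_subspaceZ => //; apply: act_rootv_span => //.
exact: (IH (q i)) (rootv_part B i) qf.
Qed.

Lemma act_span p X w : X \in hpart D p -> (p -> full) -> word_span w ->
  word_span (act X w).
Proof.
move=> Xp pf [l /allP ll ->]; rewrite (lin_comb (act_linr _)) big_seq.
elim/big_rec: _ => [|x u xl Wu]; first by case: word_span_subspace.
by apply: word_span_subspace.2 => //; apply: act_word_span (ll _ xl) Xp pf.
Qed.

Hypothesis gen : forall w, word_span w.

Lemma weight_span mu w : weight_space act mu w ->
  exists2 l : seq (C * seq I),
    all (fun x => lowering x.2 && (word_weight x.2 == mu)) l &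
    w = \sum_(x <- l) x.1 *: word x.2.
Proof.
move=> Wmu; have [l ll we] := gen w.
exists [seq x <- l | word_weight x.2 == mu].
  by rewrite all_filter; apply: sub_all ll => x /= ->; apply/implyP.
(* The expansion of [w] sorted by weight, with [w] itself subtracted in the component [mu]. The
   total is zero, so independence makes each component vanish. *)
pose f nu := \sum_(x <- l | word_weight x.2 == nu) x.1 *: word x.2 -
  (nu == mu)%:R *: w.
pose s := undup (mu :: [seq word_weight x.2 | x <- l]).
have mus : mu \in s by rewrite mem_undup mem_head.
have := @weight_space_indep _ _ _ _ act_linr s f (undup_uniq _) _ _ mu mus.
rewrite /f eqxx scale1r big_filter => h; apply/eqP; rewrite eq_sym -subr_eq0.
apply/eqP/h.
  move=> nu _; rewrite -scaleNr addrC; have sW := weight_lin_subspace act_linr nu.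
  apply: (lin_subspaceD sW).
    case: eqP => [->|_]; first exact: lin_subspaceZ (weight_lin_subspace act_linr mu) Wmu.
    by rewrite oppr0 scale0r; case: sW.
  rewrite big_seq_cond; elim/big_rec: _ => [|x u /andP[xl /eqP <-] Wu].
    by case: sW.
  apply: (weight_lin_subspace act_linr _).2 => //.
  exact: word_weightP (allP ll _ xl).
rewrite sumrB -scaler_suml.
have -> : \sum_(nu <- s) (nu == mu)%:R = 1 :> C.
  rewrite (bigD1_seq mu) ?undup_uniq //= eqxx big1 ?addr0 // => nu /negPf ->.
  by [].
rewrite scale1r we; apply/eqP; rewrite subr_eq0; apply/eqP.
rewrite (exchange_big_dep xpredT) //=; apply: eq_big_seq => x xl.
have xs : word_weight x.2 \in s by rewrite mem_undup inE (map_f (fun x => word_weight x.2) xl) orbT.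
rewrite big_mkcond (bigD1_seq _ xs) ?undup_uniq //= eqxx big1 ?addr0 // => nu.
by rewrite eq_sym => /negPf ->.
Qed.

(* The total H0-weight of a lowering word grows at least linearly in its length. *)
Lemma word_size_bound mu : exists N, forall s, lowering s ->
  word_weight s = mu -> (size s < N)%N.
Proof.
have sumE s : word_weight s = mu -> (La - mu) H0 = \sum_(i <- s) - a i H0.
  move=> <-; rewrite /word_weight opprD addrA subrr add0r opp_lfunE sum_lfunE.
  by rewrite sumrN.
have low_gt0 s : lowering s -> s != [::] -> 0 < \sum_(i <- s) - a i H0.
  case: s => // i s /= /andP[/andP[_ npos] ls] _; rewrite big_cons.
  apply: ltr_wpDr; last exact: not_pos.
  rewrite big_seq; apply: sumr_ge0 => j js; apply/ltW/not_pos.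
  by have /andP[] := allP ls _ js.
(* If this value is not positive, which includes not being real, only the empty word can have weight
   [mu]. *)
have [x0|x0] := boolP (0 < (La - mu) H0); last first.
  exists 1%N => s ls smu; case: s ls smu => // i s ls smu.
  by move: x0; rewrite (sumE _ smu) low_gt0.
(* Let x be the value of [La - mu] at [H0]. Each letter repeated [N] times outweighs x, so a word of
   total x, repeated [N] times, is worth at least x times its length; thus its length is at most
   [N]. *)
have /fin_all_exists[n nP] i : exists n, ~~ pos i -> (La - mu) H0 < - a i H0 *+ n.
  case: (boolP (pos i)) => [|npos]; first by exists 0%N.
  by have [n nP] := arch (not_pos npos) (gtr0_real x0); exists n.
set N := (\sum_i n i)%N; exists N.+1 => s ls smu; rewrite ltnS.
have := sumE _ smu; set x := (La - mu) H0 in x0 nP * => xE.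
rewrite -(ler_pMn2l x0) {2}xE.
elim: s ls {smu xE} => [|i s IH] /=; first by rewrite big_nil mul0rn.
move=> /andP[/andP[_ npos] ls]; rewrite big_cons mulrnDl mulrS.
apply: lerD; last exact: IH.
apply: le_trans (ltW (nP i npos)) _; apply: ler_wpMn2l; first exact/ltW/not_pos.
by rewrite /N (bigD1 i) //= leq_addr.
Qed.

Lemma word_weight_nil : word_weight [::] = La.
Proof. by rewrite /word_weight big_nil addr0. Qed.

Lemma lowering_gt0 s : lowering s -> s != [::] -> 0 < (La - word_weight s) H0.
Proof.
rewrite /word_weight opprD addrA subrr add0r opp_lfunE sum_lfunE -sumrN.
case: s => // i s /= /andP[/andP[_ npos] ls] _; rewrite big_cons.
apply: ltr_wpDr; last exact: not_pos.
rewrite big_seq; apply: sumr_ge0 => j js; apply/ltW/not_pos.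
by have /andP[] := allP ls _ js.
Qed.

Lemma lowering_weight_gt s : lowering s -> s != [::] ->
  weight_gt P La (word_weight s).
Proof.
move=> ls s0; split.
  apply: contraTneq (lowering_gt0 ls s0) => ->.
  by rewrite zero_lfunE ltxx.
(* A letter with negative root a_i is counted for the positive root -a_i, the one indexed by
   [oproot B i]. *)
exists (fun al => count (fun i => - a i == al) s).
rewrite sum_pos /word_weight opprD addrA subrr add0r.
elim: s ls {s0} => [_|i s IH /= /andP[/andP[_ npos] ls]].
  by rewrite big_nil big1 ?oppr0 // => i _.
rewrite big_cons opprD IH //.
rewrite [RHS](eq_bigr _ (fun j _ => mulrnDr (a j) (- a i == a j) _)) big_split /=.
congr (_ + _); rewrite (bigD1 (oproot B i)) ?pos_oproot //= oprootE eqxx big1 ?addr0 //.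
move=> j /andP[_ ji]; case: eqP => // aij; case/eqP: ji; apply: (root_inj B).
by rewrite oprootE.
Qed.

(** A sum of nonnegative terms vanishes only termwise. Evaluation at [H0] thus excludes cycles in
    the order, which is used for transitivity. *)
Lemma weight_gt_H0 la mu : weight_gt P la mu -> 0 < (la - mu) H0.
Proof.
move=> [la0 [n lamu]]; rewrite lamu sum_pos sum_lfunE.
have ge0 i : pos i -> 0 <= (a i *+ n (a i)) H0.
  by move=> posi; rewrite -scaler_nat scale_lfunE mulr_ge0 ?ler0n // ltW.
rewrite lt0r sumr_ge0 // andbT psumr_eq0 //; apply: contra la0 => /allP h.
rewrite lamu sum_pos big1 // => i posi; have := h i (mem_index_enum i).
rewrite posi /= -scaler_nat scale_lfunE mulf_eq0 pnatr_eq0 (negPf (H0_regular i).2) orbF.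
by move=> /eqP ->; rewrite scale0r.
Qed.

Lemma weight_cases mu w : weight_space act mu w -> w != 0 ->
  mu = La \/ weight_gt P La mu.
Proof.
move=> /weight_span[[|x l] /= ]; first by rewrite big_nil => _ ->; rewrite eqxx.
move=> /andP[/andP[lx /eqP <-] _] _ _.
have [->|x0] := eqVneq x.2 [::]; [left | right]; first exact: word_weight_nil.
exact: lowering_weight_gt.
Qed.

Lemma weight_fbasis mu : exists n (f : 'I_n -> V), fbasis (weight_space act mu) f.
Proof.
have [N NP] := word_size_bound mu; have sW := weight_lin_subspace act_linr mu.
(* Words of length below [N] form a finite type. Those that are not lowering or have another weight
   are replaced by 0, so that the family stays in the weight space. *)
pose g (p : {n : 'I_N & n.-tuple I}) :=
  if lowering (tagged p) && (word_weight (tagged p) == mu) then word (tagged p) else 0.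
apply: (@span_fbasis _ _ _ _ g) => // [p|w /weight_span[l ll ->]].
  by rewrite /g; case: andP => [[lp /eqP <-]|_];
    [exact: word_weightP | case: (weight_lin_subspace act_linr mu)].
elim: l ll => [_|x l IH /= /andP[/andP[lx xmu] /IH[c cE]]].
  by exists (fun=> 0); rewrite big_nil big1 // => p _; rewrite scale0r.
have sx : (size x.2 < N)%N by apply: NP => //; exact/eqP.
pose p : {n : 'I_N & n.-tuple I} := Tagged (fun n : 'I_N => n.-tuple I)
  (in_tuple x.2 : (Ordinal sx).-tuple I).
exists (fun p' => c p' + (p' == p)%:R * x.1); rewrite big_cons cE.
under [RHS]eq_bigr do rewrite scalerDl.
rewrite big_split addrC; congr (_ + _); rewrite (bigD1 p) //= eqxx mul1r big1.
  by rewrite addr0 /g /= lx xmu.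
by move=> p' /negPf ->; rewrite mul0r scale0r.
Qed.

(** Every nonempty lowering word has a weight strictly below [La] at [H0], so only the empty word
    remains. *)
Lemma highest_fbasis : v != 0 -> fbasis (weight_space act La) (fun _ : 'I_1 => v).
Proof.
move=> v0; split=> [_|w /weight_span[l ll ->]|c]; first exact: v_weight.
  exists (fun=> \sum_(x <- l) x.1); rewrite big_ord1 scaler_suml.
  apply: eq_big_seq => x xl; have /andP[lx /eqP xLa] := allP ll _ xl.
  have [-> //|x0] := eqVneq x.2 [::].
  by have := lowering_gt0 lx x0; rewrite xLa subrr zero_lfunE ltxx.
rewrite big_ord1 => /eqP; rewrite scaler_eq0 (negPf v0) orbF => /eqP c0 i.
by rewrite ord1.
Qed.

End HighestWeight.

(** * The Casimir operator and the Freudenthal formula *)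

Section DualBases.
Variables (C : numClosedFieldType) (D : superData C) (I : finType).
Variables (a : I -> weight D) (e : I -> D) (q : I -> bool) (F : D -> D -> C).
Hypothesis B : root_datum a e q F.

Local Notation J := ('I_(\dim (cartan D)) + I)%type.

Definition hbasis (j : J) : D :=
  match j with inl r => (vbasis (cartan D))`_r | inr i => e i end.
Definition hdual (j : J) : D :=
  match j with inl r => dual_cartan B r | inr i => dual_rootv B i end.
Definition hparity (j : J) : bool := if j is inr i then q i else false.

Lemma hbasis_part j : hbasis j \in hpart D (hparity j).
Proof.
case: j => [r|i] /=; last exact: rootv_part B i.
exact: (subvP (cartan_even B)) (cartan_basis_mem r).
Qed.

Lemma hdual_part j : hdual j \in hpart D (hparity j).
Proof.
case: j => [r|i] /=; first exact: (subvP (cartan_even B)) (dual_cartan_mem B r).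
by rewrite memvZ // -(oproot_parity B) (rootv_part B).
Qed.

Lemma form_hdual j k : F (hdual j) (hbasis k) = (j == k)%:R.
Proof.
case: j k => [r|i] [s|j] /=.
- exact: form_dual_cartan.
- exact: (form_root_cartan B j (dual_cartan_mem B r)).2.
- by rewrite (rformZl B) (form_root_cartan B _ (cartan_basis_mem s)).1 mulr0.
- exact: (form_dual_rootv B i j).
Qed.

(** The dual vector stands on the left here and the basis vector on the right in [hdual_expand].
    With these orders no sign appears, although [F] is only supersymmetric. *)
Lemma hbasis_expand p X : X \in hpart D p ->
  X = \sum_j F (hdual j) X *: hbasis j.
Proof.
move=> /(part_span B) [H [c [HH _ ->]]].
pose x (j : J) : C := match j with
  | inl r => coord (vbasis (cartan D)) r H | inr i => (q i == p)%:R * c i end.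
have -> : H + \sum_(i | q i == p) c i *: e i = \sum_j x j *: hbasis j.
  rewrite big_sumType /= -coord_vbasis //; congr (_ + _).
  rewrite big_mkcond; apply: eq_bigr => i _.
  by case: (q i == p); rewrite ?mul1r // mul0r scale0r.
apply: eq_bigr => j _; congr (_ *: _); rewrite (rform_sumr B) (bigD1 j) //=.
rewrite (rformZr B) form_hdual eqxx mulr1 big1 ?addr0 // => k /negPf jk.
by rewrite (rformZr B) form_hdual eq_sym jk mulr0.
Qed.

Lemma hdual_expand p X : X \in hpart D p ->
  X = \sum_j F X (hbasis j) *: hdual j.
Proof.
move=> Xp; apply/eqP; rewrite -subr_eq0; apply/eqP; apply: (form_nondeg B (p := p)).
  rewrite memvB // memv_suml // => j _.
  have [->|Fj] := eqVneq (F X (hbasis j)) 0; first by rewrite scale0r mem0v.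
  by rewrite memvZ // (form_parity B Xp (hbasis_part j) Fj) hdual_part.
move=> Y /hbasis_expand ->; rewrite (rform_sumr B) big1 // => k _.
rewrite (rformZr B) (rformDl B) (rformNl B) (rform_suml B) (bigD1 k) //=.
rewrite (rformZl B) form_hdual eqxx mulr1 big1 ?addr0 ?subrr ?mulr0 // => j /negPf jk.
by rewrite (rformZl B) form_hdual jk mulr0.
Qed.

End DualBases.

Section Freudenthal.
Variables (C : numClosedFieldType) (D : superData C) (I : finType).
Variables (a : I -> weight D) (e : I -> D) (q : I -> bool) (F : D -> D -> C).
Hypothesis B : root_datum a e q F.
Hypothesis arch : forall x y : C, 0 < x -> y \is Num.real ->
  exists n, y < x *+ n.
Variable H0 : subvs_of (cartan D).
Hypothesis H0_regular : forall i, a i H0 \is Num.real /\ a i H0 != 0.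
Let pos i := 0 < a i H0.
Variable P : set (weight D).
Hypothesis P_pos : P = [set al | sroots al /\ 0 < al H0].
Variables (V : lmodType C) (act : D -> V -> V).
Hypothesis act_linl : forall v, linear (act^~ v).
Hypothesis act_linr : forall X, linear (act X).
Hypothesis act_brk : forall p p' X Y v, X \in hpart D p -> Y \in hpart D p' ->
  act (brk X Y) v = act X (act Y v) - (-1) ^+ (p && p') *: act Y (act X v).
Variables (La : weight D) (v : V).
Hypothesis v_weight : weight_space act La v.
Hypothesis v_singular : forall i, pos i -> act (e i) v = 0.
Hypothesis gen : forall w, word_span a e q H0 true act v w.

Implicit Types (H : subvs_of (cartan D)) (la mu : weight D).

Local Notation b := (hbasis e).
Local Notation b' := (hdual B).
Local Notation par := (hparity q).

Definition casimir (w : V) : V := \sum_j act (b j) (act (b' j) w).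

Let actE p p' X Y w : X \in hpart D p -> Y \in hpart D p' ->
  act X (act Y w) = act (brk X Y) w + (-1) ^+ (p && p') *: act Y (act X w).
Proof. by move=> Xp Yp; rewrite (act_brk w Xp Yp) subrK. Qed.

Lemma casimir_linear : linear casimir.
Proof.
move=> c u w; rewrite scaler_sumr -big_split; apply: eq_bigr => j _ /=.
by rewrite !act_linr.
Qed.

(** By invariance the matrices of ad X in the two dual bases are negative transposes of each other
    up to a sign, and this is the sign created when [X] passes b_k. The two sums of brackets
    therefore cancel, and the complete passage carries the square of a sign. *)
Lemma casimir_act p X w : X \in hpart D p -> act X (casimir w) = casimir (act X w).
Proof.
move=> Xp; rewrite (lin_sum (act_linr X)) /casimir.
pose s (j : 'I_(\dim (cartan D)) + I) : C := (-1) ^+ (p && par j).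
have bE j : brk X (b j) = \sum_k F (b' k) (brk X (b j)) *: b k.
  by have h := brk_part B Xp (hbasis_part B j); exact: (hbasis_expand B h).
have b'E j : brk X (b' j) = \sum_k F (brk X (b' j)) (b k) *: b' k.
  by have h := brk_part B Xp (hdual_part B j); exact: (hdual_expand B h).
have step j : act X (act (b j) (act (b' j) w)) =
   act (b j) (act (b' j) (act X w)) +
   (act (brk X (b j)) (act (b' j) w) + s j *: act (b j) (act (brk X (b' j)) w)).
  rewrite (actE _ Xp (hbasis_part B j)) (actE w Xp (hdual_part B j)).
  rewrite (linD (act_linr _)) (linZ (act_linr _)) scalerDr scalerA.
  by rewrite -expr2 sqrr_sign scale1r addrA addrC.
under eq_bigr do rewrite step.
rewrite big_split /= big_split /= -[RHS]addr0; congr (_ + _).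
under eq_bigr => j _ do rewrite bE (lin_comb (act_linl _)).
under [X in _ + X]eq_bigr => j _ do
  rewrite b'E (lin_comb (act_linl _)) (lin_comb (act_linr _)) scaler_sumr.
rewrite [X in _ + X]exchange_big -big_split big1 //= => j _.
rewrite -big_split big1 //= => k _; rewrite scalerA -scalerDl.
rewrite -(form_inv B (hdual_part B k) Xp (hbasis_part B j)).
rewrite (brk_skew B Xp (hdual_part B k)) (rformNl B) (rformZl B).
by rewrite addNr scale0r.
Qed.

Local Notation wsp mu := (weight_space act mu).

Lemma act_rootv i mu w : wsp mu w -> wsp (mu + a i) (act (e i) w).
Proof.
move=> Ww; apply: (act_rootv_weight B act_linl act_linr (full := true)) => //.
by move=> p p' X Y w' Xp Yp _ _; apply: act_brk Xp Yp.
Qed.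

(** By invariance the Cartan part of the bracket is the coweight of a_i up to the sign (-1)^(q i).
    The fields of [invariant_form] include no Jacobi identity from which to read off the weight of
    the bracket. Its root part is therefore handled in the module: it sends [w] to a vector of
    weight [mu] that is also a sum of vectors of the other weights [mu + a j], hence to 0. *)
Lemma cartan_brk_weight i mu w : wsp mu w ->
  act (brk (e i) (dual_rootv B i)) w = ((-1) ^+ q i * wform mu (a i)) *: w.
Proof.
move=> Ww.
have ei := rootv_part B i; have ei' : dual_rootv B i \in hpart D (q i).
  exact: hdual_part B (inr i).
have /(part_span B)[H [c [HH _ XE]]] := brk_part B ei ei'.
set X := brk _ _ in XE *.
have HE H' : F (vsval H') H = a i H' * (-1) ^+ q i.
  have <- : F (e i) (dual_rootv B i) = (-1) ^+ q i.
    by rewrite (form_sym B ei' ei) andbb form_dual_rootv eqxx mulr1.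
  rewrite -(rformZl B) -(rootv_wt B) (form_inv B (cartan_part B H') ei ei') -/X XE.
  rewrite (rformDr B) (rform_sumr B) big1 ?addr0 // => j _.
  by rewrite (rformZr B) (form_root_cartan B j (subvsP H')).2 mulr0.
have muH : act H w = ((-1) ^+ q i * wform mu (a i)) *: w.
  rewrite -(vsprojK HH) Ww -(coweightP B) vsprojK // HE (wformC B) (wformE B).
  by rewrite mulrC.
have W1 : wsp (mu + a (oproot B i)) (act (dual_rootv B i) w).
  by rewrite (linZ (act_linl _)); apply: (weight_spaceZ act_linr); apply: act_rootv.
have W2 : wsp (mu + a i) (act (e i) w) by apply: act_rootv.
pose Y := \sum_(j | q j == (q i (+) q i)) c j *: act (e j) w.
have XwE : act X w = act H w + Y by rewrite XE (linD (act_linl _)) (lin_comb (act_linl _)).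
suff Y0 : Y = 0 by rewrite XwE muH Y0 addr0.
have YW : wsp mu (- Y).
  have -> : - Y = act H w - act X w by rewrite XwE opprD addrA subrr add0r.
  rewrite -[- act X w]scaleN1r; apply: (weight_spaceD act_linr).
    by rewrite muH; apply: (weight_spaceZ act_linr).
  apply: (weight_spaceZ act_linr); rewrite (act_brk w ei ei') -scaleNr.
  apply: (weight_spaceD act_linr).
    by have := act_rootv i W1; rewrite oprootE -addrA addNr addr0.
  apply: (weight_spaceZ act_linr); rewrite (linZ (act_linl _)).
  apply: (weight_spaceZ act_linr).
  by have := act_rootv (oproot B i) W2; rewrite oprootE -addrA subrr addr0.
(* The relation fed to independence: the components of weight [mu + a j] sum to [Y], and [-Y] is
   placed at the weight [mu]. *)
pose f nu := if [pick j | nu == mu + a j] is Some j then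
  (q j == (q i (+) q i))%:R * c j *: act (e j) w else - Y.
have f_mu : f mu = - Y.
  rewrite /f; case: pickP => // j; rewrite -{1}[mu]addr0 => /eqP/addrI/esym/eqP.
  by rewrite (negPf (root_neq0 B j)).
have f_a j : f (mu + a j) = (q j == (q i (+) q i))%:R * c j *: act (e j) w.
  rewrite /f; case: pickP => [k /eqP/addrI/(root_inj B) -> //|/(_ j)].
  by rewrite eqxx.
apply: oppr_inj; rewrite oppr0 -f_mu.
apply: (@weight_space_indep _ _ _ _ act_linr (mu :: [seq mu + a j | j <- index_enum I]) f);
  last exact: mem_head.
- rewrite /= map_inj_uniq ?index_enum_uniq ?andbT => [|j k /addrI/(root_inj B)//].
  apply/mapP => -[j _]; rewrite -{1}[mu]addr0 => /addrI/esym/eqP.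
  by rewrite (negPf (root_neq0 B j)).
- move=> nu; rewrite inE => /predU1P[->|/mapP[j _ ->]]; first by rewrite f_mu.
  by rewrite f_a; apply: (weight_spaceZ act_linr); apply: act_rootv.
rewrite big_cons big_map f_mu /Y big_mkcond [X in _ + X](eq_bigr _ (fun j _ => f_a j)).
rewrite addrC -[RHS](subrr Y) /Y [in X in _ = X - _]big_mkcond /=; congr (_ - _).
  by apply: eq_bigr => j _; case: eqP; rewrite ?mul1r // mul0r scale0r.
by rewrite -big_mkcond.
Qed.

Definition wdim mu : nat := fdim (wsp mu).

Let act_brk_full p p' X Y w : X \in hpart D p -> Y \in hpart D p' ->
  (p -> true) -> (p' -> true) ->
  act (brk X Y) w = act X (act Y w) - (-1) ^+ (p && p') *: act Y (act X w).
Proof. by move=> Xp Yp _ _; apply: act_brk. Qed.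

Lemma wbasis_exists mu : exists f : 'I_(wdim mu) -> V, fbasis (wsp mu) f.
Proof.
have [n [f bf]] := weight_fbasis B arch H0_regular act_linl act_linr
  act_brk_full v_weight gen mu.
have dE : wdim mu = n.
  by rewrite /wdim (fbasis_fdim (weight_lin_subspace act_linr mu) bf) card_ord.
by rewrite dE; exists f.
Qed.

Definition wbasis mu := sval (cid (wbasis_exists mu)).
Arguments wbasis : clear implicits.

Lemma wbasisP mu : fbasis (wsp mu) (wbasis mu).
Proof. exact: svalP (cid (wbasis_exists mu)). Qed.

Definition root_trace i mu : C :=
  tracef (wbasis mu) (fun w => act (e i) (act (dual_rootv B i) w)).

Lemma act_dual_rootv i mu w : wsp mu w -> wsp (mu - a i) (act (dual_rootv B i) w).
Proof.
move=> Ww; rewrite (linZ (act_linl _)) -(oprootE B).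
by apply: (weight_spaceZ act_linr); apply: act_rootv.
Qed.

Lemma act_rootv_dual i mu w : wsp mu w ->
  wsp mu (act (e i) (act (dual_rootv B i) w)).
Proof. by move=> Ww; rewrite -[mu](subrK (a i)); apply/act_rootv/act_dual_rootv. Qed.

Lemma act_dual_rootv_root i mu w : wsp mu w ->
  wsp mu (act (dual_rootv B i) (act (e i) w)).
Proof. by move=> Ww; rewrite -[mu](addrK (a i)); apply/act_dual_rootv/act_rootv. Qed.

(** Exchanging e_i with its dual gives the bracket, a scalar on the weight space, plus the reversed
    product with a sign. Cyclicity of the trace turns the reversed product on weight [mu] into the
    original one on weight [mu + a i]. *)
Lemma root_trace_rec i mu : root_trace i mu =
  (-1) ^+ q i * wform mu (a i) * (wdim mu)%:R + (-1) ^+ q i * root_trace i (mu + a i).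
Proof.
have be := wbasisP mu.
have ei := rootv_part B i; have ei' : dual_rootv B i \in hpart D (q i).
  exact: (hdual_part B (inr i)).
pose ee w := act (dual_rootv B i) (act (e i) w).
have -> : root_trace i mu = tracef (wbasis mu) (fun w =>
    ((-1) ^+ q i * wform mu (a i)) *: w + (-1) ^+ q i *: ee w).
  apply: (eq_tracef be) => w Ww.
  by rewrite (actE w ei ei') (cartan_brk_weight _ Ww) andbb.
rewrite (tracefD be) => [||w Ww]; last 2 first.
- by move=> w Ww; apply: (weight_spaceZ act_linr).
- by apply: (weight_spaceZ act_linr); apply: act_dual_rootv_root.
rewrite (tracef_scalar _ be) card_ord (tracefZ _ be); last first.
  by move=> w; apply: act_dual_rootv_root.
congr (_ + _ * _); apply: (tracef_comp be (wbasisP _)) => // w.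
  exact: act_rootv.
by rewrite -{2}[mu](addrK (a i)); apply: act_dual_rootv.
Qed.

Lemma root_trace0 i mu : wdim mu = 0%N -> root_trace i mu = 0.
Proof.
rewrite /root_trace /tracef => d0; apply: big1 => j _.
by exfalso; move: j; rewrite d0 => -[].
Qed.

Let pos_op i : pos (oproot B i) = ~~ pos i.
Proof. exact: pos_oproot. Qed.

Let term i mu k : C := wform (mu + a i *+ k) (a i) * (wdim (mu + a i *+ k))%:R.

Lemma root_trace_iter i mu n : root_trace i mu =
  \sum_(0 <= k < n) (-1) ^+ (k.+1 * q i) * term i mu k +
  (-1) ^+ (n * q i) * root_trace i (mu + a i *+ n).
Proof.
elim: n => [|n IH]; first by rewrite big_nil add0r mul0n expr0 mul1r mulr0n addr0.
rewrite big_nat_recr //= {}IH root_trace_rec -!addrA; congr (_ + _).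
rewrite mulrDr /term mulSn exprD -mulrSr; ring.
Qed.

(** For the opposite root [root_trace_rec] leads down the string. Solved for its lower end it climbs
    the same string, and the first dimension met is that of [mu + a i]: hence the lower bound 1. *)
Lemma root_trace_op_iter i mu n : root_trace (oproot B i) mu =
  \sum_(1 <= k < n.+1) (-1) ^+ (k.+1 * q i) * term i mu k +
  (-1) ^+ (n * q i) * root_trace (oproot B i) (mu + a i *+ n).
Proof.
elim: n => [|n IH]; first by rewrite big_geq // add0r mul0n expr0 mul1r mulr0n addr0.
rewrite big_nat_recr //= {}IH -!addrA; congr (_ + _).
have := root_trace_rec (oproot B i) (mu + a i *+ n.+1).
have -> : mu + a i *+ n.+1 + a (oproot B i) = mu + a i *+ n.
  by rewrite oprootE mulrSr addrA addrK.
rewrite oproot_parity oprootE (wformNr B) => ->.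
have ss : (-1) ^+ q i * (-1) ^+ q i = 1 :> C by rewrite -expr2 sqrr_sign.
rewrite /term !mulSn !exprD; set s := (-1) ^+ q i in ss *.
set t := (-1) ^+ (n * q i); set x := root_trace _ _.
by rewrite -[LHS]mul1r -ss; ring.
Qed.

Lemma cartan_casimir mu w : wsp mu w ->
  \sum_r act (b (inl r)) (act (b' (inl r)) w) = wform mu mu *: w.
Proof.
move=> Ww; set t := coweight mu.
have actH X : X \in cartan D -> act X w = F (vsval t) X *: w.
  by move=> XH; rewrite -(vsprojK XH) Ww (coweightP B).
transitivity (\sum_r (F (vsval t) (b (inl r)) * F (vsval t) (b' (inl r))) *: w).
  apply: eq_bigr => r _.
  have [h h'] := (cartan_basis_mem r, dual_cartan_mem B r).
  by rewrite (actH _ h') (linZ (act_linr _)) (actH _ h) scalerA mulrC.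
rewrite -scaler_suml /wform -(form_cartan B) ?subvsP //; congr (_ *: _).
rewrite {4}(hdual_expand B (cartan_part B t)) (rform_sumr B) big_sumType /=.
rewrite [X in _ = _ + X]big1 ?addr0 => [|i _].
  by apply: eq_bigr => r _; rewrite (rformZr B).
by rewrite (form_root_cartan B i (subvsP t)).2 scale0r (rform0r B).
Qed.

Lemma casimir_valueE mu : casimir_value P mu =
  wform mu mu + \sum_(i | pos i) (-1) ^+ q i * wform mu (a i).
Proof.
rewrite /casimir_value (wformDl B); congr (_ + _).
rewrite (rhoE B P_pos) (wformE B) sum_lfunE; apply: eq_bigr => i _.
by rewrite scale_lfunE -(wformE B) (wformC B).
Qed.

(** On [v] a positive index contributes only its bracket, giving the 2 rho term, and for a negative
    one the dual vector already kills [v]. Words inherit the scalar because the Casimir operator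
    commutes with every letter. *)
Lemma casimir_scalar w : casimir w = casimir_value P La *: w.
Proof.
have cv : casimir v = casimir_value P La *: v.
  rewrite /casimir big_sumType /= (cartan_casimir v_weight) casimir_valueE.
  rewrite scalerDl; congr (_ + _); rewrite scaler_suml [RHS]big_mkcond.
  apply: eq_bigr => i _; case: ifP => [posi|npos].
    rewrite (actE v (rootv_part B i) (hdual_part B (inr i))) v_singular //.
    by rewrite (lin0 (act_linr _)) scaler0 addr0 (cartan_brk_weight _ v_weight).
  rewrite (linZ (act_linl _)) v_singular ?scaler0 ?(lin0 (act_linr _)) //.
  by rewrite pos_op npos.
have [l _ ->] := gen w.
rewrite (lin_comb casimir_linear) scaler_sumr; apply: eq_bigr => x _.
rewrite scalerA mulrC -scalerA; congr (_ *: _).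
elim: x.2 => [|i s IH] //=.
by rewrite -(casimir_act _ (rootv_part B i)) IH (linZ (act_linr _)).
Qed.

Lemma casimir_trace mu : casimir_value P La * (wdim mu)%:R =
  wform mu mu * (wdim mu)%:R + \sum_i root_trace i mu.
Proof.
have be := wbasisP mu; have sW := weight_lin_subspace act_linr mu.
have := tracef_scalar (casimir_value P La) be; rewrite card_ord => <-.
have := tracef_scalar (wform mu mu) be; rewrite card_ord => <-.
rewrite -(tracef_sum (Q := xpredT) be sW) => [|i w _ Ww]; last exact: act_rootv_dual.
rewrite -(tracefD be) => [||w Ww]; last 2 first.
- by move=> w; apply: (weight_spaceZ act_linr).
- by apply: (weight_space_sum act_linr) => i _; apply: act_rootv_dual.
apply: (eq_tracef be) => w Ww.
by rewrite -casimir_scalar /casimir big_sumType /= (cartan_casimir Ww).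
Qed.

(** The trace over all roots is grouped into pairs of opposite roots. The [k = 0] term of the
    positive root is exactly the 2 rho contribution to [casimir_value P mu], and the sums over
    [k >= 1] agree, whence the factor 2. *)
Theorem freudenthal mu K :
  (forall i k, pos i -> (K <= k)%N -> wdim (mu + a i *+ k) = 0%N) ->
  (casimir_value P La - casimir_value P mu) * (wdim mu)%:R =
  2 * \sum_(i | pos i) \sum_(1 <= k < K) (-1) ^+ (k.+1 * q i) * term i mu k.
Proof.
move=> dK; rewrite mulrBl casimir_trace casimir_valueE mulrDl opprD addrACA subrr.
rewrite add0r (bigID pos) /= [X in _ + X - _](reindex_inj (inv_inj (oprootK B))) /=.
under [X in _ + X - _]eq_bigl => i do rewrite pos_op negbK.
rewrite -big_split mulr_suml -sumrB mulr_sumr; apply: eq_bigr => i posi /=.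
have tr0 j : root_trace j (mu + a i *+ K) = 0 by rewrite root_trace0 ?dK.
have termK : term i mu K = 0 by rewrite /term dK ?mulr0.
rewrite (root_trace_iter i mu K) (root_trace_op_iter i mu K) !tr0 !mulr0 !addr0.
(* For [K = 0] the vanishing hypothesis includes k = 0, so the weight space of [mu] itself is
   zero. *)
case: K termK {dK tr0} => [|K] termK.
  rewrite !big_geq // addr0 add0r mulr0 -mulrA.
  by move: termK; rewrite /term addr0 => ->; rewrite mulr0 oppr0.
rewrite [X in X + _ - _]big_ltn // [X in _ + X - _]big_nat_recr //= termK mulr0 addr0.
by rewrite /term mulr0n addr0 mul1n; ring.
Qed.

End Freudenthal.

(** * Multiplicities *)

Section Multiplicities.
Variables (C : numClosedFieldType) (D : superData C) (I : finType).
Variables (a : I -> weight D) (e : I -> D) (q : I -> bool) (F : D -> D -> C).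
Hypothesis B : root_datum a e q F.
Hypothesis arch : forall x y : C, 0 < x -> y \is Num.real ->
  exists n, y < x *+ n.
Variable H0 : subvs_of (cartan D).
Hypothesis H0_regular : forall i, a i H0 \is Num.real /\ a i H0 != 0.
Let pos i := 0 < a i H0.
Variable P : set (weight D).
Hypothesis P_pos : P = [set al | sroots al /\ 0 < al H0].
Implicit Types (La mu nu : weight D).

(** Simplicity is tested on graded subspaces only, while the given highest weight vector may mix
    parities. The words are therefore applied to a homogeneous component, which makes their span
    graded. *)
Lemma simple_hw_generated La (V : srep D) : simple_hw P La V ->
  exists v : V, [/\ v != 0, weight_space (@sact _ _ V) La v,
    forall i, pos i -> sact (e i) v = 0 &
    forall w, word_span a e q H0 true (@sact _ _ V) v w].
Proof.
case=> -[v [v0 vLa vsing]] simpleV.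
have vsing' i : pos i -> sact (e i) v = 0.
  move=> posi; apply: (vsing (q i) (a i)); last exact: root_space_rootv B i.
  by apply/(rootsP B P_pos); exists i.
have lr := @sact_linr _ _ V.
have ll := @sact_linl _ _ V.
have [v1 [v2 [g1 g2 vE]]] := sgrade_sum v.
have cap (u1 u2 : V) : sgrade false u1 -> sgrade true u2 -> u1 + u2 = 0 -> u1 = 0 /\ u2 = 0.
  move=> h1 h2 /eqP; rewrite addr_eq0 => /eqP u12.
  have : u1 = 0.
    apply: sgrade_cap => //; rewrite u12 -scaleN1r.
    exact: lin_subspaceZ (sgrade_sub V true) h2.
  by move=> u10; split=> //; apply/eqP; rewrite -oppr_eq0 -u12 u10.
(* An even or an odd component of v is a homogeneous highest weight vector. *)
have [p [u [gu u0 uLa u_sing]]] : exists p (u : V), [/\ sgrade p u, u != 0,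
    weight_space (@sact _ _ V) La u & forall i, pos i -> sact (e i) u = 0].
  have W12 : weight_space (@sact _ _ V) La v1 /\ weight_space (@sact _ _ V) La v2.
    suff h H : sact (vsval H) v1 = La H *: v1 /\ sact (vsval H) v2 = La H *: v2.
      by split=> H; case: (h H).
    have := vLa H; rewrite vE (linD (lr _)) scalerDr => h.
    have H1 := sact_grade (cartan_part B H) g1.
    have H2 := sact_grade (cartan_part B H) g2.
    have [] := cap (sact (vsval H) v1 - La H *: v1) (sact (vsval H) v2 - La H *: v2).
    - rewrite -scaleNr; apply: (lin_subspaceD (sgrade_sub V false)) => //.
      exact: lin_subspaceZ (sgrade_sub V false) g1.
    - rewrite -scaleNr; apply: (lin_subspaceD (sgrade_sub V true)) => //.
      exact: lin_subspaceZ (sgrade_sub V true) g2.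
    - by rewrite addrACA -opprD h subrr.
    by move=> /eqP; rewrite subr_eq0 => /eqP -> /eqP; rewrite subr_eq0 => /eqP ->.
  have S12 i : pos i -> sact (e i) v1 = 0 /\ sact (e i) v2 = 0.
    move=> posi; have := vsing' i posi; rewrite vE (linD (lr _)).
    have H1 := sact_grade (rootv_part B i) g1.
    have H2 := sact_grade (rootv_part B i) g2.
    (* An odd root vector exchanges the parities, so the two components trade places. *)
    case: (q i) H1 H2 => H1 H2; last exact: cap.
    by rewrite addrC => /cap [] // -> ->.
  have [v10|v10] := eqVneq v1 0.
    exists true, v2; split=> //; last by move=> i /S12[].
      by apply: contra_neq v0 => v20; rewrite vE v10 v20 addr0.
    by case: W12.
  by exists false, v1; split=> //; [case: W12 | move=> i /S12[]].
exists u; split=> //.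
pose W := word_span a e q H0 true (@sact _ _ V) u.
have sW : lin_subspace W by apply: word_span_subspace.
have gword s : lowering a q H0 true s ->
    exists p', sgrade p' (word e (@sact _ _ V) u s).
  elim: s => [_|i s IH /= /andP[_ /IH[p' gs]]]; first by exists p.
  by exists (q i (+) p'); apply: sact_grade (rootv_part B i) gs.
case: (simpleV W) => //.
- move=> w w1 w2 [l ll' wE] gw1 gw2 ww.
  (* Sorting the homogeneous words of an expansion by parity splits [w] inside [W]; uniqueness of
     components identifies the pieces with [w1] and [w2]. *)
  have [x1 [x2 [Wx1 Wx2 [gx1 gx2] wx]]] : exists x1 x2 : V,
     [/\ W x1, W x2, sgrade false x1 /\ sgrade true x2 & w = x1 + x2].
    rewrite wE; elim: l ll' {wE} => [_|x l IH /= /andP[lx /IH[x1 [x2 [W1 W2 [h1 h2] wx]]]]].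
      exists 0, 0; rewrite big_nil addr0; split=> //; try by case: sW.
      by split; case: (sgrade_sub V false); case: (sgrade_sub V true).
    have Wx := word_in_span e (@sact _ _ V) u lx.
    rewrite big_cons wx; have [[] gx] := gword _ lx.
      exists x1, (x.1 *: word e (@sact _ _ V) u x.2 + x2); split=> //.
      - by apply: (lin_subspaceD sW) => //; apply: lin_subspaceZ.
      - split=> //; apply: (lin_subspaceD (sgrade_sub V true)) => //.
        exact: lin_subspaceZ (sgrade_sub V true) gx.
      by rewrite addrCA.
    exists (x.1 *: word e (@sact _ _ V) u x.2 + x1), x2; split=> //.
    - by apply: (lin_subspaceD sW) => //; apply: lin_subspaceZ.
    - split=> //; apply: (lin_subspaceD (sgrade_sub V false)) => //.
      exact: lin_subspaceZ (sgrade_sub V false) gx.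
    by rewrite addrA.
  have [] := cap (w1 - x1) (w2 - x2).
  - rewrite -[- x1]scaleN1r; apply: (lin_subspaceD (sgrade_sub V false)) => //.
    exact: lin_subspaceZ (sgrade_sub V false) gx1.
  - rewrite -[- x2]scaleN1r; apply: (lin_subspaceD (sgrade_sub V true)) => //.
    exact: lin_subspaceZ (sgrade_sub V true) gx2.
  - by rewrite addrACA -opprD -ww -wx subrr.
  by move=> /eqP; rewrite subr_eq0 => /eqP -> /eqP; rewrite subr_eq0 => /eqP ->.
- move=> X w /memv_addP[X0 X0g [X1 X1g ->]] Ww; rewrite (linD (ll _)).
  have brk' p1 p2 (X' Y' : D) (w' : V) : X' \in hpart D p1 -> Y' \in hpart D p2 ->
      (p1 -> true) -> (p2 -> true) -> sact (brk X' Y') w' =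
      sact X' (sact Y' w') - (-1) ^+ (p1 && p2) *: sact Y' (sact X' w').
    by move=> h1 h2 _ _; apply: sact_brk h1 h2.
  by apply: (lin_subspaceD sW);
    [apply: (act_span B ll lr brk' uLa _ X0g) | apply: (act_span B ll lr brk' uLa _ X1g)] => //;
    move=> i _; apply: u_sing.
- move=> W0; have : W u by apply: (word_in_span e _ u (s := [::])).
  by rewrite W0 => /= uu; rewrite uu eqxx in u0.
- by move=> WT w; rewrite -/(W w) WT.
Qed.

Lemma simple_hw0_generated nu (L : erep D) : simple_hw0 (P `&` sroot false) nu L ->
  exists v : L, [/\ v != 0, weight_space (@eact _ _ L) nu v,
    forall i, (q i -> false) -> pos i -> eact (e i) v = 0 &
    forall w, word_span a e q H0 false (@eact _ _ L) v w].
Proof.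
case=> -[v [v0 vnu vsing]] simpleL.
have lr := @eact_linr _ _ L.
have ll := @eact_linl _ _ L.
have vsing' i : (q i -> false) -> pos i -> eact (e i) v = 0.
  move=> qf posi; have qi : q i = false by apply/negP => /qf.
  apply: (vsing (a i)).
    by apply/(posP B P_pos); exists i; rewrite // qi -/(pos i) posi.
  by have := root_space_rootv B i; rewrite qi.
exists v; split=> //; pose W := word_span a e q H0 false (@eact _ _ L) v.
have sW : lin_subspace W by apply: word_span_subspace.
case: (simpleL W) => //.
- move=> X w Xg Ww; apply: (act_span B ll lr _ vnu _ Xg) => //.
  move=> p p' X' Y' w' X'g Y'g; case: p X'g => X'g pf; first by have := pf isT.
  case: p' Y'g => Y'g pf'; first by have := pf' isT.
  by rewrite scale1r; apply: eact_brk.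
- move=> W0; have : W v by apply: (word_in_span e _ v (s := [::])).
  by rewrite W0 => /= vv; rewrite vv eqxx in v0.
- by move=> WT w; rewrite -/(W w) WT.
Qed.

Lemma weight_gt_trans la mu nu : weight_gt P la mu -> weight_gt P mu nu ->
  weight_gt P la nu.
Proof.
move=> gt1 gt2; split.
  have lnE : la - nu = (la - mu) + (mu - nu) by rewrite addrA subrK.
  have gt0 : 0 < (la - nu) H0.
    rewrite lnE add_lfunE; exact: addr_gt0 (weight_gt_H0 B H0_regular P_pos gt1)
      (weight_gt_H0 B H0_regular P_pos gt2).
  by apply: contraTneq gt0 => ->; rewrite zero_lfunE ltxx.
have [[_ [n nE]] [_ [n' n'E]]] := (gt1, gt2).
exists (fun al => n al + n' al)%N.
rewrite -[la](subrK mu) -addrA nE n'E !(sum_pos B P_pos) -big_split.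
by apply: eq_bigr => i _; rewrite mulrnDr.
Qed.

Lemma weight_gt_irrefl mu : ~ weight_gt P mu mu.
Proof. by case; rewrite subrr eqxx. Qed.

Lemma weight_gt_root mu i k : pos i -> (0 < k)%N -> weight_gt P (mu + a i *+ k) mu.
Proof.
move=> posi k0; rewrite /weight_gt addrAC subrr add0r; split.
  by rewrite -scaler_nat scaler_eq0 pnatr_eq0 negb_or -lt0n k0 (root_neq0 B i).
exists (fun al => (al == a i) * k)%N; rewrite (sum_pos B P_pos) (bigD1 i) //=.
rewrite eqxx mul1n big1 ?addr0 // => j /andP[_ /negPf ji].
by rewrite (inj_eq (root_inj B)) ji.
Qed.

Lemma fdim_neq0 (V : lmodType C) (act : D -> V -> V) (mu : weight D) n
    (f : 'I_n -> V) : (forall X, linear (act X)) ->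
  fbasis (weight_space act mu) f ->
  (fdim (weight_space act mu) != 0%N <-> exists2 w, weight_space act mu w & w != 0).
Proof.
move=> lr bf; rewrite (fbasis_fdim (weight_lin_subspace lr mu) bf) card_ord.
have [Wf gen ind] := bf; split=> [n0|[w /gen[c ->]]].
  case: n n0 f {bf gen} Wf ind => // n _ f Wf ind.
  exists (f ord0) => //; apply/eqP => f0.
  have h : \sum_i (i == ord0)%:R *: f i = 0.
    rewrite (bigD1 ord0) //= f0 scaler0 add0r big1 // => i /negPf ->.
    by rewrite scale0r.
  by have /eqP := ind _ h ord0; rewrite eqxx oner_eq0.
by apply: contraNneq => n0; rewrite big1 // => -[j jn]; exfalso; move: jn; rewrite n0.
Qed.

Section Decomposition.
Variables (omega : D -> D) (eps : C) (k : set D).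
Variables (La : weight D) (V : srep D).
Hypothesis hV : simple_hw P La V.
Variable L0 : weight D -> erep D.
Hypothesis hL0 : forall nu, simple_hw0 (P `&` sroot false) nu (L0 nu).
Variable nc : bool.
Local Notation S := (LaGam omega P eps k L0 nc La).
Variable m : weight D -> nat.
Hypothesis hm : decomposition V L0 m S.
Local Notation d := (fun mu : weight D => fdim (weight_space (@sact _ _ V) mu)).

Lemma srep_fbasis mu :
  exists n (f : 'I_n -> V), fbasis (weight_space (@sact _ _ V) mu) f.
Proof.
have [v [v0 vLa vsing gen]] := simple_hw_generated hV.
apply: (weight_fbasis B arch H0_regular (@sact_linl _ _ V) (@sact_linr _ _ V) _ vLa gen).
by move=> p p' X Y w Xp Yp _ _; apply: sact_brk Xp Yp.
Qed.

Let erep_brk (L : erep D) p p' (X Y : D) (w : L) : X \in hpart D p ->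
  Y \in hpart D p' -> (p -> false) -> (p' -> false) ->
  eact (brk X Y) w = eact X (eact Y w) - (-1) ^+ (p && p') *: eact Y (eact X w).
Proof.
case: p p' => [] [] Xp Yp pf pf'; try by [have := pf isT | have := pf' isT].
by rewrite scale1r; apply: eact_brk.
Qed.

Lemma erep_fbasis nu mu :
  exists n (f : 'I_n -> L0 nu), fbasis (weight_space (@eact _ _ (L0 nu)) mu) f.
Proof.
have [v [v0 vnu vsing gen]] := simple_hw0_generated (hL0 nu).
exact: (weight_fbasis B arch H0_regular (@eact_linl _ _ (L0 nu))
  (@eact_linr _ _ (L0 nu)) (@erep_brk (L0 nu)) vnu gen).
Qed.

Lemma hw_mult_refl nu : hw_mult L0 nu nu = 1%N.
Proof.
have [v [v0 vnu vsing gen]] := simple_hw0_generated (hL0 nu).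
have := highest_fbasis B H0_regular (@eact_linl _ _ (L0 nu))
  (@eact_linr _ _ (L0 nu)) (@erep_brk (L0 nu)) vnu gen v0.
move=> /(fbasis_fdim (weight_lin_subspace (@eact_linr _ _ (L0 nu)) nu)) h.
by rewrite /hw_mult h card_ord.
Qed.

Lemma hw_mult_gt nu mu : hw_mult L0 nu mu != 0%N -> mu = nu \/ weight_gt P nu mu.
Proof.
have [n [f bf]] := erep_fbasis nu mu.
move=> /(fdim_neq0 (@eact_linr _ _ (L0 nu)) bf)[w Ww w0].
have [v [v0 vnu vsing gen]] := simple_hw0_generated (hL0 nu).
exact: (weight_cases B H0_regular P_pos (@eact_linl _ _ (L0 nu))
  (@eact_linr _ _ (L0 nu)) (@erep_brk (L0 nu)) vnu gen Ww w0).
Qed.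

Lemma srep_dim_gt mu : d mu != 0%N -> mu = La \/ weight_gt P La mu.
Proof.
have [n [f bf]] := srep_fbasis mu.
move=> /(fdim_neq0 (@sact_linr _ _ V) bf)[w Ww w0].
have [v [v0 vLa vsing gen]] := simple_hw_generated hV.
apply: (weight_cases B H0_regular P_pos (@sact_linl _ _ V) (@sact_linr _ _ V)
  _ vLa gen Ww w0).
by move=> p p' X Y w' Xp Yp _ _; apply: sact_brk Xp Yp.
Qed.

Lemma srep_dim_highest : d La = 1%N.
Proof.
have [v [v0 vLa vsing gen]] := simple_hw_generated hV.
have sW := weight_lin_subspace (@sact_linr _ _ V) La.
rewrite (fbasis_fdim sW (e := fun _ : 'I_1 => v)) ?card_ord //.
apply: (highest_fbasis B H0_regular (@sact_linl _ _ V) (@sact_linr _ _ V) _ vLa gen v0).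
by move=> p p' X Y w Xp Yp _ _; apply: sact_brk Xp Yp.
Qed.

Lemma decomposition_dim (N : nat) (wt : 'I_N -> weight D)
    (phi : forall i, L0 (wt i) -> V) :
  (forall i, linear (phi i)) ->
  (forall i X v, X \in hpart D false -> phi i (eact X v) = sact X (phi i v)) ->
  (forall v, exists! x : forall i, L0 (wt i), v = \sum_(i < N) phi i (x i)) ->
  forall mu, d mu = (\sum_i hw_mult L0 (wt i) mu)%N.
Proof.
move=> lphi phiX dec mu.
have /fin_all_exists[n /fin_all_exists[f bf]] i := erep_fbasis (wt i) mu.
have lr := @sact_linr _ _ V.
have bV := fbasis_dsum (W := weight_space (@sact _ _ V) mu)
  (WU := fun i => weight_space (@eact _ _ (L0 (wt i))) mu) lphi dec _ _ bf.
rewrite (fbasis_fdim (weight_lin_subspace lr mu) (bV _ _)).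
- rewrite card_tagged sumnE big_map big_enum /=; apply: eq_bigr => i _.
  by rewrite /hw_mult (fbasis_fdim (weight_lin_subspace (@eact_linr _ _ _) mu) (bf i)).
- move=> x; split=> [Wx i H|Wx H]; last first.
    rewrite (lin_sum (lr _)) scaler_sumr; apply: eq_bigr => i _.
    by rewrite -phiX ?(cartan_part B) // Wx (linZ (lphi i)).
  (* The families of H x_i and of mu(H) x_i decompose the same vector, so they agree
     componentwise. *)
  have [y [_ yu]] := dec (sact (vsval H) (\sum_(i < N) phi i (x i))).
  have h1 := yu (fun i => eact (vsval H) (x i)).
  have h2 := yu (fun i => mu H *: x i).
  have := etrans (esym (h1 _)) (h2 _) => /(_ _ _)/(f_equal (fun g => g i)); apply.
    rewrite (lin_sum (lr _)); apply: eq_bigr => j _.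
    by rewrite phiX ?(cartan_part B).
  by rewrite Wx scaler_sumr; apply: eq_bigr => j _; rewrite (linZ (lphi j)).
- by move=> i; apply: weight_lin_subspace (@eact_linr _ _ _) mu.
Qed.

(** Turns a sum over weights into a sum over the finite list of summands. The set [A] may be
    infinite, but the terms vanish off the weights in the list since [m] does. *)
Lemma sum_multiplicity (N : nat) (wt : 'I_N -> weight D) (A : set (weight D))
    (g : weight D -> C) :
  (forall mu, m mu = #|[set i | wt i == mu]%SET|) ->
  \sum_(nu \in A) (m nu)%:R * g nu = \sum_(i | wt i \in A) g (wt i).
Proof.
move=> mE; pose r := undup [seq wt i | i <- index_enum 'I_N].
rewrite {1}(_ : A = [set` [pred nu | nu \in A]]); last first.
  by apply/seteqP; split=> nu /=; rewrite inE.
rewrite -(@bigfs _ _ _ _ r) ?undup_uniq //.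
  under eq_bigr => nu _ do rewrite mE -sum1_card natr_sum mulr_suml.
  rewrite (exchange_big_dep (fun i => wt i \in A)) /=; last first.
    by move=> nu i nuA; rewrite finset.inE => /eqP ->.
  apply: eq_bigr => i iA.
  have ir : wt i \in r by rewrite mem_undup map_f // mem_index_enum.
  rewrite big_mkcond (bigD1_seq _ ir) ?undup_uniq //= iA finset.inE eqxx mul1r.
  rewrite big1 ?addr0 // => nu /negPf nui; rewrite finset.inE eq_sym nui andbF.
  by [].
move=> nu _ nur; rewrite mE (_ : [set i | wt i == nu]%SET = finset.set0) ?cards0 ?mul0r //.
apply/setP => i; rewrite finset.inE finset.in_set0; apply/negP => /eqP nui.
by case/negP: nur; rewrite mem_undup -nui map_f // mem_index_enum.
Qed.

Theorem multiplicities :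
  m La = 1%N /\
  forall mu : weight D, S mu -> mu <> La ->
    (m mu)%:R =
      (d mu)%:R - \sum_(nu \in [set nu | S nu /\ weight_gt P nu mu])
                    ((m nu)%:R * (hw_mult L0 nu mu)%:R : C) /\
    (m mu)%:R =
      \sum_(nu \in [set nu | S nu /\ weight_gt P nu mu])
        Bcoef P L0 La mu nu * (m nu)%:R.
Proof.
have [N [wt [phi [Swt lphi phiX dec mE]]]] := hm.
have dE := decomposition_dim lphi phiX dec.
(* Dimensions in a summand are bounded by those in [V]. Applied at the weight [wt i] this shows that
   [wt i] is a weight of [V]. *)
have d_hw i mu : d mu = 0%N -> hw_mult L0 (wt i) mu = 0%N.
  by move=> /eqP; rewrite dE sum_nat_eq0 => /forallP/(_ i)/eqP.
have wt_le i : wt i = La \/ weight_gt P La (wt i).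
  apply: srep_dim_gt; apply/eqP => /(d_hw i).
  by rewrite hw_mult_refl.
have mE' mu : m mu = (\sum_i (wt i == mu))%N.
  rewrite mE -sum1_card big_mkcond /=; apply: eq_bigr => i _.
  by rewrite finset.inE; case: eqP.
split.
  (* Summands with highest weight strictly below [La] do not contain the weight [La], so d(La) = 1
     counts the copies of [L0 La]. *)
  rewrite -srep_dim_highest dE mE'; apply: eq_bigr => i _.
  case: eqP => [->|wti]; first by rewrite hw_mult_refl.
  apply/esym/eqP/negPn/negP => /hw_mult_gt[/esym//|gt1].
  case: (wt_le i) => // gt2; exact: (weight_gt_irrefl (weight_gt_trans gt1 gt2)).
move=> mu Smu muLa; set A := [set nu | _].
have eq1 : (m mu)%:R = (d mu)%:R - \sum_(nu \in A) ((m nu)%:R * (hw_mult L0 nu mu)%:R : C).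
  rewrite (sum_multiplicity A (fun nu => (hw_mult L0 nu mu)%:R) mE) dE mE'.
  rewrite !natr_sum [X in _ - X]big_mkcond -sumrB; apply: eq_bigr => i _.
  have [wti|wti] := eqVneq (wt i) mu.
    rewrite wti hw_mult_refl ifN ?subr0 //.
    by apply/negP; rewrite inE => -[_ /weight_gt_irrefl].
  case: ifPn => [_|iA]; first by rewrite subrr.
  rewrite subr0; apply/esym/eqP; rewrite pnatr_eq0.
  apply/negPn/negP => /hw_mult_gt[/esym/eqP|gt1]; first by rewrite (negPf wti).
  by case/negP: iA; rewrite inE; split.
split=> //.
pose Delta : C := casimir_value P La - casimir_value P mu.
have Delta0 : Delta != 0.
  have [ga [_ _ gaP] gaE] := Smu.
  have ga0 : ga != 0 by apply/eqP => ga0; apply: muLa; rewrite -gaE ga0 subr0.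
  have := gaP ga0; rewrite gaE => lt0; apply: contraTneq lt0 => D0.
  by rewrite -opprB -/Delta D0 oppr0 mulr0 ltxx.
(* One [K] for all strings. If the value of [La - mu] at [H0] is not real, no weight of [V] lies on
   these strings and 0 will do; otherwise the archimedean property bounds each of the finitely many
   strings. *)
have [K dK] : exists K, forall i n, pos i -> (K <= n)%N -> d (mu + a i *+ n) = 0%N.
  pose x := (La - mu) H0.
  have xgt i n : d (mu + a i *+ n) != 0%N -> 0 <= x - a i H0 *+ n.
    have -> : x - a i H0 *+ n = (La - (mu + a i *+ n)) H0.
      rewrite opprD addrA add_lfunE opp_lfunE -[a i *+ n]scaler_nat scale_lfunE.
      by rewrite scaler_nat.
    move=> /srep_dim_gt[->|/(weight_gt_H0 B H0_regular P_pos)/ltW//].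
    by rewrite subrr zero_lfunE.
  have [xreal|xreal] := boolP (x \is Num.real); last first.
    exists 0%N => i n posi _; apply/eqP/negPn/negP => /xgt/ger0_real.
    rewrite rpredBr ?(negPf xreal) //.
    by rewrite -mulr_natr rpredM ?(H0_regular i).1 ?realn.
  have /fin_all_exists[n nP] i : exists n, pos i -> x < a i H0 *+ n.
    case: (boolP (pos i)) => posi; last by exists 0%N.
    by have [n nP] := arch posi xreal; exists n.
  exists (\sum_i n i)%N => i n' posi le; apply/eqP/negPn/negP => /xgt.
  rewrite subr_ge0 => le'.
  suff le'' : a i H0 *+ n i <= a i H0 *+ n'.
    by have := lt_le_trans (nP i posi) (le_trans le'' le'); rewrite ltxx.
  apply: ler_wpMn2l; first exact: ltW.
  by apply: leq_trans le; rewrite (bigD1 i) //= leq_addr.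
(* The right side of Freudenthal's formula with the dimensions of [V] replaced by those of
   [L0 nu]. *)
pose FR nu : C := 2 * \sum_(i | pos i) \sum_(1 <= n < K)
  (-1) ^+ (n.+1 * q i) * wform (mu + a i *+ n) (a i) * (hw_mult L0 nu (mu + a i *+ n))%:R.
(* The sum over all k in [Bcoef] may be cut at [K] because [wt i] belongs to a summand of [V]:
   [hw_mult] vanishes wherever [d] does. *)
have BE i : Bcoef P L0 La mu (wt i) = FR (wt i) / Delta - (hw_mult L0 (wt i) mu)%:R.
  rewrite /Bcoef -/Delta (sum_pos B P_pos); congr (2 * _ / _ - _).
  apply: eq_bigr => j posj; rewrite (root_parity_root B).
  rewrite (@fsbigE _ _ _ _ _ (index_iota 1 K)) ?iota_uniq //.
  - rewrite big_seq_cond [RHS]big_seq; apply: eq_bigl => n.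
    by rewrite mem_index_iota; apply: andb_idr => /andP[n1 _]; rewrite inE.
  - by move=> n /=; rewrite mem_index_iota => /andP[].
  - move=> n /= n1; rewrite mem_index_iota n1 /= -leqNgt => Kn.
    by rewrite (d_hw i) ?mulr0 ?dK.
(* [FR] only sees weights strictly above [mu], so even the copies of [L0 mu] drop out; this keeps
   the unknown [m mu] out of the right side. *)
have FR0 i : ~ weight_gt P (wt i) mu -> FR (wt i) = 0.
  move=> ngt; rewrite /FR big1 ?mulr0 // => j posj; rewrite big_nat.
  apply: big1 => n /andP[n1 _]; apply/eqP; rewrite mulf_eq0 pnatr_eq0 orbC.
  apply/orP; left; apply/negPn/negP => h; apply: ngt.
  have gt0 := weight_gt_root mu posj n1.
  by case: (hw_mult_gt h) => [<-//|gt1]; apply: weight_gt_trans gt1 gt0.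
have dFR : (d mu)%:R = \sum_(i | wt i \in A) FR (wt i) / Delta.
  have -> : \sum_(i | wt i \in A) FR (wt i) / Delta = \sum_i FR (wt i) / Delta.
    rewrite big_mkcond; apply: eq_bigr => i _; case: ifPn => // iA.
    rewrite FR0 ?mul0r // => gt; case/negP: iA; rewrite inE; split=> //.
  rewrite -mulr_suml; apply: (mulIf Delta0); rewrite mulfVK // mulrC.
  have [v [v0 vLa vsing gen]] := simple_hw_generated hV.
  rewrite /Delta (freudenthal B arch H0_regular P_pos (@sact_linl _ _ V)
    (@sact_linr _ _ V) (@sact_brk _ _ V) vLa vsing gen dK).
  rewrite -mulr_sumr; congr (2 * _); rewrite [RHS]exchange_big; apply: eq_bigr => j _.
  rewrite [RHS]exchange_big; apply: eq_bigr => n _ /=.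
  by rewrite /wdim dE natr_sum mulrA mulr_sumr.
rewrite eq1 (sum_multiplicity A (fun nu => (hw_mult L0 nu mu)%:R) mE) dFR -sumrB.
under [RHS]eq_fsbigr do rewrite mulrC.
rewrite (sum_multiplicity A (Bcoef P L0 La mu) mE).
by apply: eq_bigr => i _; rewrite BE.
Qed.

End Decomposition.

End Multiplicities.

(** * Supermatrices *)

Section DeltaMatrices.
Variables (C : numClosedFieldType) (N : nat).
Implicit Types (X Y : 'M[C]_N) (i j k l : 'I_N).

Lemma mulmx_delta X i j k l : (X *m delta_mx i j) k l = X k i *+ (l == j).
Proof.
rewrite mxE (bigD1 i) //= mxE eqxx big1 ?addr0 => [|r /negPf ri].
  by rewrite /= mulr_natr.
by rewrite mxE ri mulr0.
Qed.

Lemma delta_mulmx X i j k l : (delta_mx i j *m X) k l = X j l *+ (k == i).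
Proof.
rewrite mxE (bigD1 j) //= mxE eqxx andbT big1 ?addr0 => [|r /negPf rj].
  by rewrite mulr_natl.
by rewrite mxE rj andbF mul0r.
Qed.

Lemma mul_delta_mulmx X Y i j k l :
  (X *m delta_mx i j *m Y) k l = X k i * Y j l.
Proof.
rewrite -mulmxA mxE (bigD1 i) //= delta_mulmx eqxx mulr1n big1 ?addr0 // => r /negPf ri.
by rewrite delta_mulmx ri mulr0.
Qed.

End DeltaMatrices.

Section SuperMatrices.
Variables (C : numClosedFieldType) (m n : nat).
Implicit Types (X Y Z : 'M[C]_(m + n)) (i j : 'I_(m + n)).

Definition mxpar i : bool := (m <= i)%N.

Lemma mxpar_lshift (i : 'I_m) : mxpar (lshift n i) = false.
Proof. by rewrite /mxpar /= leqNgt ltn_ord. Qed.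

Lemma mxpar_rshift (i : 'I_n) : mxpar (rshift m i) = true.
Proof. by rewrite /mxpar /= leq_addr. Qed.

Lemma block_parityP p X : block_parity p X <->
  forall i j, mxpar i (+) mxpar j != p -> X i j = 0.
Proof.
case: p; split.
- case=> ul dr i j; rewrite -[X]submxK ul dr.
  case: (split_ordP i) => i' ->; case: (split_ordP j) => j' ->;
    rewrite ?mxpar_lshift ?mxpar_rshift //= => _.
    by rewrite block_mxEul mxE.
  by rewrite block_mxEdr mxE.
- move=> h; split; apply/matrixP => i j; rewrite !mxE; apply: h;
  by rewrite ?mxpar_lshift ?mxpar_rshift.
- case=> ur dl i j; rewrite -[X]submxK ur dl.
  case: (split_ordP i) => i' ->; case: (split_ordP j) => j' ->;
    rewrite ?mxpar_lshift ?mxpar_rshift //= => _.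
    by rewrite block_mxEur mxE.
  by rewrite block_mxEdl mxE.
- move=> h; split; apply/matrixP => i j; rewrite !mxE; apply: h;
  by rewrite ?mxpar_lshift ?mxpar_rshift.
Qed.

Lemma block_parity_lin p c X Y :
  block_parity p X -> block_parity p Y -> block_parity p (c *: X + Y).
Proof.
move=> /block_parityP hX /block_parityP hY; apply/block_parityP => i j h.
by rewrite !mxE hX // hY // mulr0 addr0.
Qed.

Lemma block_parity0 p : block_parity p (0 : 'M[C]_(m + n)).
Proof. by apply/block_parityP => i j _; rewrite mxE. Qed.

Lemma block_parity_mul p p' X Y :
  block_parity p X -> block_parity p' Y -> block_parity (p (+) p') (X *m Y).
Proof.
move=> /block_parityP hX /block_parityP hY; apply/block_parityP => i j h.
rewrite mxE big1 // => k _.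
have [ik|ik] := eqVneq (mxpar i (+) mxpar k) p; last by rewrite hX ?mul0r.
rewrite hY ?mulr0 //; apply: contraNneq h => <-; rewrite -ik.
by case: (mxpar i) (mxpar j) (mxpar k) => [] [] [].
Qed.

Lemma mx_oddE p X : block_parity p X -> mx_odd X = if p then X else 0.
Proof.
by rewrite /mx_odd; case: p => -[h1 h2];
  [rewrite -{3}[X]submxK h1 h2 | rewrite h1 h2 block_mx0].
Qed.

Lemma supercommutatorE p p' X Y : block_parity p X -> block_parity p' Y ->
  supercommutator X Y = X *m Y - (-1) ^+ (p && p') *: (Y *m X).
Proof.
move=> hX hY; rewrite /supercommutator (mx_oddE hX) (mx_oddE hY).
case: p p' {hX hY} => [] [] /=; rewrite ?mul0mx ?mulmx0 ?mul0rn ?addr0 ?scale1r //.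
by rewrite expr1 scaleN1r opprK mulr2n addrA subrK.
Qed.

Lemma supercommutator_parity p p' X Y : block_parity p X -> block_parity p' Y ->
  block_parity (p (+) p') (supercommutator X Y).
Proof.
move=> hX hY; rewrite (supercommutatorE hX hY) addrC -scaleNr.
apply: block_parity_lin; last exact: block_parity_mul.
by rewrite addbC; apply: block_parity_mul.
Qed.

Lemma supertraceE X : supertrace X = \sum_i (-1) ^+ mxpar i * X i i.
Proof.
rewrite big_split_ord /= /supertrace /mxtrace -sumrN; congr (_ + _);
  apply: eq_bigr => i _; rewrite !mxE ?mxpar_lshift ?mxpar_rshift.
  by rewrite mul1r.
by rewrite expr1 mulN1r.
Qed.

Lemma supertrace_linear : linear (@supertrace C m n : 'M[C]_(m + n) -> C^o).
Proof.
move=> c X Y; rewrite !supertraceE scaler_sumr -big_split; apply: eq_bigr => i _ /=.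
by rewrite !mxE mulrDr [_ *: _]mulrCA.
Qed.

Lemma supertrace_mulC p p' X Y : block_parity p X -> block_parity p' Y ->
  supertrace (X *m Y) = (-1) ^+ (p && p') * supertrace (Y *m X).
Proof.
move=> /block_parityP hX /block_parityP hY; rewrite !supertraceE.
under eq_bigr do rewrite mxE mulr_sumr.
rewrite exchange_big mulr_sumr; apply: eq_bigr => k _.
rewrite mxE mulr_sumr mulr_sumr; apply: eq_bigr => i _ /=.
have [ik|ik] := eqVneq (mxpar i (+) mxpar k) p; last by rewrite hX // mul0r !mulr0.
have [ki|ki] := eqVneq (mxpar k (+) mxpar i) p'; last by rewrite hY // mul0r !mulr0.
rewrite [Y k i * _]mulrC !mulrA; congr (_ * _ * _); rewrite -ik -ki.
by case: (mxpar i) (mxpar k) => [] [] /=; rewrite ?expr0 ?expr1 ?mulr1 ?mulrNN ?mul1r.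
Qed.

(** The terms in XYZ agree; the others match after moving [Y], of parity p', across XZ, of parity p
    + p''. *)
Lemma supertrace_inv p p' p'' X Y Z : block_parity p X -> block_parity p' Y ->
  block_parity p'' Z ->
  supertrace (supercommutator X Y *m Z) = supertrace (X *m supercommutator Y Z).
Proof.
move=> hX hY hZ; rewrite (supercommutatorE hX hY) (supercommutatorE hY hZ).
have lin := supertrace_linear.
rewrite mulmxBl mulmxBr (linB lin) [RHS](linB lin) mulmxA -scalemxAl -scalemxAr.
rewrite !(linZ lin); congr (_ - _).
rewrite [X *m (Z *m Y)]mulmxA (supertrace_mulC (block_parity_mul hX hZ) hY).
rewrite [Y *m (X *m Z)]mulmxA.
by case: p p' p'' {hX hY hZ} => [] [] [] /=; rewrite ?expr0 ?expr1 ?scale1r ?mul1r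
  ?scaleN1r ?mulN1r ?opprK.
Qed.

Lemma mx_odd_lin c X Y : mx_odd (c *: X + Y) = c *: mx_odd X + mx_odd Y.
Proof.
by apply/matrixP => i j; rewrite /mx_odd !mxE; case: splitP => i' _;
  rewrite !mxE; case: splitP => j' _; rewrite !mxE ?mulr0 ?addr0.
Qed.

Lemma supercommutator_linl Y : linear (fun X => supercommutator X Y).
Proof.
move=> c X X'; rewrite /supercommutator mx_odd_lin mulmxDl !mulmxDr.
rewrite -!scalemxAl -!scalemxAr [in RHS]scalerDr scalerBr mulrnDl scalerMnr opprD.
by rewrite [RHS]addrACA; congr (_ + _); exact: addrACA.
Qed.

Lemma supercommutator_linr X : linear (supercommutator X).
Proof.
move=> c Y Y'; rewrite /supercommutator mx_odd_lin mulmxDr !mulmxDl.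
rewrite -!scalemxAl -!scalemxAr [in RHS]scalerDr scalerBr mulrnDl scalerMnr opprD.
by rewrite [RHS]addrACA; congr (_ + _); exact: addrACA.
Qed.

Lemma supercommutator_skew p p' X Y : block_parity p X -> block_parity p' Y ->
  supercommutator Y X = - ((-1) ^+ (p && p') *: supercommutator X Y).
Proof.
move=> hX hY; rewrite (supercommutatorE hX hY) (supercommutatorE hY hX).
rewrite andbC; case: (_ && _); rewrite ?expr0 ?expr1 ?scale1r ?scaleN1r ?opprK.
  by rewrite addrC.
by rewrite opprB.
Qed.

End SuperMatrices.

(** The part common to sl and osp, with [c] equal to 1 and 1/2. Closure under the bracket,
    commutativity of the Cartan subalgebra and nondegeneracy are left to each case. *)
Lemma supermatrix_form (C : numClosedFieldType) (m n : nat)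
    (hp : bool -> {vspace 'M[C]_(m + n)}) (h : {vspace 'M[C]_(m + n)})
    (sf : 'M[C]_(m + n) -> 'M[C]_(m + n) -> C) (c : C) :
  (forall p X, X \in hp p -> block_parity p X) ->
  (forall p p' X Y, X \in hp p -> Y \in hp p' ->
     supercommutator X Y \in hp (p (+) p')) ->
  (h <= hp false)%VS ->
  (forall X Y, X \in h -> Y \in h -> X *m Y = Y *m X) ->
  (forall X Y, sf X Y = c * supertrace (X *m Y)) ->
  (forall p X, X \in hp p -> (forall Y, Y \in hp p -> supertrace (X *m Y) = 0) ->
     X = 0) -> c != 0 ->
  @invariant_form C (@SuperData C 'M[C]_(m + n) (@supercommutator C m n) hp h sf) sf.
Proof.
move=> hpP brkP hle hC sfE nondeg c0; have lin := supertrace_linear (C := C) (m := m) (n := n).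
split=> //=.
- exact: supercommutator_linl.
- exact: supercommutator_linr.
- move=> p p' X Y /hpP hX /hpP hY; exact: supercommutator_skew.
- move=> H H' hH hH'; have /hpP pH := subvP hle _ hH; have /hpP pH' := subvP hle _ hH'.
  by rewrite (supercommutatorE pH pH') scale1r hC // subrr.
- by move=> Y a X X'; rewrite !sfE mulmxDl -scalemxAl lin mulrDr; congr (_ + _); exact: mulrCA.
- by move=> X a Y Y'; rewrite !sfE mulmxDr -scalemxAr lin mulrDr; congr (_ + _); exact: mulrCA.
- move=> p p' X Y /hpP hX /hpP hY; rewrite !sfE (supertrace_mulC hY hX) andbC.
  by rewrite mulrCA.
- move=> X Y /hpP hX /hpP hY; rewrite sfE supertraceE big1 ?mulr0 // => i _.
  have /block_parityP := block_parity_mul hX hY => -> //; last by rewrite addbb.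
  exact: mulr0.
- move=> p p' p'' X Y Z /hpP hX /hpP hY /hpP hZ; rewrite !sfE.
  by rewrite (supertrace_inv hX hY hZ).
- move=> p X hX hXY; apply: (nondeg p) => // Y hY.
  by have /eqP := hXY Y hY; rewrite sfE mulf_eq0 (negPf c0) => /eqP.
Qed.

(** * The special linear case *)

Section SpecialLinear.
Variables (C : numClosedFieldType) (m n : nat).
Implicit Types (X Y : 'M[C]_(m + n)) (i j k l : 'I_(m + n)).
Local Notation D := (sl_data C m n).

Let slin := supertrace_linear (C := C) (m := m) (n := n).

Lemma sl_partP p X : X \in hpart D p <->
  block_parity p X /\ (m != n -> supertrace X = 0).
Proof.
apply: vs_ofP => /=; first by split=> [|_]; [exact: block_parity0 | rewrite (lin0 slin)].
move=> a Y Z [Yp Y0] [Zp Z0]; split=> [|mn]; first exact: block_parity_lin.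
by rewrite slin Y0 // Z0 // scaler0 addr0.
Qed.

Lemma sl_cartanP X : X \in cartan D <->
  is_diag_mx X /\ (m != n -> supertrace X = 0).
Proof.
apply: vs_ofP => /=.
  by split=> [|_]; [apply/is_diag_mxP => i j _; rewrite mxE | rewrite (lin0 slin)].
move=> a Y Z [/is_diag_mxP Yp Y0] [/is_diag_mxP Zp Z0]; split=> [|mn].
  by apply/is_diag_mxP => i j ij; rewrite !mxE Yp // Zp // mulr0 addr0.
by rewrite slin Y0 // Z0 // scaler0 addr0.
Qed.

Lemma supertrace_delta X i j :
  supertrace (X *m delta_mx j i) = (-1) ^+ mxpar i * X i j.
Proof.
rewrite supertraceE (bigD1 i) //= mulmx_delta eqxx big1 ?addr0 // => k /negPf ki.
by rewrite mulmx_delta ki mulr0.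
Qed.

Lemma block_parity_delta i j :
  block_parity (mxpar i (+) mxpar j) (delta_mx i j : 'M[C]_(m + n)).
Proof.
apply/block_parityP => k l kl; rewrite mxE; have [ki|//] := eqVneq k i.
by have [lj|//] := eqVneq l j; rewrite ki lj eqxx in kl.
Qed.

Lemma sl_delta_part i j : i != j -> delta_mx i j \in hpart D (mxpar i (+) mxpar j).
Proof.
move=> ij; apply/sl_partP; split=> [|_]; first exact: block_parity_delta.
have -> : delta_mx i j = 1%:M *m delta_mx i j :> 'M[C]_(m + n) by rewrite mul1mx.
by rewrite supertrace_delta mxE eq_sym (negPf ij) mulr0.
Qed.

(** Roots only involve differences of diagonal entries. A multiple of the identity, whose supertrace
    m - n is nonzero when m and n differ, corrects the supertrace without changing them. *)
Lemma sl_diag_lift (x : 'I_(m + n) -> C) : exists2 H, H \in cartan D &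
  forall i j, H i i - H j j = x i - x j.
Proof.
pose X := diag_mx (\row_i x i).
have XE i j : X i j = x i *+ (i == j) by rewrite !mxE.
have dX : is_diag_mx X by apply: diag_mx_is_diag.
have [mn|mn] := eqVneq m n.
  exists X; last by move=> i j; rewrite !XE !eqxx.
  by apply/sl_cartanP; split=> // /eqP nmn; case: (nmn mn).
have mn0 : m%:R - n%:R != 0 :> C by rewrite subr_eq0 eqr_nat.
have str1 : supertrace (1%:M : 'M[C]_(m + n)) = m%:R - n%:R.
  rewrite /supertrace scalar_mx_block block_mxKul block_mxKdr.
  by rewrite !mxtrace1.
exists (X - (supertrace X / (m%:R - n%:R)) *: 1%:M).
  apply/sl_cartanP; split=> [|_].
    apply/is_diag_mxP => i j ij; have ne : (i == j) = false by apply: negbTE.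
    by rewrite !mxE ne !mulr0n mulr0 subr0.
  by rewrite (linB slin) (linZ slin) str1 [_ *: _]divfK // subrr.
by move=> i j; rewrite !mxE !eqxx !mulr1n; ring.
Qed.

Lemma sl_form : invariant_form (D := D) (fun X Y => supertrace (X *m Y)).
Proof.
apply: (@supermatrix_form C m n _ _ _ 1).
- by move=> p X /sl_partP[].
- move=> p p' X Y /sl_partP[Xp _] /sl_partP[Yp _]; apply/sl_partP.
  split=> [|_]; first exact: supercommutator_parity.
  rewrite (supercommutatorE Xp Yp) (linB slin) (linZ slin).
  by rewrite (supertrace_mulC Xp Yp) subrr.
- apply/subvP => X /sl_cartanP[/is_diag_mxP dX X0]; apply/sl_partP; split=> //.
  apply/block_parityP => i j ij; apply: dX; apply: contraNneq ij => /val_inj ->.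
  by rewrite addbb.
- move=> X Y /sl_cartanP[/is_diag_mxP dX _] /sl_cartanP[/is_diag_mxP dY _].
  apply/matrixP => i j; rewrite !mxE (bigD1 i) //= big1 ?addr0 => [|k ki]; last first.
    by rewrite dX ?mul0r // eq_sym.
  rewrite (bigD1 j) //= big1 ?addr0 => [|k kj]; last by rewrite dX ?mulr0.
  have [->|ij] := eqVneq i j; first exact: mulrC.
  by rewrite (dY i j) // mulr0 mul0r.
- by move=> X Y; rewrite mul1r.
- move=> p X Xp XY; have [/block_parityP hX X0] := (sl_partP p X).1 Xp.
  have off i j : i != j -> X i j = 0.
    move=> ij; have [pij|/hX//] := eqVneq (mxpar i (+) mxpar j) p.
    have := XY (delta_mx j i); rewrite supertrace_delta => h.
    rewrite -[X i j](signrMK (mxpar i)) h ?mulr0 //.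
    by rewrite -pij addbC; apply: sl_delta_part; rewrite eq_sym.
  case: p Xp XY hX => Xp XY hX.
    apply/matrixP => i j; rewrite mxE; have [->|/off//] := eqVneq i j.
    by rewrite hX // addbb.
  have par0 i : block_parity false (delta_mx i i : 'M[C]_(m + n)).
    by have := block_parity_delta i i; rewrite addbb.
  have str_delta i : supertrace (delta_mx i i : 'M[C]_(m + n)) = (-1) ^+ mxpar i.
    by rewrite -[delta_mx i i]mul1mx supertrace_delta mxE eqxx mulr1.
  suff Xd i : X i i = 0.
    by apply/matrixP => i j; rewrite mxE; have [->|/off] := eqVneq i j.
  have [mn|mn] := eqVneq m n.
    have := XY (delta_mx i i); rewrite supertrace_delta => h.
    rewrite -[X i i](signrMK (mxpar i)) h ?mulr0 //.
    by apply/sl_partP; split=> // /eqP nmn; case: (nmn mn).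
  have signZ b (x : C) : (-1) ^+ b *: ((-1) ^+ b * x : C^o) = x by exact: signrMK.
  have signZ1 b : (-1) ^+ b *: ((-1) ^+ b : C^o) = 1.
    by rewrite -[RHS](signZ b) mulr1.
  (* The test matrix is a difference of signed elementary diagonal matrices of supertrace zero. A
     scalar [X] then has supertrace (m - n) times its entry, which must vanish. *)
  have Xij j : X j j = X i i.
    have := XY ((-1) ^+ mxpar j *: delta_mx j j - (-1) ^+ mxpar i *: delta_mx i i).
    rewrite mulmxBr -!scalemxAr (linB slin) !(linZ slin) !supertrace_delta.
    rewrite !signZ => h; apply/eqP; rewrite -subr_eq0; apply/eqP/h.
    apply/sl_partP; split=> [|_].
      rewrite -scaleNr addrC; apply: block_parity_lin => //.
      by rewrite -[_ *: _]addr0; apply: block_parity_lin => //; apply: block_parity0.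
    by rewrite (linB slin) !(linZ slin) !str_delta !signZ1 subrr.
  have := X0 mn; rewrite supertraceE; under eq_bigr do rewrite Xij.
  rewrite -mulr_suml => /eqP; rewrite mulf_eq0 => /orP[|/eqP//].
  rewrite big_split_ord /=; under eq_bigr do rewrite mxpar_lshift.
  under [X in _ + X]eq_bigr do rewrite mxpar_rshift.
  by rewrite !sumr_const !card_ord mulNrn subr_eq0 eqr_nat (negPf mn).
- exact: oner_neq0.
Qed.

Theorem sl_root_datum : exists (I : finType) (a : I -> weight D) e q F,
  root_datum a e q F.
Proof.
pose J := ('I_(m + n) * 'I_(m + n))%type.
pose e (x : J) : D := if x.1 == x.2 then 0 else delta_mx x.1 x.2.
pose a (x : J) : weight D :=
  @wt_of _ D (fun H : 'M[C]_(m + n) => H x.1 x.1 - H x.2 x.2).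
pose q (x : J) := mxpar x.1 (+) mxpar x.2.
have aE x (H : subvs_of (cartan D)) :
    a x H = (vsval H : 'M[C]_(m + n)) x.1 x.1 - (vsval H : 'M[C]_(m + n)) x.2 x.2.
  by rewrite /a wt_ofE // => c X Y; rewrite !mxE; ring.
have aP (z : 'I_(m + n) -> C) : exists H' : subvs_of (cartan D), forall x, a x H' = z x.1 - z x.2.
  have [H hH HE] := sl_diag_lift z; exists (vsproj (cartan D) H) => x.
  by rewrite aE vsprojK // HE.
have e0 x : e x != 0 -> x.1 != x.2.
  by rewrite /e; case: (x.1 == x.2) => //; rewrite eqxx.
suff [I [a' [e' [q' R]]]] : exists (I : finType) (a' : I -> weight D) e' q',
    root_datum a' e' q' (fun X Y : 'M[C]_(m + n) => supertrace (X *m Y)).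
  by exists I, a', e', q', (fun X Y : 'M[C]_(m + n) => supertrace (X *m Y)).
apply: (root_datum_of_family (a := a) (e := e) (q := q) sl_form).
- move=> x; rewrite /e; case: eqVneq => [_|x12]; first exact: mem0v.
  exact: sl_delta_part.
- move=> x H; have /sl_cartanP[/is_diag_mxP dH _] := subvsP H.
  have Hp : block_parity false (vsval H : 'M[C]_(m + n)).
    apply/block_parityP => i j ij; apply: dH; apply: contraNneq ij => /val_inj ->.
    by rewrite addbb.
  rewrite aE /e; case: eqVneq => [_|x12].
    rewrite scaler0; exact: (lin0 (supercommutator_linr _)).
  rewrite /= (supercommutatorE Hp (block_parity_delta _ _)) scale1r.
  apply/matrixP => k l; rewrite [LHS]mxE [X in _ + X]mxE [RHS]mxE mulmx_delta.
  rewrite delta_mulmx mxE.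
  have [->|lx] := eqVneq l x.2; have [->|kx] := eqVneq k x.1.
  + by rewrite mulr1.
  + by rewrite dH //= ?mulr0n mulr0 subr0.
  + by rewrite (dH x.2) 1?eq_sym //= ?mulr0n mulr0 subr0.
  + by rewrite /= ?mulr0n mulr0 subr0.
- move=> x /e0 x12 ax0; exfalso.
  have [H HE] := aP (fun i => (i == x.1)%:R).
  have := HE x; rewrite ax0 zero_lfunE eqxx eq_sym.
  by rewrite (negPf x12) subr0 => /eqP; rewrite eq_sym oner_eq0.
- move=> x y /e0 x12 /e0 y12 _ axy.
  have delta i : (i == x.1)%:R - (i == x.2)%:R = (i == y.1)%:R - (i == y.2)%:R :> C.
    have [H HE] := aP (fun j => (i == j)%:R).
    by rewrite -(HE x) -(HE y) axy.
  (* The value 1 of the indicator difference marks the row index, and -1 the column index;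
     characteristic zero keeps them apart. *)
  have b_inj (b1 b2 : bool) : b1%:R - b2%:R = 1 :> C -> b1.
    case: b1 b2 => [] [] // /eqP; rewrite ?subrr ?sub0r eq_sym ?oner_eq0 //.
    by rewrite -addr_eq0 -mulr2n pnatr_eq0.
  have y1 : x.1 = y.1.
    by apply/eqP/(b_inj _ (x.1 == y.2)); rewrite -delta eqxx (negPf x12) subr0.
  have y2 : x.2 = y.2.
    apply/eqP/(b_inj _ (x.2 == y.1)); rewrite -opprB -delta eqxx eq_sym (negPf x12).
    by rewrite sub0r opprK.
  have -> : y = x by rewrite [x]surjective_pairing y1 y2 -surjective_pairing.
  by split=> //; exists 1; rewrite scale1r.
move=> p X Xp; have [/block_parityP hX X0] := (sl_partP p X).1 Xp.
exists (diag_mx (\row_i X i i)), (fun x : J => X x.1 x.2); split.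
- apply/sl_cartanP; split=> [|/X0 <-]; first exact: diag_mx_is_diag.
  by rewrite !supertraceE; apply: eq_bigr => i _; rewrite !mxE eqxx.
- move=> pT; apply/matrixP => i j; rewrite !mxE hX ?mul0rn //.
  by rewrite addbb pT.
apply/matrixP => k l; rewrite mxE summxE !mxE.
have [kl|kl] := eqVneq k l.
  rewrite -kl big1 ?addr0 // => x _; rewrite mxE /e.
  case: eqVneq => [_|x12]; rewrite mxE ?mulr0 //.
  have [kx|_] := eqVneq k x.1; last by rewrite mulr0.
  by rewrite kx (negPf x12) mulr0.
rewrite mulr0n add0r big_mkcond (bigD1 (k, l)) //= big1 ?addr0 => [|x xkl].
  rewrite /q /=; case: (eqVneq (_ (+) _) p) => [_|klp]; last exact: hX.
  by rewrite mxE /e /= (negPf kl) mxE !eqxx mulr1.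
case: ifP => // _; rewrite mxE /e; case: eqVneq => [_|_]; rewrite mxE ?mulr0 //.
have [kx|_] := eqVneq k x.1; last by rewrite mulr0.
have [lx|_] := eqVneq l x.2; last by rewrite mulr0.
by case/eqP: xkl; rewrite kx lx -surjective_pairing.
Qed.

End SpecialLinear.

(** * Split forms of orthosymplectic matrices *)

(* An orthosymplectic space in a basis indexed by 'I_N: [sg] matches each index with
   the one of the opposite weight (fixing the index of weight 0), [ta] tells the second
   index of a pair from the first, and [par] marks the symplectic indices. *)
Section PairedIndices.
Variables (C : numClosedFieldType) (N : nat).
Variables (par ta : 'I_N -> bool) (sg : 'I_N -> 'I_N).
Hypothesis sgK : involutive sg.
Hypothesis par_sg : forall k, par (sg k) = par k.
Hypothesis ta_sg : forall k, sg k != k -> ta (sg k) = ~~ ta k.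
Hypothesis ta_fix : forall k, sg k = k -> ta k = false.
Hypothesis par_free : forall k, par k -> sg k != k.

Implicit Types (k l x y : 'I_N) (c : 'I_N -> C).

Definition paired k x := (k == x) || (k == sg x).

Lemma pairedP k x : paired k x -> k = x \/ k = sg x /\ sg x != x.
Proof.
move=> /orP[/eqP ->|/eqP ->]; first by left.
by have [->|] := eqVneq (sg x) x; [left | right].
Qed.

Lemma paired_sym k x : paired k x = paired x k.
Proof. by rewrite /paired eq_sym [k == sg x]eq_sym (can2_eq sgK sgK). Qed.

Lemma paired_sg k x : paired (sg k) x = paired k x.
Proof. by rewrite /paired (can2_eq sgK sgK) (inj_eq (inv_inj sgK)) orbC. Qed.

Lemma paired_par k x : paired k x -> par k = par x.
Proof. by move=> /pairedP[->|[->]]. Qed.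

Lemma sum_paired (f : 'I_N -> C) x :
  \sum_(l | paired l x) f l = f x + (if sg x == x then 0 else f (sg x)).
Proof.
rewrite (bigD1 x) /=; last by rewrite /paired eqxx.
congr (_ + _); case: eqVneq => [sx|sx].
  by rewrite big_pred0 // => l; rewrite /paired sx orbb andbN.
rewrite (big_pred1 (sg x)) // => l; rewrite /paired /= andb_orl andbN.
by case: eqVneq => // ->; rewrite sx.
Qed.

(** Coordinates of the eigenvectors (1, -i) and (1, i) of the block (0, i; -i, 0), with eigenvalues
    1 and -1. *)
Definition pair_coef (b b' : bool) : C :=
  if b then (if b' then 'i else - 'i) else 1.

Definition weight_basis : 'M[C]_N :=
  \matrix_(k, x) (if paired k x then pair_coef (ta k) (ta x) else 0).

Definition weight_cobasis : 'M[C]_N :=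
  \matrix_(x, k) (if paired k x
    then (if sg x == x then 1 else 2^-1) * (if ta k then - pair_coef true (ta x) else 1)
    else 0).

Definition pair_cartan c : 'M[C]_N :=
  \matrix_(k, l) (if (l == sg k) && (sg k != k)
    then (if ta k then - 'i else 'i) * c k else 0).

Definition pair_weight c x : C :=
  if sg x == x then 0 else if ta x then - c x else c x.

Definition pair_form : 'M[C]_N :=
  \matrix_(k, l) (if par k then (if l == sg k then (-1) ^+ ta k else 0)
                  else (k == l)%:R).

Local Notation U := weight_basis.
Local Notation W := weight_cobasis.
Local Notation J := pair_form.

Let ii : 'i * 'i = -1 :> C. Proof. by rewrite -expr2 sqrCi. Qed.

Lemma weight_basis_paired k x : ~~ paired k x -> U k x = 0.
Proof. by rewrite mxE => /negPf ->. Qed.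

Lemma weight_basisK : W *m U = 1%:M.
Proof.
apply/matrixP => x y; rewrite !mxE (bigID (fun k => paired k x)) /=.
rewrite [X in _ + X]big1 ?addr0 => [|k kx]; last by rewrite mxE (negPf kx) mul0r.
rewrite sum_paired !mxE !paired_sg ![paired _ x]/paired ?eqxx /= paired_sym.
have [xy|nxy] := boolP (paired y x); last first.
  have -> : (x == y) = false.
    by apply: contraNF nxy => /eqP ->; rewrite /paired eqxx.
  by rewrite !mulr0 add0r; case: ifP; rewrite ?mulr0.
(* The algebraic tactics treat ['i] as an indeterminate, so the entries are compared modulo i^2 + 1
   with an explicit cofactor [z]. *)
have by_ii (z u t : C) : u - t = z * ('i * 'i + 1) -> u = t.
  by rewrite ii addNr mulr0 => /eqP; rewrite subr_eq0 => /eqP.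
have n2 : 2 != 0 :> C by rewrite pnatr_eq0.
have [yx|[yx sx]] := pairedP xy; rewrite yx ?eqxx.
  case: eqVneq => [/ta_fix ->|sx]; first by rewrite !mulr1 addr0.
  rewrite ta_sg //; apply: (by_ii (- 2^-1)).
  by case: (ta x); rewrite /pair_coef /=; field.
rewrite (negPf sx) !ta_sg // [x == _]eq_sym (negPf sx); apply: (by_ii 2^-1).
by case: (ta x); rewrite /pair_coef /=; field.
Qed.

Lemma weight_cobasisK : U *m W = 1%:M.
Proof. exact: mulmx1C weight_basisK. Qed.

Lemma pair_cartan_diag c : (forall k, c (sg k) = c k) ->
  pair_cartan c *m U = U *m diag_mx (\row_x pair_weight c x).
Proof.
move=> csg; apply/matrixP => k x; rewrite [LHS]mxE mul_mx_diag !mxE.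
rewrite (bigD1 (sg k)) //= big1 ?addr0 => [|l /negPf lk]; last by rewrite mxE lk mul0r.
rewrite !mxE eqxx paired_sg /=; have [kx|_] := boolP (paired k x); last first.
  by rewrite mulr0 mul0r.
have [->|[-> sx]] := pairedP kx; rewrite /pair_weight.
  case: eqVneq => [|sx] /=; first by rewrite mul0r mulr0.
  rewrite ta_sg //; case: (ta x); rewrite /pair_coef /=;
   rewrite ?mulr1 ?mul1r ?mulNr ?mulrN ?opprK //.
  by rewrite mulrAC ii mulN1r opprK.
rewrite (negPf sx) sgK eq_sym sx csg ta_sg //=; case: (ta x); rewrite /pair_coef /=;
   rewrite ?mulr1 ?mul1r ?mulNr ?mulrN ?opprK //.
by rewrite mulrAC ii mulN1r ?opprK.
Qed.

Definition par_even (A : 'M[C]_N) := forall k x, par k != par x -> A k x = 0.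

Lemma weight_basis_even : par_even U.
Proof.
move=> k x kx; apply: weight_basis_paired; apply: contra_neqN kx.
exact: paired_par.
Qed.

Lemma weight_cobasis_even : par_even W.
Proof.
move=> x k kx; rewrite mxE ifN //; apply: contra_neqN kx => /paired_par.
by [].
Qed.

Lemma par_even_trmx A : par_even A -> par_even A^T.
Proof. by move=> Ae k x kx; rewrite mxE Ae // eq_sym. Qed.

(* The matrices M with M *m J in the orthosymplectic Lie superalgebra. *)
Definition superanti (M : 'M[C]_N) :=
  forall k l, M k l = - ((-1) ^+ (par k && par l) * M l k).

Lemma superanti_congr A M : par_even A -> superanti M ->
  superanti (A *m M *m A^T).
Proof.
move=> Ae Ma k l; rewrite !mxE.
under eq_bigr do rewrite mxE mulr_suml.
rewrite exchange_big mulr_sumr -sumrN; apply: eq_bigr => i _ /=.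
rewrite !mxE mulr_suml mulr_sumr -sumrN; apply: eq_bigr => j _.
rewrite !mxE (Ma i j).
have [ki|ki] := eqVneq (par k) (par i); last by rewrite Ae ?mulr0 ?mul0r ?mulr0 ?oppr0.
have [lj|lj] := eqVneq (par l) (par j); last first.
  by rewrite [A l j]Ae // !mulr0 ?mul0r ?mulr0 ?oppr0.
by rewrite ki lj; ring.
Qed.

Lemma pair_form_even : par_even J.
Proof.
move=> k l kl; rewrite mxE; case: ifP => pk.
  by case: eqP => // lk; rewrite lk par_sg eqxx in kl.
by case: eqP => // lk; rewrite lk eqxx in kl.
Qed.

Lemma pair_formE (M : 'M[C]_N) k l : (M *m J) k l =
  if par l then - (-1) ^+ ta l * M k (sg l) else M k l.
Proof.
rewrite mxE; case: ifP => pl.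
  rewrite (bigD1 (sg l)) //= mxE par_sg pl sgK eqxx ta_sg ?par_free //.
  rewrite big1 ?addr0 => [|i il]; first by case: (ta l); ring.
  rewrite mxE; case: ifP => pi.
    by case: eqP => [li|_]; rewrite ?mulr0 //; case/eqP: il; rewrite li sgK.
  by case: eqP => [il'|_]; rewrite ?mulr0 //; rewrite il' pl in pi.
rewrite (bigD1 l) //= mxE pl eqxx mulr1 big1 ?addr0 // => i il.
rewrite mxE (negPf il); case: ifP => pi; rewrite ?mulr0 //.
by case: eqP => [li|]; rewrite ?mulr0 //; rewrite li par_sg pi in pl.
Qed.

Lemma pair_form_mulE (M : 'M[C]_N) k l : (J *m M) k l =
  if par k then (-1) ^+ ta k * M (sg k) l else M k l.
Proof.
rewrite mxE; case: ifP => pk.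
  rewrite (bigD1 (sg k)) //= mxE pk eqxx big1 ?addr0 // => i /negPf ik.
  by rewrite mxE pk ik mul0r.
rewrite (bigD1 k) //= mxE pk eqxx mul1r big1 ?addr0 // => i ik.
by rewrite mxE pk eq_sym (negPf ik) mul0r.
Qed.

Lemma pair_formK : J *m J^T = 1%:M.
Proof.
apply/matrixP => k l; rewrite !mxE; under eq_bigr do rewrite !mxE.
case: (boolP (par k)) => pk.
  rewrite (bigD1 (sg k)) //= eqxx big1 ?addr0 => [|i /negPf ->]; last by rewrite mul0r.
  case: ifP => pl; first rewrite (inj_eq (inv_inj sgK)).
    by case: eqP => [->|_]; rewrite ?mulr0 // -expr2 sqrr_sign.
  have -> : (l == sg k) = false.
    by apply: contraFF pl => /eqP ->; rewrite par_sg.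
  by have -> : (k == l) = false; [apply: contraFF pl => /eqP <- | rewrite mulr0].
rewrite (bigD1 k) //= eqxx big1 ?addr0 => [|i ik]; last first.
  by rewrite eq_sym (negPf ik) mul0r.
rewrite mul1r; case: ifP => pl; last by rewrite eq_sym.
have -> : (k == sg l) = false.
  by apply: contraNF pk => /eqP ->; rewrite par_sg.
by have -> : (k == l) = false; [apply: contraNF pk => /eqP -> | ].
Qed.

Lemma pair_cartan_form c : (forall k, c (sg k) = c k) ->
  (pair_cartan c)^T *m J = - (J *m pair_cartan c).
Proof.
move=> csg; apply/matrixP => k l.
rewrite pair_formE [RHS]mxE pair_form_mulE !mxE !sgK.
case: (boolP (par l)) => pl; case: (boolP (par k)) => pk.
- rewrite [l == k]eq_sym; have [->|_] := eqVneq k l; first by rewrite mulNr.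
  by rewrite /= !mulr0 oppr0.
- have -> : (k == l) = false by apply: contraNF pk => /eqP ->.
  have -> : (l == sg k) = false by apply: contraNF pk => /eqP lk; rewrite -par_sg -lk.
  by rewrite /= mulr0 oppr0.
- have -> : (l == k) = false by apply: contraNF pl => /eqP ->.
  have -> : (k == sg l) = false by apply: contraNF pl => /eqP kl; rewrite -par_sg -kl.
  by rewrite /= mulr0 oppr0.
rewrite -(can2_eq sgK sgK k l) eq_sym; have [->|_] := eqVneq l (sg k).
  rewrite sgK eq_sym csg; case: eqP => [|/eqP sk] /=; first by rewrite oppr0.
  by rewrite ta_sg //; case: (ta k); rewrite /= ?mulNr ?opprK.
by rewrite oppr0.
Qed.

Local Notation w := pair_weight.

(** Cartan matrices are skew for the form, so transposing the eigenvector relation turns it into one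
    for U^T J, with opposite eigenvalues. *)
Lemma cobasis_cartan c : (forall k, c (sg k) = c k) ->
  U^T *m J *m pair_cartan c = - (diag_mx (\row_x w c x) *m U^T *m J).
Proof.
move=> csg; rewrite -mulmxA -[J *m _]opprK -pair_cartan_form // mulmxN mulmxA.
by rewrite -trmx_mul pair_cartan_diag // trmx_mul tr_diag_mx.
Qed.

(** The super exterior square of the standard representation, realised in the algebra by M -> U M
    U^T J. The vector of the pair (x, y) has the sum of the two weights. *)
Definition pair_rootv x y : 'M[C]_N :=
  U *m (delta_mx x y - (-1) ^+ (par x && par y) *: delta_mx y x) *m U^T *m J.

Lemma pair_rootv_weight c x y : (forall k, c (sg k) = c k) ->
  pair_cartan c *m pair_rootv x y - pair_rootv x y *m pair_cartan c =
  (w c x + w c y) *: pair_rootv x y.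
Proof.
move=> csg; rewrite /pair_rootv; set d := diag_mx (\row_x w c x).
set M := delta_mx x y - _.
have MdE : d *m M + M *m d = (w c x + w c y) *: M.
  apply/matrixP => k l; rewrite mxE mul_diag_mx mul_mx_diag !mxE.
  set s := (-1) ^+ _; case: (boolP ((k == x) && (l == y))) => [/andP[/eqP -> /eqP ->]|_];
    case: (boolP (_ && _)) => [/andP[/eqP e1 /eqP e2]|_]; rewrite ?e1 ?e2 /=; ring.
rewrite -[U *m M *m U^T *m J *m _]mulmxA -[U *m M *m U^T *m (J *m _)]mulmxA.
rewrite [U^T *m (J *m _)]mulmxA cobasis_cartan // mulmxN opprK.
rewrite !mulmxA pair_cartan_diag // -/d -!mulmxDl -[U *m d *m M]mulmxA.
rewrite -[U *m M *m d]mulmxA -mulmxDr MdE.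
by rewrite -scalemxAr -!scalemxAl.
Qed.

Lemma pair_rootv_sym x y :
  pair_rootv y x = (- (-1) ^+ (par x && par y)) *: pair_rootv x y.
Proof.
rewrite /pair_rootv scalemxAl scalemxAl scalemxAr; do 3 congr (_ *m _).
rewrite scalerBr scalerA [par y && _]andbC mulNr -expr2 sqrr_sign.
by rewrite scaleNr scaleN1r opprK addrC.
Qed.

Lemma superanti_delta x y :
  superanti (delta_mx x y - (-1) ^+ (par x && par y) *: delta_mx y x).
Proof.
move=> k l; rewrite !mxE; set s := (-1) ^+ (par x && par y).
have s2 : s * s = 1 by rewrite -expr2 sqrr_sign.
rewrite [(l == x) && _]andbC [(l == y) && _]andbC.
have [/andP[/eqP -> /eqP ->]|_] := boolP ((k == x) && (l == y)).
  rewrite -/s mulrBr mulr1n mulrA s2 mul1r; case: (_ && _) => /=; ring.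
have [/andP[/eqP -> /eqP ->]|_] := boolP ((k == y) && (l == x)).
  by rewrite andbC -/s /=; ring.
by rewrite /=; ring.
Qed.

Lemma pair_rootv_super x y : exists2 M, superanti M & pair_rootv x y = M *m J.
Proof.
exists (U *m (delta_mx x y - (-1) ^+ (par x && par y) *: delta_mx y x) *m U^T) => //.
apply: superanti_congr; [exact: weight_basis_even | exact: superanti_delta].
Qed.

Definition par_hom (b : bool) (M : 'M[C]_N) :=
  forall k l, par k (+) par l != b -> M k l = 0.

Lemma par_hom_mull b A M : par_even A -> par_hom b M -> par_hom b (A *m M).
Proof.
move=> Ae Mh k l kl; rewrite mxE; apply: big1 => i _.
have [ki|ki] := eqVneq (par k) (par i); last by rewrite Ae // mul0r.
by rewrite Mh ?mulr0 // -ki.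
Qed.

Lemma par_hom_mulr b A M : par_even A -> par_hom b M -> par_hom b (M *m A).
Proof.
move=> Ae Mh k l kl; rewrite mxE; apply: big1 => i _.
have [il|il] := eqVneq (par i) (par l); last by rewrite Ae // mulr0.
by rewrite Mh ?mul0r // il.
Qed.

Lemma par_hom_delta x y : par_hom (par x (+) par y)
  (delta_mx x y - (-1) ^+ (par x && par y) *: delta_mx y x).
Proof.
move=> i j h.
rewrite !mxE; have [/andP[/eqP ix /eqP jy]|_] := boolP ((i == x) && _).
  by rewrite ix jy eqxx in h.
have [/andP[/eqP iy /eqP jx]|_] := boolP ((i == y) && (j == x)).
  by rewrite iy jx addbC eqxx in h.
by rewrite mulr0 subr0.
Qed.

Lemma pair_rootv_par x y : par_hom (par x (+) par y) (pair_rootv x y).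
Proof.
apply: (par_hom_mulr pair_form_even).
apply: (par_hom_mulr (par_even_trmx weight_basis_even)).
exact: (par_hom_mull weight_basis_even (par_hom_delta (x:=x) (y:=y))).
Qed.

Lemma pair_form_sym k l : J k l = (-1) ^+ par k * J l k.
Proof.
rewrite !mxE; case: (boolP (par k)) => pk; case: (boolP (par l)) => pl.
- have [->|lk] := eqVneq l (sg k).
    by rewrite sgK eqxx ta_sg ?par_free //; case: (ta k); rewrite /= ?mulN1r ?opprK ?mulr1.
  have -> : (k == sg l) = false; last by rewrite mulr0.
  by apply: contraNF lk => /eqP ->; rewrite sgK.
- have -> : (l == sg k) = false by apply: contraNF pl => /eqP ->; rewrite par_sg.
  have -> : (l == k) = false by apply: contraNF pl => /eqP ->.
  by rewrite mulr0.
- have -> : (k == sg l) = false by apply: contraNF pk => /eqP ->; rewrite par_sg.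
  have -> : (k == l) = false by apply: contraNF pk => /eqP ->.
  by rewrite mulr0.
by rewrite mul1r eq_sym.
Qed.

(* The sign rule (p_k + p_i)(p_k + p_j) = p_k + p_k p_i + p_k p_j + p_i p_j makes this
   a termwise identity. *)
Lemma superanti_form_mul b b' M M' : superanti M -> superanti M' ->
  par_hom b M -> par_hom b' M' -> forall i j,
  (M *m J *m M') i j = - ((-1) ^+ (par i && par j) *
    (- ((-1) ^+ (b && b') * (M' *m J *m M) j i))).
Proof.
move=> Ma M'a Mh M'h i j; rewrite mulrN opprK mulrA !mxE.
under eq_bigr do rewrite mxE mulr_suml.
under [in RHS]eq_bigr do rewrite mxE mulr_suml.
rewrite mulr_sumr exchange_big /=; apply: eq_bigr => k _.
rewrite mulr_sumr; apply: eq_bigr => l _ /=.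
have [lk|lk] := eqVneq (par l) (par k); last first.
  have J1 : J k l = 0 by apply: pair_form_even; rewrite eq_sym.
  have J2 : J l k = 0 by exact: pair_form_even.
  by rewrite J1 J2 ?mulr0 ?mul0r ?mulr0.
have [ik|ik] := eqVneq (par i (+) par k) b; last first.
  by rewrite Mh // [M k i]Mh 1?addbC // ?mul0r ?mulr0 ?mul0r ?mulr0.
have [lj|lj] := eqVneq (par l (+) par j) b'; last first.
  by rewrite M'h // [M' j l]M'h 1?addbC // ?mul0r ?mulr0 ?mul0r ?mulr0.
rewrite (Ma i k) (M'a l j) pair_form_sym -ik -lj lk.
by case: (par i) (par j) (par k) => [] [] [] /=; ring.
Qed.

(** The coefficients are the entries of [M] in the weight basis; the factor 1/2 compensates for
    listing each pair in both orders. *)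
Lemma pair_rootv_span M : superanti M -> M *m J =
  \sum_(p : 'I_N * 'I_N) (2^-1 * (W *m M *m W^T) p.1 p.2) *: pair_rootv p.1 p.2.
Proof.
move=> Ma; set M' := W *m M *m W^T.
have M'a : superanti M' by apply: superanti_congr => //; exact: weight_cobasis_even.
have ME : M = U *m M' *m U^T.
  rewrite /M' !mulmxA weight_cobasisK mul1mx -mulmxA -trmx_mul weight_cobasisK.
  by rewrite trmx1 mulmx1.
move: M' M'a ME => M' M'a ME; have M'E : M' = \sum_(p : 'I_N * 'I_N) (2^-1 * M' p.1 p.2) *:
    (delta_mx p.1 p.2 - (-1) ^+ (par p.1 && par p.2) *: delta_mx p.2 p.1).
  apply/matrixP => k l; rewrite summxE.
  under eq_bigr => p _ do rewrite !mxE mulrBr.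
  rewrite sumrB (bigD1 (k, l)) //= !eqxx big1 => [|[x y] /= xy]; last first.
    have [/andP[/eqP kx /eqP ly]|_] := boolP ((k == x) && (l == y)); last exact: mulr0.
    by rewrite kx ly eqxx in xy.
  rewrite (bigD1 (l, k)) //= !eqxx big1 => [|[x y] /= xy]; last first.
    have [/andP[/eqP ky /eqP lx]|_] := boolP ((k == y) && (l == x)); last by rewrite !mulr0.
    by rewrite ky lx eqxx in xy.
  rewrite [M' l k]M'a andbC; have s2 : (-1) ^+ (par k && par l) * (-1) ^+ (par k && par l) = 1 :> C.
    by rewrite -expr2 sqrr_sign.
  transitivity (2^-1 * M' k l + 2^-1 * ((-1) ^+ (par k && par l) * (-1) ^+ (par k && par l)) * M' k l).
    by have n2 : 2 != 0 :> C; [rewrite pnatr_eq0 | rewrite s2; field].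
  by rewrite /=; ring.
rewrite ME {1}M'E mulmx_sumr !mulmx_suml; apply: eq_bigr => p _.
by rewrite -scalemxAr -!scalemxAl.
Qed.

Lemma pair_rootv_cartan x : exists2 c, (forall k, c (sg k) = c k) &
  pair_rootv x (sg x) = pair_cartan c.
Proof.
(* With u = (1, -i) and u' = (1, i), an orthogonal pair gives u u'^T - u' u^T = 2 (0, i; -i, 0), up
   to the order of the pair. A symplectic one gives u u'^T + u' u^T = 2 I, hence 2 Omega after
   multiplication by [J], which is -2i times (0, i; -i, 0). *)
pose z : C := (if par x then -1 else (if ta x then -1 else 1)) * 2 * (if par x then 'i else 1).
exists (fun k => if paired k x then z else 0) => [k|]; first by rewrite paired_sg.
have UU k l : (U *m (delta_mx x (sg x) - (-1) ^+ (par x && par (sg x)) *: delta_mx (sg x) x) *m U^T) k l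
   = U k x * U l (sg x) - (-1) ^+ par x * (U k (sg x) * U l x).
  rewrite par_sg andbb mulmxBr -scalemxAr mulmxBl -scalemxAl.
  by rewrite [LHS]mxE [X in _ + X]mxE [X in - X]mxE !mul_delta_mulmx ![U^T _ _]mxE.
apply/matrixP => k l; rewrite /pair_rootv pair_formE !UU [RHS]mxE.
have [kx|nkx] := boolP (paired k x); last first.
  rewrite ![U k _]mxE [paired k (sg x)]paired_sym paired_sg [paired x k]paired_sym.
  by rewrite (negPf nkx) !mul0r !mulr0 subr0 mulr0 !if_same.
have [lx|nlx] := boolP (paired l x); last first.
  rewrite ![U l _]mxE ![U (sg l) _]mxE !paired_sg [paired l (sg x)]paired_sym.
  rewrite paired_sg [paired x l]paired_sym (negPf nlx) !mulr0 subr0 mulr0 if_same.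
  by rewrite ifN // negb_and; case: eqP nlx => // ->; rewrite paired_sg kx.
have by_ii (u t c : C) : u - t = c * ('i * 'i + 1) -> u = t.
  by rewrite ii addNr mulr0 => /eqP; rewrite subr_eq0 => /eqP.
have px : paired x x by rewrite /paired eqxx.
have pxs : paired x (sg x) by rewrite paired_sym paired_sg.
have [sx|sx] := eqVneq (sg x) x.
  have -> : k = x by case: (pairedP kx) => // -[->].
  have -> : l = x by case: (pairedP lx) => // -[->].
  have -> : par x = false by apply: contraTF isT => /par_free; rewrite sx eqxx.
  by rewrite sx eqxx /= !mul1r subrr.
rewrite /z; have nsx : (x == sg x) = false by rewrite eq_sym (negPf sx).
have [->|[-> _]] := pairedP kx; have [->|[-> _]] := pairedP lx;
  rewrite ?par_sg ?sgK ?eqxx ?(negPf sx) ?nsx /= !mxE ?paired_sg ?px ?pxs ?sgK.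
all: rewrite !ta_sg //; case: (par x); case: (ta x); rewrite /pair_coef /=.
all: try by apply: (by_ii _ _ 0); ring.
all: try by apply: (by_ii _ _ 2); ring.
all: try by apply: (by_ii _ _ (-2)); ring.
all: try by apply: (by_ii _ _ 1); ring.
all: try by apply: (by_ii _ _ (-1)); ring.
Qed.

Lemma pair_form_trE (M : 'M[C]_N) k l : (M *m J^T) k l =
  if par l then (-1) ^+ ta l * M k (sg l) else M k l.
Proof.
have -> : M *m J^T = (J *m M^T)^T by rewrite trmx_mul trmxK.
by rewrite mxE pair_form_mulE ![M^T _ _]mxE.
Qed.

Lemma superanti_pair_cartan c : (forall k, c (sg k) = c k) ->
  superanti (pair_cartan c *m J^T).
Proof.
move=> csg k l; rewrite !pair_form_trE !mxE !(inj_eq (inv_inj sgK)).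
case: (boolP (par l)) => pl; case: (boolP (par k)) => pk /=.
- rewrite [k == l]eq_sym; case: eqP => [->|_] /=; first by rewrite expr1 mulN1r opprK.
  by rewrite !mulr0 oppr0.
- have -> : (l == k) = false by apply: contraNF pk => /eqP <-.
  have -> : (k == sg l) = false by apply: contraNF pk => /eqP ->; rewrite par_sg.
  by rewrite /= !mulr0 oppr0.
- have -> : (k == l) = false by apply: contraNF pl => /eqP <-.
  have -> : (l == sg k) = false by apply: contraNF pl => /eqP ->; rewrite par_sg.
  by rewrite /= !mulr0 oppr0.
rewrite mul1r -(can2_eq sgK sgK k l) [sg k == l]eq_sym; case: eqP => [->|_] /=.
  rewrite sgK [k == _]eq_sym csg; case: eqP => [|/eqP sk] /=; first by rewrite oppr0.
  by rewrite ta_sg //; case: (ta k); rewrite /= ?mulNr ?opprK.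
by rewrite oppr0.
Qed.

Lemma pair_cartan_even c : par_hom false (pair_cartan c).
Proof.
move=> k l kl; rewrite mxE; case: eqP => // lk; rewrite lk par_sg addbb in kl.
by [].
Qed.

Lemma pair_cartan_comm c c' : (forall k, c (sg k) = c k) ->
  (forall k, c' (sg k) = c' k) ->
  pair_cartan c *m pair_cartan c' = pair_cartan c' *m pair_cartan c.
Proof.
move=> h h'; rewrite -[LHS]mulmx1 -[RHS]mulmx1 -weight_cobasisK !mulmxA.
rewrite -![_ *m _ *m U]mulmxA !pair_cartan_diag // !mulmxA !pair_cartan_diag //.
by rewrite -![U *m _ *m _]mulmxA [diag_mx _ *m diag_mx _]diag_mxC.
Qed.

Lemma pair_cartan_lin (z : C) c c' :
  pair_cartan (fun x => z * c x + c' x) = z *: pair_cartan c + pair_cartan c'.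
Proof.
by apply/matrixP => i j; rewrite !mxE; case: ifP => _; [ring | rewrite mulr0 addr0].
Qed.

(** Put R = J^T M J. Testing against an unsymmetrised elementary matrix reads off an entry of R; the
    symmetrised test gives twice that entry, because R is again [superanti]. Finally [J] is
    invertible. *)
Lemma pair_form_nondeg M : superanti M ->
  (forall k l, \sum_i (-1) ^+ par i * (M *m J *m
     ((delta_mx k l - (-1) ^+ (par k && par l) *: delta_mx l k) *m J)) i i = 0) ->
  M = 0.
Proof.
move=> Ma h; pose R := J^T *m M *m J^T^T.
have Ra : superanti R.
  by apply: superanti_congr => //; apply/par_even_trmx/pair_form_even.
have trR k l : \sum_i (-1) ^+ par i * (M *m J *m delta_mx k l *m J) i i = R l k.
  rewrite /R trmxK -[J^T *m M *m J]mulmxA [RHS]mxE; apply: eq_bigr => i _.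
  rewrite mul_delta_mulmx [J^T _ _]mxE [J i l]pair_form_sym; ring.
have R0 : R = 0.
  apply/matrixP => l k; rewrite [RHS]mxE.
  have subE (A A' : 'M[C]_N) (z : C) i : (A - z *: A') i i = A i i - z * A' i i.
    by rewrite !mxE.
  have := h k l; rewrite mulmxA mulmxBr -scalemxAr mulmxBl -scalemxAl.
  under eq_bigr do rewrite subE mulrBr mulrCA.
  rewrite sumrB -mulr_sumr !trR [R k l]Ra mulrN opprK mulrA -expr2 sqrr_sign mul1r.
  by move=> /eqP; rewrite -mulr2n mulrn_eq0 => /eqP.
have := congr1 (fun A => J *m A *m J^T) R0.
rewrite /R trmxK mulmx0 mul0mx !mulmxA pair_formK mul1mx -mulmxA pair_formK.
by rewrite mulmx1.
Qed.

Hypothesis fix_uniq : forall k l, sg k = k -> sg l = l -> k = l.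

Let sep x v : int := (x == v)%:Z - (x == sg v)%:Z.

Lemma weight_sep v : sg v != v -> exists2 c, (forall k, c (sg k) = c k) &
  forall x, w c x = (sep x v)%:~R.
Proof.
move=> sv; exists (fun k => if paired k v then (if ta v then -1 else 1) else 0).
  by move=> k; rewrite paired_sg.
move=> x; rewrite /pair_weight /sep; case: eqVneq => sx.
  have -> : (x == v) = false by apply: contraNF sv => /eqP <-; apply/eqP.
  have -> : (x == sg v) = false; last by [].
  by apply: contraNF sv => /eqP xv; rewrite -{2}[v]sgK -xv sx.
have [/pairedP[->|[-> _]]|nxv] := boolP (paired x v).
- by rewrite eqxx eq_sym (negPf sv); case: (ta v); rewrite ?opprK.
- by rewrite (negPf sv) eqxx ta_sg //; case: (ta v); rewrite ?opprK.
move: nxv; rewrite /paired negb_or => /andP[/negPf -> /negPf ->].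
by case: (ta x); rewrite ?oppr0.
Qed.

(** The coordinate functions of [weight_sep] take integer values, so the claim reduces to comparing
    Kronecker symbols. With [pair_rootv_cartan] it places the vectors of weight zero in the Cartan
    subalgebra. *)
Lemma pair_weight0 x y : (forall c, (forall k, c (sg k) = c k) -> w c x + w c y = 0) ->
  y = sg x.
Proof.
move=> h; have hs v : sg v != v -> sep x v + sep y v = 0.
  move=> sv; have [c csg cE] := weight_sep sv; apply/eqP.
  by rewrite -(@intr_eq0 C) rmorphD /= -!cE h.
have [sx|sx] := eqVneq (sg x) x; last first.
  have := hs x sx; rewrite /sep eqxx [x == _]eq_sym (negPf sx).
  by case: (y =P sg x) => // _; case: (y == x).
have [sy|sy] := eqVneq (sg y) y; first by rewrite sx; apply: fix_uniq.
have := hs y sy; rewrite /sep eqxx [y == _]eq_sym (negPf sy).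
by case: (x =P sg y) => [-> _|_]; [rewrite sgK | case: (x == y)].
Qed.

(** This is multiplicity one of the roots. Self-paired indices all have weight zero, hence the
    appeal to their uniqueness. *)
Lemma pair_weight_inj x y z t :
  (forall c, (forall k, c (sg k) = c k) -> w c x + w c y = w c z + w c t) ->
  (exists2 c, (forall k, c (sg k) = c k) & w c x + w c y != 0) ->
  (z, t) = (x, y) \/ (z, t) = (y, x).
Proof.
have wlogx x' y' z' t' : sg x' != x' -> 
  (forall c, (forall k, c (sg k) = c k) -> w c x' + w c y' = w c z' + w c t') ->
  y' <> sg x' -> (z', t') = (x', y') \/ (z', t') = (y', x').
  move=> sx h yx; have hs v : sg v != v -> sep x' v + sep y' v = sep z' v + sep t' v.
    move=> sv; have [c csg cE] := weight_sep sv; apply/eqP.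
    by rewrite -(@eqr_int C) 2!intrD -!cE h.
  have cancel y1 t1 : (forall v, sg v != v -> sep y1 v = sep t1 v) -> t1 = y1.
    move=> hyt; have [sy|sy] := eqVneq (sg y1) y1; last first.
      have := hyt y1 sy; rewrite /sep eqxx [y1 == _]eq_sym (negPf sy).
      by case: (t1 =P y1) => // _; case: (t1 == _).
    have [st|st] := eqVneq (sg t1) t1; first exact: fix_uniq.
    have := hyt t1 st; rewrite /sep eqxx [t1 == _]eq_sym (negPf st).
    by case: (y1 =P t1) => // _; case: (y1 == _).
  (* At the coordinate of [x'] the left side is at least 1, since [y'] is not opposite to [x']. So
     [z'] or [t'] equals [x'], and cancelling it leaves an equality of single weights. *)
  have := hs x' sx; rewrite /sep eqxx [x' == _]eq_sym (negPf sx).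
  have -> : (y' == sg x') = false by apply/eqP.
  case: (z' =P x') => [zx _|_].
    left; rewrite zx; congr pair; apply: cancel => v sv.
    by have := hs v sv; rewrite zx => /addrI.
  case: (t' =P x') => [tx _|_].
    right; rewrite tx; congr pair; apply: cancel => v sv.
    by have := hs v sv; rewrite tx addrC => /addIr.
  by case: (y' == x'); case: (z' == _); case: (t' == _).
move=> h [c csg c0].
have wopp x' : w c x' + w c (sg x') = 0.
  rewrite /pair_weight sgK [_ == sg x']eq_sym csg; case: eqVneq => [_|sx]; first exact: addr0.
  by rewrite ta_sg //; case: (ta x'); rewrite /= ?addNr ?addrN.
have [sx|sx] := eqVneq (sg x) x; last first.
  apply: wlogx => // yx; move: c0; rewrite yx wopp eqxx //.
have [sy|sy] := eqVneq (sg y) y.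
  by have xy := fix_uniq sx sy; move: c0; rewrite -xy -{2}sx wopp eqxx.
have [||e|e] := wlogx y x z t sy; rewrite ?e; [| |by right|by left].
  by move=> c' csg'; rewrite addrC h.
by move=> xy; move: c0; rewrite xy addrC wopp eqxx.
Qed.

End PairedIndices.

(** * The orthosymplectic case *)

(** For odd [m] the last index has no successor, and the default of [insubd] makes it its own
    partner: the vector of weight zero. *)
Definition so_opp m (i : 'I_m) : 'I_m := insubd i (if odd i then i.-1 else i.+1).

Lemma val_so_opp m (i : 'I_m) : so_opp i =
  (if odd i then i.-1 else if (i.+1 < m)%N then i.+1 else i) :> nat.
Proof.
rewrite /so_opp -[nat_of_ord _]/(val _) val_insubd; case: (boolP (odd i)) => // oi.
by rewrite (leq_ltn_trans (leq_pred i)).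
Qed.

Lemma so_oppK m : involutive (@so_opp m).
Proof.
move=> i; apply: val_inj; rewrite /= !val_so_opp; case: (boolP (odd i)) => oi.
  have i0 : (0 < i)%N by case: (val i) oi.
  have -> : odd i.-1 = false by move: oi; rewrite -{1}(prednK i0) /= => /negbTE.
  by rewrite prednK // ltn_ord.
by case: ltnP => im; rewrite ?(negPf oi) /= ?oi // ltnNge im.
Qed.

Lemma odd_so_opp m (i : 'I_m) : so_opp i != i -> odd (so_opp i) = ~~ odd i.
Proof.
rewrite -val_eqE /= val_so_opp; case: (boolP (odd i)) => oi.
  have i0 : (0 < i)%N by case: (val i) oi.
  by move=> _; move: oi; rewrite -{1}(prednK i0) /= => /negbTE.
by case: ltnP => im; rewrite ?eqxx //= oi.
Qed.

Lemma so_opp_fix m (i : 'I_m) : so_opp i = i -> odd i = false /\ i.+1 = m.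
Proof.
move/(congr1 val); rewrite /= val_so_opp; case: (boolP (odd i)) => oi.
  by have i0 : (0 < i)%N; [case: (val i) oi | rewrite -{2}(prednK i0) => /n_Sn].
case: ltnP => im; first by move/esym/n_Sn.
by move=> _; split=> //; apply/eqP; rewrite eqn_leq im ltn_ord.
Qed.

Lemma half_so_opp m (i : 'I_m) : (so_opp i)./2 = i./2.
Proof.
rewrite val_so_opp; case: (boolP (odd i)) => oi.
  have i0 : (0 < i)%N by case: (val i) oi.
  have oi' : odd i.-1 = false by move: oi; rewrite -{1}(prednK i0) /= => /negbTE.
  by rewrite -{2}(prednK i0) -[in RHS]uphalfE uphalf_half oi'.
by case: ltnP => // im; rewrite -uphalfE uphalf_half (negPf oi).
Qed.

Lemma so_opp_coord (C : numClosedFieldType) m (c : 'I_m -> C) :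
  (forall i, c (so_opp i) = c i) -> exists t, forall i, c i = t i./2.
Proof.
move=> csg; exists (fun b => if insub b.*2 is Some i then c i else 0) => i.
have [i' ii'] : exists i' : 'I_m, i' = i./2.*2 :> nat /\ c i' = c i.
  case: (boolP (odd i)) => oi.
    exists (so_opp i); rewrite csg; split=> //.
    by rewrite val_so_opp oi -[in LHS](odd_double_half i) oi.
  by exists i; split=> //; rewrite -[in LHS](odd_double_half i) (negPf oi).
case: insubP => [u _ uE|]; last by rewrite -ii'.1 ltn_ord.
by rewrite -ii'.2; congr (c _); apply: val_inj; rewrite /= uE ii'.1.
Qed.

Lemma K_blocksE (C : numClosedFieldType) m (t : nat -> C) :
  K_blocks m t = pair_cartan (fun i : 'I_m => odd i) (@so_opp m) (fun i => t i./2).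
Proof.
apply/matrixP => k l; rewrite !mxE.
have lk : (l == so_opp k) && (so_opp k != k) =
    if odd k then l.+1 == k else (l == k.+1 :> nat).
  rewrite -!val_eqE /= val_so_opp; case: (boolP (odd k)) => ok.
    have k0 : (0 < k)%N by case: (val k) ok.
    rewrite -{3}(prednK k0) -(prednK k0) eqSS /=; case: eqP => //= _.
    by apply/eqP => /n_Sn.
  case: ltnP => km; last first.
    rewrite eqxx andbF; apply/esym/eqP => lk.
    by have := ltn_ord l; rewrite lk ltnNge km.
  by rewrite [k.+1 == k]gtn_eqF ?andbT.
rewrite lk; case: (boolP (odd k)) => ok /=.
  case: (boolP (odd l)) => ol /=; rewrite ?[l.+1 == k]eq_sym.
    by case: eqP => // kl; move: ok; rewrite kl /= ol.
  case: eqP => // kl; rewrite kl -uphalfE uphalf_half (negPf ol) add0n mulNr.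
  by [].
case: eqP => // lk'.
case: (boolP (odd l)) => //= ol; case: eqP => // kl.
by move: ok; rewrite kl /= ol.
Qed.

Section OrthoSymplectic.
Variables (C : numClosedFieldType) (m n : nat).
Local Notation N := (m + (n + n))%N.
Local Notation D := (osp_data C m n).
Implicit Types (X Y Z M : 'M[C]_N).

Definition osp_ta (k : 'I_N) : bool := match fintype.split k with
  | inl i => odd i | inr j => (n <= j)%N end.

Definition osp_sg (k : 'I_N) : 'I_N := match fintype.split k with
  | inl i => lshift (n + n) (so_opp i)
  | inr j => rshift m (match fintype.split j with
      | inl b => rshift n b | inr b => lshift n b end) end.

Lemma splitl p r (i : 'I_p) : fintype.split (lshift r i) = inl i.
Proof. exact: (unsplitK (inl i)). Qed.

Lemma splitr p r (i : 'I_r) : fintype.split (rshift p i) = inr i.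
Proof. exact: (unsplitK (inr i)). Qed.

Lemma osp_index (Q : 'I_N -> Prop) : (forall i, Q (lshift (n + n) i)) ->
  (forall b, Q (rshift m (lshift n b))) -> (forall b, Q (rshift m (rshift n b))) ->
  forall k, Q k.
Proof.
move=> h1 h2 h3 k; case: (split_ordP k) => [i ->|j ->]; first exact: h1.
by case: (split_ordP j) => [b ->|b ->].
Qed.

Lemma osp_sgK : involutive osp_sg.
Proof.
elim/osp_index => b; rewrite /osp_sg ?splitl ?splitr ?splitl ?splitr ?so_oppK //.
Qed.

Lemma osp_par_sg k : mxpar (osp_sg k) = mxpar k.
Proof.
elim/osp_index: k => b;
 by rewrite /osp_sg ?splitl ?splitr ?splitl ?splitr ?mxpar_lshift ?mxpar_rshift.
Qed.

Lemma osp_ta_sg k : osp_sg k != k -> osp_ta (osp_sg k) = ~~ osp_ta k.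
Proof.
elim/osp_index: k => b;
  rewrite /osp_sg /osp_ta ?splitl ?splitr ?splitl ?splitr ?splitl ?splitr //=.
- by rewrite (inj_eq (@lshift_inj _ _)) => /odd_so_opp.
- by rewrite leq_addr leqNgt ltn_ord.
- by rewrite leq_addr leqNgt ltn_ord.
Qed.

Lemma osp_par_free k : mxpar k -> osp_sg k != k.
Proof.
elim/osp_index: k => b; rewrite ?mxpar_lshift // => _;
  rewrite /osp_sg ?splitr ?splitl ?splitr -val_eqE /= eqn_add2l.
  by rewrite gtn_eqF // ltn_addr.
by rewrite ltn_eqF // ltn_addr.
Qed.

Lemma osp_sg_lshift i : osp_sg (lshift (n + n) i) = lshift (n + n) (so_opp i).
Proof. by rewrite /osp_sg splitl. Qed.

Lemma osp_fix k : osp_sg k = k ->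
  exists2 i : 'I_m, k = lshift (n + n) i & so_opp i = i.
Proof.
move=> kk; case: (split_ordP k) => i ki.
  by exists i => //; apply: (@lshift_inj _ (n + n)); rewrite -osp_sg_lshift -ki.
by have := osp_par_free (k := k); rewrite kk eqxx ki mxpar_rshift => /(_ isT).
Qed.

Lemma osp_ta_fix k : osp_sg k = k -> osp_ta k = false.
Proof. by move=> /osp_fix[i -> /so_opp_fix[]]; rewrite /osp_ta splitl. Qed.

Lemma osp_fix_uniq k l : osp_sg k = k -> osp_sg l = l -> k = l.
Proof.
move=> /osp_fix[i -> /so_opp_fix[_ im]] /osp_fix[j -> /so_opp_fix[_ jm]].
by congr lshift; apply: val_inj; apply: succn_inj; rewrite im jm.
Qed.

Local Notation J := (@pair_form C N (@mxpar m (n + n)) osp_ta osp_sg).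
Local Notation pc := (@pair_cartan C N osp_ta osp_sg).

Lemma osp_formE : J = block_mx 1%:M 0 0 (Omega C n).
Proof.
have tal (b : 'I_n) : (n <= b)%N = false by rewrite leqNgt ltn_ord.
apply/matrixP; elim/osp_index => [i|b|b]; elim/osp_index => [j|b'|b'];
  rewrite mxE /osp_sg /osp_ta ?mxpar_lshift ?mxpar_rshift /=
    ?splitl ?splitr ?splitl ?splitr
    ?eq_lshift ?eq_lrshift ?eq_rlshift ?eq_rshift ?eq_lshift ?eq_rlshift
    ?block_mxEul ?block_mxEur ?block_mxEdl ?block_mxEdr
    ?block_mxEul ?block_mxEur ?block_mxEdl ?block_mxEdr !mxE /= ?tal ?leq_addr //.
- by rewrite eq_lrshift.
- by rewrite eq_sym; case: eqP.
by rewrite eq_sym; case: eqP; rewrite ?expr1 ?oppr0.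
Qed.

Lemma Omega_trK : Omega C n *m (Omega C n)^T = 1%:M /\ (Omega C n)^T *m Omega C n = 1%:M.
Proof.
suff h : Omega C n *m (Omega C n)^T = 1%:M by split=> //; apply: mulmx1C.
rewrite /Omega tr_block_mx mulmx_block !trmx0 trmx1 linearN /= trmx1.
by rewrite !mul0mx !mulmx0 mulNmx mulmxN opprK !mulmx1 !addr0 !add0r -scalar_mx_block.
Qed.

Lemma superanti_block (a : 'M[C]_m) (b : 'M_(m, n + n)) c (d : 'M_(n + n)) :
  superanti (@mxpar m (n + n)) (block_mx a b c d) <->
  [/\ a = - a^T, c = - b^T & d = d^T].
Proof.
split=> [h|[ha hc hd] k l].
  split; apply/matrixP => i j; rewrite !mxE.
  - have := h (lshift _ i) (lshift _ j).
    by rewrite !block_mxEul mxpar_lshift mul1r.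
  - have := h (rshift _ i) (lshift _ j).
    by rewrite block_mxEdl block_mxEur mxpar_lshift andbF mul1r.
  have := h (rshift _ i) (rshift _ j).
  by rewrite !block_mxEdr !mxpar_rshift expr1 mulN1r opprK.
case: (split_ordP k) => i ->; case: (split_ordP l) => j ->;
  rewrite ?block_mxEul ?block_mxEur ?block_mxEdl ?block_mxEdr
   ?mxpar_lshift ?mxpar_rshift /= ?mul1r ?expr1 ?mulN1r ?opprK.
- by rewrite {1}ha !mxE.
- by rewrite hc !mxE opprK.
- by rewrite hc !mxE.
by rewrite {1}hd !mxE.
Qed.

Lemma osp_mxP X : osp_mx X <-> superanti (@mxpar m (n + n)) (X *m J^T).
Proof.
have [O1 O2] := Omega_trK.
rewrite osp_formE tr_block_mx !trmx0 trmx1 -{2}[X]submxK mulmx_block.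
rewrite !mulmx0 !mulmx1 !addr0 !add0r superanti_block /osp_mx !trmx_mul trmxK.
split=> [[hA hD hC]|[hA hC hD]]; split=> //.
  by rewrite {1}hD -mulmxA O1 mulmx1.
by rewrite -hD -mulmxA O2 mulmx1.
Qed.

Let JK : J *m J^T = 1%:M := pair_formK C osp_ta osp_sgK osp_par_sg.

Lemma osp_form_cancel X : X = X *m J^T *m J.
Proof.
rewrite -mulmxA; have -> : J^T *m J = 1%:M; last by rewrite mulmx1.
exact: mulmx1C JK.
Qed.

Lemma osp_mx_form M : superanti (@mxpar m (n + n)) M -> osp_mx (M *m J).
Proof.
move=> hM; apply/osp_mxP; rewrite -mulmxA.
by rewrite JK mulmx1.
Qed.

Lemma superanti_lin (c : C) M M' : superanti (@mxpar m (n + n)) M ->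
  superanti (@mxpar m (n + n)) M' -> superanti (@mxpar m (n + n)) (c *: M + M').
Proof. by move=> h h' k l; rewrite !mxE h h'; ring. Qed.

Lemma osp_partP p X : X \in hpart D p <-> block_parity p X /\ osp_mx X.
Proof.
have lin (c : C) Y Z : osp_mx Y -> osp_mx Z -> osp_mx (c *: Y + Z).
  move=> /osp_mxP hY /osp_mxP hZ; apply/osp_mxP.
  by rewrite mulmxDl -scalemxAl; apply: superanti_lin.
apply: vs_ofP => /=.
  split; first exact: block_parity0.
  by apply/osp_mxP => k l; rewrite mul0mx !mxE mulr0 oppr0.
by move=> c Y Z [Yp Yo] [Zp Zo]; split; [exact: block_parity_lin | exact: lin].
Qed.

Definition osp_coord (t : nat -> C) (d : 'rV[C]_n) (k : 'I_N) : C :=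
  match fintype.split k with
  | inl i => t i./2
  | inr j => match fintype.split j with inl b => d 0 b | inr b => d 0 b end
  end.

Lemma osp_coord_sg t d k : osp_coord t d (osp_sg k) = osp_coord t d k.
Proof.
elim/osp_index: k => b; rewrite /osp_coord /osp_sg
  ?splitl ?splitr ?splitl ?splitr ?splitl ?splitr //.
by rewrite half_so_opp.
Qed.

(** The symplectic block i Omega diag(D, D) consists of the same blocks d (0, i; -i, 0), now on the
    pairs (b, n + b). *)
Lemma osp_cartan_pair (t : nat -> C) (d : 'rV[C]_n) :
  osp_cartan_mx m t d = pc (osp_coord t d).
Proof.
have tal (b : 'I_n) : (n <= b)%N = false by rewrite leqNgt ltn_ord.
rewrite /osp_cartan_mx K_blocksE mulmx_block !mul0mx !mulmx0 mulNmx !mul1mx.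
rewrite !addr0 !add0r scale_block_mx !scaler0.
apply/matrixP; elim/osp_index => [i|b|b]; elim/osp_index => [j|b'|b'];
  rewrite [RHS]mxE /osp_coord /osp_sg /osp_ta /= ?splitl ?splitr ?splitl ?splitr
    ?eq_lshift ?eq_lrshift ?eq_rlshift ?eq_rshift ?eq_lshift ?eq_rlshift ?eq_lrshift
    ?block_mxEul ?block_mxEur ?block_mxEdl ?block_mxEdr
    ?block_mxEul ?block_mxEur ?block_mxEdl ?block_mxEdr !mxE /= ?tal ?leq_addr //.
- by rewrite eq_sym andbT; case: eqP => _; rewrite ?mulr0n ?mulr0.
by rewrite eq_sym andbT; case: eqP => _; rewrite ?mulr0n ?oppr0 ?mulr0 // mulrN mulNr.
Qed.

Lemma pair_cartan_osp (c : 'I_N -> C) : (forall k, c (osp_sg k) = c k) ->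
  exists t d, pc c = osp_cartan_mx m t d.
Proof.
move=> csg; have [t tE] : exists t, forall i, c (lshift (n + n) i) = t i./2.
  apply: (so_opp_coord (c := fun i => c (lshift (n + n) i))) => i.
  by rewrite -osp_sg_lshift csg.
exists t, (\row_b c (rshift m (lshift n b))); rewrite osp_cartan_pair.
apply/matrixP => k l; rewrite !mxE; congr (if _ then _ * _ else _).
elim/osp_index: k => [i|b|b]; rewrite /osp_coord ?splitr ?splitl ?splitr ?mxE //.
by rewrite -csg /osp_sg splitr splitr.
Qed.

Lemma osp_cartanP X : X \in cartan D <->
  exists2 c : 'I_N -> C, (forall k, c (osp_sg k) = c k) & X = pc c.
Proof.
have E Y : (exists t d, Y = osp_cartan_mx m t d) <->
   exists2 c : 'I_N -> C, (forall k, c (osp_sg k) = c k) & Y = pc c.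
  split=> [[t [d ->]]|[c csg ->]]; last exact: pair_cartan_osp.
  by exists (osp_coord t d) => [k|]; [exact: osp_coord_sg | exact: osp_cartan_pair].
rewrite -E; apply: vs_ofP => /=.
  apply/E; exists (fun=> 0) => //; apply/matrixP => i j; rewrite !mxE mulr0.
  by rewrite if_same.
move=> z Y Z /E[c csg ->] /E[c' csg' ->]; apply/E.
exists (fun x => z * c x + c' x) => [k|]; first by rewrite csg csg'.
by rewrite pair_cartan_lin.
Qed.

Local Notation par := (@mxpar m (n + n)).

Lemma block_parity_hom p X : block_parity p X <-> par_hom par p X.
Proof. exact: block_parityP. Qed.

Let J_even : par_even par J := pair_form_even C osp_ta osp_par_sg.

Lemma osp_pre p X : X \in hpart D p ->
  exists M, [/\ superanti par M, par_hom par p M & X = M *m J].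
Proof.
move=> /osp_partP[/block_parity_hom Xp /osp_mxP Xo]; exists (X *m J^T).
split=> //; last exact: osp_form_cancel.
exact: par_hom_mulr (par_even_trmx J_even) Xp.
Qed.

Lemma osp_part_form p M : superanti par M -> par_hom par p M -> M *m J \in hpart D p.
Proof.
move=> Ma Mp; apply/osp_partP; split; last exact: osp_mx_form.
apply/block_parity_hom; exact: par_hom_mulr J_even Mp.
Qed.

Lemma osp_form : invariant_form (D := D)
  (fun X Y => 2^-1 * supertrace (X *m Y)).
Proof.
apply: (@supermatrix_form C m (n + n) _ _ _ 2^-1).
- by move=> p X /osp_partP[].
- move=> p p' X Y hX hY; have [Xp _] := (osp_partP p X).1 hX.
  have [Yp _] := (osp_partP p' Y).1 hY.
  have [M [Ma Mp XE]] := osp_pre hX; have [M' [M'a M'p YE]] := osp_pre hY.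
  rewrite (supercommutatorE Xp Yp) XE YE.
  (* The last [J] factors out, so closure under the bracket is a statement about the supercommutator
     of [M] and [M'] with [J] inserted between them. *)
  have -> : M *m J *m (M' *m J) - (-1) ^+ (p && p') *: (M' *m J *m (M *m J)) =
      (M *m J *m M' - (-1) ^+ (p && p') *: (M' *m J *m M)) *m J.
    by rewrite mulmxBl -scalemxAl !mulmxA.
  have subE (A A' : 'M[C]_N) (z : C) i j : (A - z *: A') i j = A i j - z * A' i j.
    by rewrite !mxE.
  apply: osp_part_form.
    have h := superanti_form_mul osp_sgK osp_par_sg osp_ta_sg osp_par_free.
    move=> i j; rewrite !subE (h _ _ _ _ _ Ma M'a Mp M'p i j).
    rewrite (h _ _ _ _ _ M'a Ma M'p Mp i j) [p' && p]andbC.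
    set s := (-1) ^+ (p && p').
    have ss : s * s = 1 by rewrite /s -expr2 sqrr_sign.
    set x := (_ *m M') j i; set y := (_ *m M) j i; set z := (-1) ^+ _.
    rewrite -[x in RHS](mul1r x) -ss.
    by ring.
  have hom_mul b b' A A' : par_hom par b A -> par_hom par b' A' ->
      par_hom par (b (+) b') (A *m J *m A').
    move=> /(par_hom_mulr J_even)/block_parity_hom hA /block_parity_hom hA'.
    exact/block_parity_hom/(block_parity_mul hA hA').
  move=> i j ij; rewrite subE (hom_mul _ _ _ _ Mp M'p i j ij).
  by rewrite (hom_mul _ _ _ _ M'p Mp i j) ?mulr0 ?subr0 // [p' (+) p]addbC.
- apply/subvP => X /osp_cartanP[c csg ->]; apply/osp_partP; split.
    by apply/block_parity_hom; apply: pair_cartan_even osp_par_sg c.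
  by apply/osp_mxP; apply: (superanti_pair_cartan osp_sgK osp_par_sg osp_ta_sg).
- move=> X Y /osp_cartanP[c csg ->] /osp_cartanP[c' csg' ->].
  exact: (pair_cartan_comm osp_sgK osp_ta_sg osp_ta_fix).
- by [].
- move=> p X hX XY; have [M [Ma Mp XE]] := osp_pre hX.
  suff M0 : M = 0 by rewrite XE M0 mul0mx.
  apply: (pair_form_nondeg osp_sgK osp_par_sg osp_ta_sg osp_par_free Ma) => k l.
  rewrite -XE -supertraceE.
  set E := delta_mx k l - _; have Ea : superanti par E by exact: superanti_delta.
  have Ep : par_hom par (par k (+) par l) E by exact: par_hom_delta.
  have hE := osp_part_form Ea Ep.
  (* The hypothesis covers test elements of parity [p]; against the other parity the supertrace
     vanishes because the product is odd. *)
  have [klp|klp] := eqVneq (par k (+) par l) p; first by apply: XY; rewrite -klp.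
  have [Xp _] := (osp_partP p X).1 hX; have [EJp _] := (osp_partP _ _).1 hE.
  rewrite supertraceE big1 // => i _.
  have /block_parityP h := block_parity_mul Xp EJp.
  by rewrite h ?mulr0 // addbb; move: klp; case: (par k (+) par l); case: (p).
- by rewrite invr_eq0 pnatr_eq0.
Qed.

Theorem osp_root_datum : exists (I : finType) (a : I -> weight D) e q F,
  root_datum a e q F.
Proof.
pose U : 'M[C]_N := weight_basis C osp_ta osp_sg.
pose W : 'M[C]_N := weight_cobasis C osp_ta osp_sg.
pose w := @pair_weight C N osp_ta osp_sg.
pose e (x : 'I_N * 'I_N) : D := pair_rootv C par osp_ta osp_sg x.1 x.2.
(* A form linear in every matrix [H]; on the Cartan subalgebra W H U is diagonal and its entries are
   the weights. *)
pose a (x : 'I_N * 'I_N) : weight D := @wt_of _ D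
  (fun H : 'M[C]_N => (W *m H *m U) x.1 x.1 + (W *m H *m U) x.2 x.2).
pose q (x : 'I_N * 'I_N) := par x.1 (+) par x.2.
have aE x (H : subvs_of (cartan D)) c : (forall k, c (osp_sg k) = c k) ->
    vsval H = pc c -> a x H = w c x.1 + w c x.2.
  move=> csg Hc; rewrite /a wt_ofE => [|z X Y]; last first.
    by rewrite !mulmxDr !mulmxDl -!scalemxAr -!scalemxAl !mxE; ring.
  rewrite Hc -mulmxA (pair_cartan_diag osp_sgK osp_ta_sg csg) mulmxA.
  rewrite (weight_basisK C osp_sgK osp_ta_sg osp_ta_fix) mul1mx.
  by rewrite !mxE !eqxx !mulr1n.
have aP c : (forall k, c (osp_sg k) = c k) ->
    exists H : subvs_of (cartan D), forall x, a x H = w c x.1 + w c x.2.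
  move=> csg; have hc : pc c \in cartan D by apply/osp_cartanP; exists c.
  by exists (vsproj (cartan D) (pc c)) => x; apply: aE; rewrite // vsprojK.
have inD x : e x \in hpart D (q x).
  rewrite /e; have [M Ma ME] := pair_rootv_super C osp_ta osp_par_sg x.1 x.2.
  rewrite ME; apply/osp_partP; split; last exact: osp_mx_form.
  by rewrite -ME; apply/block_parity_hom/(pair_rootv_par C osp_ta osp_par_sg).
suff [I [a' [e' [q' R]]]] : exists (I : finType) (a' : I -> weight D) e' q',
    root_datum a' e' q' (fun X Y : 'M[C]_N => 2^-1 * supertrace (X *m Y)).
  by exists I, a', e', q', (fun X Y : 'M[C]_N => 2^-1 * supertrace (X *m Y)).
apply: (root_datum_of_family (a := a) (e := e) (q := q) osp_form) => //.
- move=> x H; have /osp_cartanP[c csg Hc] := subvsP H.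
  rewrite (aE x H c csg Hc) Hc /=.
  have Hp : block_parity false (pc c).
    by apply/block_parity_hom; apply: pair_cartan_even osp_par_sg c.
  have ep : block_parity (q x) (e x : 'M[C]_N) by have /osp_partP[] := inD x.
  rewrite (supercommutatorE Hp ep) scale1r.
  exact: (pair_rootv_weight osp_sgK osp_par_sg osp_ta_sg osp_par_free).
- move=> x _ ax0.
  have x2 : x.2 = osp_sg x.1.
    apply: (pair_weight0 (C := C) osp_sgK osp_ta_sg osp_fix_uniq) => c csg.
    by have [H HE] := aP c csg; rewrite -/(w c _) -HE ax0 zero_lfunE.
  split; first by rewrite /q x2 osp_par_sg addbb.
  apply/osp_cartanP; rewrite /e x2.
  exact: (pair_rootv_cartan C osp_sgK osp_par_sg osp_ta_sg osp_par_free).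
- move=> x y _ _ ax0 axy.
  have [||yx|yx] := pair_weight_inj (C := C) osp_sgK osp_ta_sg osp_fix_uniq
     (x := x.1) (y := x.2) (z := y.1) (t := y.2).
  + move=> c csg; have [H HE] := aP c csg.
    by rewrite -!/(w c _) -!HE axy.
  + have [H aH] : exists H, a x H != 0.
      apply: contrapT => /forallNP h; move/eqP: ax0; apply.
      by apply/lfunP => H; rewrite zero_lfunE; apply/eqP/negPn/negP/h.
    have /osp_cartanP[c csg Hc] := subvsP H.
    by exists c => //; rewrite -!/(w c _) -(aE x H c csg Hc).
  + have -> : y = x by rewrite [y]surjective_pairing yx -surjective_pairing.
    by split=> //; exists 1; rewrite scale1r.
  case: yx => y1 y2; rewrite /q /e y1 y2; split; first exact: addbC.
  exists (- (-1) ^+ (par x.1 && par x.2)); exact: pair_rootv_sym.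
move=> p X hX; have [M [Ma Mp XE]] := osp_pre hX.
(* The Cartan part is 0 because the family contains the pairs of opposite indices, whose vectors are
   Cartan elements. *)
exists 0, (fun x => 2^-1 * (W *m M *m W^T) x.1 x.2); split=> //; first exact: mem0v.
rewrite add0r XE (pair_rootv_span osp_sgK osp_par_sg osp_ta_sg osp_ta_fix Ma).
rewrite [RHS]big_mkcond; apply: eq_bigr => x _; case: eqP => // /eqP qx.
have We := weight_cobasis_even C osp_ta osp_par_sg.
have h : par_hom par p (W *m M *m W^T).
  apply: par_hom_mulr (par_even_trmx We) _; exact: par_hom_mull We Mp.
by rewrite h // mulr0 scale0r.
Qed.

End OrthoSymplectic.

(** * The spin representation of so(7) *)

Section Clifford.
Variable C : numClosedFieldType.
Local Notation sx := (sigma_x C).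
Local Notation sy := (sigma_y C).
Local Notation sz := (sigma_z C).
Local Notation g := (gamma C).
Local Notation S := (spin_form C).

Lemma mx2_mul (a b c d a' b' c' d' : C) : mx2 a b c d *m mx2 a' b' c' d' =
  mx2 (a * a' + b * c') (a * b' + b * d') (c * a' + d * c') (c * b' + d * d').
Proof.
have := mulmx_block (a%:M : 'M_1) (b%:M : 'M_1) (c%:M : 'M_1) (d%:M : 'M_1)
  (a'%:M : 'M_1) (b'%:M : 'M_1) (c'%:M : 'M_1) (d'%:M : 'M_1).
by rewrite -!scalar_mxM -!raddfD.
Qed.

Lemma mx2_id : mx2 1 0 0 1 = 1%:M :> 'M[C]_2.
Proof. by rewrite /mx2 !raddf0; exact: esym (@scalar_mx_block C 1 1 1). Qed.

Lemma mx2_scale k (a b c d : C) : k *: mx2 a b c d = mx2 (k * a) (k * b) (k * c) (k * d).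
Proof. by rewrite /mx2 (@scale_block_mx _ 1 1 1 1) !scale_scalar_mx. Qed.

Lemma mx2_opp (a b c d : C) : - mx2 a b c d = mx2 (- a) (- b) (- c) (- d).
Proof. by rewrite -scaleN1r mx2_scale !mulN1r. Qed.

Lemma mx2_tr (a b c d : C) : (mx2 a b c d)^T = mx2 a c b d.
Proof. by rewrite /mx2 (@tr_block_mx _ 1 1 1 1) !tr_scalar_mx. Qed.

Lemma mx2E (a b c d : C) (i j : 'I_2) : mx2 a b c d i j =
  if i == 0 then (if j == 0 then a else b) else (if j == 0 then c else d).
Proof.
case: i => [[|[|//]] ?]; case: j => [[|[|//]] ?]; rewrite /= !mxE.
all: case: splitP => i' /= hi; rewrite ?mxE; case: splitP => j' /= hj; rewrite ?mxE.
all: try by move: (ltn_ord i'); rewrite -hi.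
all: try by move: (ltn_ord j'); rewrite -hj.
all: try by rewrite (ord1 i') (ord1 j') mulr1n.
all: by move: hi hj; rewrite ?add1n.
Qed.

Lemma sigma_yx : sy *m sx = - (sx *m sy).
Proof. by rewrite !mx2_mul mx2_opp; congr mx2; ring. Qed.
Lemma sigma_zx : sz *m sx = - (sx *m sz).
Proof. by rewrite !mx2_mul mx2_opp; congr mx2; ring. Qed.
Lemma sigma_zy : sz *m sy = - (sy *m sz).
Proof. by rewrite !mx2_mul mx2_opp; congr mx2; ring. Qed.
Lemma sigma_xy : sx *m sy = 'i *: sz.
Proof. by rewrite mx2_mul mx2_scale; congr mx2; ring. Qed.

Lemma sigma_sqr : [/\ sx *m sx = 1%:M, sy *m sy = 1%:M & sz *m sz = 1%:M].
Proof.
have ii : 'i * 'i = -1 :> C by rewrite -expr2 sqrCi.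
by split; rewrite mx2_mul -mx2_id; congr mx2; rewrite ?mulNr ?mulrN ?ii; ring.
Qed.

Lemma sigma_tr : [/\ sx^T = sx, sy^T = - sy & sz^T = sz].
Proof. by rewrite /sigma_y !mx2_tr mx2_opp oppr0 opprK. Qed.

Definition tens3 (A B E : 'M[C]_2) : 'M[C]_8 := A *t B *t E.

Lemma tens3_mul A B E A' B' E' :
  tens3 A B E *m tens3 A' B' E' = tens3 (A *m A') (B *m B') (E *m E').
Proof. by rewrite /tens3 -!tensmx_mul. Qed.

Lemma tens3_scale k A B E : [/\ tens3 (k *: A) B E = k *: tens3 A B E,
  tens3 A (k *: B) E = k *: tens3 A B E & tens3 A B (k *: E) = k *: tens3 A B E].
Proof. by split; apply/matrixP => i j; rewrite !mxE; ring. Qed.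

Lemma tens3N A B E : [/\ tens3 (- A) B E = - tens3 A B E,
  tens3 A (- B) E = - tens3 A B E & tens3 A B (- E) = - tens3 A B E].
Proof. by rewrite -!scaleN1r; split; apply/matrixP => i j; rewrite !mxE; ring. Qed.

Lemma tensmx11 m n : (1%:M : 'M[C]_m) *t (1%:M : 'M[C]_n) = 1%:M.
Proof.
apply/matrixP => k l; rewrite -[k]mxtens_unindexK -[l]mxtens_unindexK.
case: (mxtens_unindex k) (mxtens_unindex l) => [i j] [i' j'].
rewrite tensmxE !mxE (inj_eq (can_inj (@mxtens_indexK _ _))) xpair_eqE.
by case: (i == i'); case: (j == j'); rewrite ?mulr1 ?mulr0.
Qed.

Lemma tens3_id : tens3 1%:M 1%:M 1%:M = 1%:M.
Proof. by rewrite /tens3 !tensmx11. Qed.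

Lemma tens3_tr A B E : (tens3 A B E)^T = tens3 A^T B^T E^T.
Proof. by have := trmx_tens (A *t B) E; rewrite (trmx_tens A B). Qed.

Lemma gammaE (i : 'I_7) : g i = nth 0
  [:: tens3 sx 1%:M 1%:M; tens3 sy 1%:M 1%:M; tens3 sz sx 1%:M; tens3 sz sy 1%:M;
      tens3 sz sz sx; tens3 sz sz sy; tens3 sz sz sz] i.
Proof. by []. Qed.

Lemma gamma_anticomm i j : i != j -> g i *m g j = - (g j *m g i).
Proof.
have [xx yy zz] := sigma_sqr.
rewrite !gammaE; case: i j => [[|[|[|[|[|[|[|//]]]]]]] ?] [[|[|[|[|[|[|[|//]]]]]]] ?] //= _.
all: rewrite !tens3_mul ?mul1mx ?mulmx1 ?xx ?yy ?zz ?sigma_yx ?sigma_zx ?sigma_zy.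
all: have N1 A B E : tens3 (- A) B E = - tens3 A B E by case: (tens3N A B E).
all: have N2 A B E : tens3 A (- B) E = - tens3 A B E by case: (tens3N A B E).
all: have N3 A B E : tens3 A B (- E) = - tens3 A B E by case: (tens3N A B E).
all: by rewrite ?N1 ?N2 ?N3 ?opprK.
Qed.

Lemma gamma_sqr i : g i *m g i = 1%:M.
Proof.
have [xx yy zz] := sigma_sqr.
rewrite !gammaE; case: i => [[|[|[|[|[|[|[|//]]]]]]] ?] /=;
  by rewrite tens3_mul ?mulmx1 ?xx ?yy ?zz tens3_id.
Qed.

Lemma gamma_tr i : (g i)^T = (-1) ^+ odd i *: g i.
Proof.
have [xt yt zt] := sigma_tr.
have N1 A B E : tens3 (- A) B E = - tens3 A B E by case: (tens3N A B E).
have N2 A B E : tens3 A (- B) E = - tens3 A B E by case: (tens3N A B E).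
have N3 A B E : tens3 A B (- E) = - tens3 A B E by case: (tens3N A B E).
rewrite !gammaE; case: i => [[|[|[|[|[|[|[|//]]]]]]] ?] /=;
  by rewrite tens3_tr ?trmx1 ?xt ?yt ?zt ?scale1r ?scaleN1r ?N1 ?N2 ?N3.
Qed.

Local Notation ga := (g (inord 1)).
Local Notation gb := (g (inord 3)).
Local Notation gc := (g (inord 5)).

Let nab : inord 1 != inord 3 :> 'I_7. Proof. by rewrite -val_eqE /= !inordK. Qed.
Let nac : inord 1 != inord 5 :> 'I_7. Proof. by rewrite -val_eqE /= !inordK. Qed.
Let nbc : inord 3 != inord 5 :> 'I_7. Proof. by rewrite -val_eqE /= !inordK. Qed.

Lemma spin_form_inv : S *m (gc *m gb *m ga) = 1%:M.
Proof.
rewrite /spin_form !mulmxA -[ga *m gb *m gc *m gc]mulmxA gamma_sqr mulmx1.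
by rewrite -[ga *m gb *m gb]mulmxA gamma_sqr mulmx1 gamma_sqr.
Qed.

Lemma spin_form_tr : S^T = S.
Proof.
have E : ga *m gb *m gc = - (gc *m gb *m ga).
  rewrite (gamma_anticomm nab) mulNmx -[gb *m ga *m gc]mulmxA (gamma_anticomm nac).
  rewrite mulmxN opprK.
  by rewrite mulmxA (gamma_anticomm nbc) mulNmx.
rewrite /spin_form [RHS]E !trmx_mul !gamma_tr !inordK //= !expr1 !scaleN1r.
by rewrite !mulmxN !mulNmx opprK mulmxN mulmxA.
Qed.

(** The factors of S are the gamma matrices of odd index, precisely the skew ones. An even gamma
    anticommutes with all three; an odd one is itself a factor and anticommutes with the other two,
    so it commutes with S. *)
Lemma spin_form_gamma i : S *m g i = (- (-1) ^+ odd i) *: (g i *m S).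
Proof.
have h k : k != i -> g k *m g i = - (g i *m g k) by apply: gamma_anticomm.
have [ia|ia] := eqVneq (inord 1) i.
  rewrite -ia inordK // expr1 opprK scale1r /spin_form !mulmxA.
  rewrite -mulmxA -[gc *m ga]opprK -(gamma_anticomm nac) mulmxN mulmxA.
  rewrite -[ga *m gb *m ga]mulmxA -[gb *m ga]opprK -(gamma_anticomm nab) mulmxN.
  by rewrite mulNmx opprK mulmxA.
have [ib|ib] := eqVneq (inord 3) i.
  rewrite -ib inordK // expr1 opprK scale1r /spin_form !mulmxA.
  rewrite -mulmxA -[gc *m gb]opprK -(gamma_anticomm nbc) mulmxN mulmxA.
  by rewrite -[gb *m ga]opprK -(gamma_anticomm nab) !mulNmx.
have [ic|ic] := eqVneq (inord 5) i.
  rewrite -ic inordK // expr1 opprK scale1r /spin_form !mulmxA.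
  rewrite -[gc *m ga]opprK -(gamma_anticomm nac) !mulNmx -[ga *m gc *m gb]mulmxA.
  by rewrite -[gc *m gb]opprK -(gamma_anticomm nbc) mulmxN mulNmx opprK mulmxA.
have oi : odd i = false.
  move: ia ib ic; rewrite -!val_eqE /= !inordK //.
  by case: i {h} => [[|[|[|[|[|[|[|//]]]]]]] ?].
rewrite oi expr0 scaleN1r /spin_form -[ga *m gb *m gc *m g i]mulmxA h //.
rewrite mulmxN [ga *m gb *m (_ *m gc)]mulmxA -[ga *m gb *m g i]mulmxA h //.
rewrite mulmxN mulNmx opprK [ga *m (_ *m gb)]mulmxA h // !mulNmx.
by rewrite !mulmxA.
Qed.

Lemma gamma_spin_form i : (g i)^T *m S = - (S *m g i).
Proof.
by rewrite gamma_tr spin_form_gamma scaleNr opprK scalemxAl.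
Qed.

Lemma spin_linear : linear (@spin C).
Proof.
move=> c A B; rewrite /spin scalerA [c * _]mulrC -scalerA -scalerDr.
congr (_ *: _); rewrite scaler_sumr -big_split; apply: eq_bigr => i _ /=.
rewrite scaler_sumr -big_split; apply: eq_bigr => j _ /=.
by rewrite !mxE scalerDl scalerA.
Qed.

(** Passing both gammas through S costs two signs, which cancel, and transposition reverses their
    order; antisymmetry of [A] supplies the remaining sign. *)
Lemma spin_form_anti A : A = - A^T -> (spin A)^T *m S = - (S *m spin A).
Proof.
move=> hA; rewrite /spin linearZ /= -scalemxAl -scalemxAr -scalerN; congr (_ *: _).
rewrite [X in X *m _]linear_sum /= mulmx_suml mulmx_sumr -sumrN.
have step i j : (A i j *: (g i *m g j))^T *m S = - (S *m (A j i *: (g j *m g i))).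
  rewrite linearZ /= trmx_mul -scalemxAl -mulmxA gamma_spin_form mulmxN mulmxA.
  rewrite gamma_spin_form mulNmx opprK -mulmxA -scalemxAr {1}hA !mxE scaleNr.
  by [].
under eq_bigr => i _.
  rewrite linear_sum mulmx_suml /=.
  under eq_bigr => j _ do rewrite step.
  over.
rewrite exchange_big /=; apply: eq_bigr => i _.
by rewrite mulmx_sumr -sumrN.
Qed.

(** Each block pairs two consecutive gammas, whose product is i [sigma_z] in one tensor slot because
    sigma_x sigma_y = i sigma_z. The spin representation is thus diagonal on the Cartan
    subalgebra. *)
Lemma spin_K_blocks t : spin (K_blocks 7 t) = (- 2^-1) *:
  (t 0%N *: tens3 sz 1%:M 1%:M + t 1%N *: tens3 1%:M sz 1%:M +
   t 2%N *: tens3 1%:M 1%:M sz).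
Proof.
have [xx yy zz] := sigma_sqr; have ii : 'i * 'i = -1 :> C by rewrite -expr2 sqrCi.
have N1 A B E : tens3 (- A) B E = - tens3 A B E by case: (tens3N A B E).
have N2 A B E : tens3 A (- B) E = - tens3 A B E by case: (tens3N A B E).
have N3 A B E : tens3 A B (- E) = - tens3 A B E by case: (tens3N A B E).
have S1 k A B E : tens3 (k *: A) B E = k *: tens3 A B E by case: (tens3_scale k A B E).
have S2 k A B E : tens3 A (k *: B) E = k *: tens3 A B E by case: (tens3_scale k A B E).
have S3 k A B E : tens3 A B (k *: E) = k *: tens3 A B E by case: (tens3_scale k A B E).
have sumE i : \sum_(j < 7) K_blocks 7 t i j *: (g i *m g j) =
    (if so_opp i != i then (if odd i then - 'i else 'i) * t i./2 else 0) *: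
      (g i *m g (so_opp i)).
  rewrite (bigD1 (so_opp i)) //= big1 ?addr0 => [|j /negPf ji].
    by rewrite K_blocksE mxE eqxx.
  by rewrite K_blocksE mxE ji scale0r.
rewrite /spin (eq_bigr _ (fun i _ => sumE i)) {sumE}.
rewrite !big_ord_recl big_ord0 !gammaE -!val_eqE /= !val_so_opp /=.
rewrite !tens3_mul !mulmx1 ?mul1mx ?zz !sigma_yx !sigma_xy.
rewrite ?N1 ?N2 ?N3 ?S1 ?S2 ?S3 scale0r !addr0.
rewrite !mulNr !scaleNr !scalerN !opprK !scalerA ![_ * t _ * 'i]mulrAC ii !mulN1r.
rewrite !scaleNr -!opprD !scalerN; congr (- _); rewrite !addrA -!scalerDr.
have n2 : 2 != 0 :> C by rewrite pnatr_eq0.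
have n4 : 4 != 0 :> C by rewrite pnatr_eq0.
set X := tens3 sz _ _; set Y := tens3 _ sz _; set Z := tens3 _ _ sz.
move: X Y Z => X Y Z; apply/matrixP => i j; rewrite !mxE.
by field.
Qed.

End Clifford.

(** * The exceptional case F(4) *)

Section F4.
Variable C : numClosedFieldType.
Local Notation g := (gamma C).
Local Notation S := (spin_form C).
Local Notation w := (Omega C 1).
Local Notation D := (F4_data C).
Implicit Types (A B : 'M[C]_7) (a b : 'M[C]_2) (Q P : 'M[C]_(8, 2)).

Definition F4_ev A a : F4_space C := (A, a, 0).
Definition F4_od Q : F4_space C := (0, 0, Q).

Definition F4_beta Q P : C := \tr (Q^T *m S *m P *m w).

(** The even constants are those of the normalised Killing form on the Cartan subalgebra; -4 is then
    forced by invariance, through [F4_form_ooe]. *)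
Definition F4_form (X Y : F4_space C) : C :=
  2^-1 * \tr (X.1.1 *m Y.1.1) - 2 / 3 * \tr (X.1.2 *m Y.1.2) - 4 * F4_beta X.2 Y.2.

Lemma Omega1_tr : w^T = - w.
Proof.
rewrite /Omega tr_block_mx !trmx0 trmx1 linearN /= trmx1.
by rewrite opp_block_mx !oppr0 opprK.
Qed.

Lemma Omega1E : w = mx2 0 1 (-1) 0.
Proof. by rewrite /Omega /mx2 !raddf0 raddfN. Qed.

Lemma mx2_eta a : a = mx2 (a 0 0) (a 0 1) (a 1 0) (a 1 1).
Proof.
apply/matrixP => i j; rewrite mx2E; case: i => [[|[|//]] ?]; case: j => [[|[|//]] ?] /=;
  congr (a _ _); exact: val_inj.
Qed.

Lemma mxtrace2 a : \tr a = a 0 0 + a 1 1.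
Proof. by rewrite /mxtrace !big_ord_recl big_ord0 addr0; congr (_ + a _ _); apply: val_inj. Qed.

Lemma Omega1_sl2 a : \tr a = 0 -> w *m a = - (a^T *m w).
Proof.
rewrite mxtrace2 => /eqP; rewrite addr_eq0 => /eqP h.
rewrite Omega1E [a]mx2_eta mx2_tr (mx2_mul 0 1 (-1) 0) mx2_mul mx2_opp h.
by congr mx2; ring.
Qed.

Lemma F4_beta_sym Q P : F4_beta P Q = - F4_beta Q P.
Proof.
rewrite /F4_beta -mxtrace_tr 3!trmx_mul trmxK spin_form_tr Omega1_tr mulNmx.
by rewrite raddfN /= mxtrace_mulC !mulmxA.
Qed.

Lemma F4_betaDr Q P P' : F4_beta Q (P + P') = F4_beta Q P + F4_beta Q P'.
Proof. by rewrite /F4_beta mulmxDr mulmxDl raddfD. Qed.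

Lemma F4_betaZr c Q P : F4_beta Q (c *: P) = c * F4_beta Q P.
Proof. by rewrite /F4_beta -scalemxAr -scalemxAl linearZ. Qed.

Lemma F4_betaNr Q P : F4_beta Q (- P) = - F4_beta Q P.
Proof. by rewrite -scaleN1r F4_betaZr mulN1r. Qed.

Lemma F4_betaDl Q Q' P : F4_beta (Q + Q') P = F4_beta Q P + F4_beta Q' P.
Proof. by rewrite !(F4_beta_sym P) F4_betaDr opprD. Qed.

Lemma F4_betaZl c Q P : F4_beta (c *: Q) P = c * F4_beta Q P.
Proof. by rewrite !(F4_beta_sym P) F4_betaZr mulrN. Qed.

Lemma F4_betaNl Q P : F4_beta (- Q) P = - F4_beta Q P.
Proof. by rewrite -scaleN1r F4_betaZl mulN1r. Qed.

Lemma F4_beta_act A a Q P : A = - A^T -> \tr a = 0 ->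
  F4_beta (F4_act A a Q) P = - F4_beta Q (F4_act A a P).
Proof.
move=> hA ha; rewrite /F4_act F4_betaDl F4_betaDr opprD; congr (_ + _).
  rewrite /F4_beta trmx_mul -[_ *m S]mulmxA spin_form_anti //.
  by rewrite mulmxN !mulNmx raddfN /= !mulmxA.
rewrite /F4_beta trmx_mul trmxK -!mulmxA mxtrace_mulC -!mulmxA Omega1_sl2 //.
by rewrite !mulmxN raddfN.
Qed.

Lemma F4_odd_so7E Q P i j : F4_odd_so7 Q P i j =
  if i == j then 0 else - (2 * F4_beta Q (g i *m g j *m P)).
Proof.
rewrite !mxE; case: eqP => _; first by rewrite mulr0.
by rewrite Omega1_tr mulmxN raddfN /= mulrN /F4_beta !mulmxA.
Qed.

Lemma antisym_diag A i : A = - A^T -> A i i = 0.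
Proof.
move/matrixP/(_ i i); rewrite !mxE => /eqP; rewrite eq_sym -subr_eq0 -opprD.
by rewrite oppr_eq0 -mulr2n mulrn_eq0 /= => /eqP.
Qed.

(** The so(7) part of the odd bracket is the moment map of the spin action. The factor 8 is the 2 of
    [F4_odd_so7] divided by the 1/4 of [spin]. *)
Lemma F4_odd_so7_tr A Q P : A = - A^T ->
  \tr (F4_odd_so7 Q P *m A) = 8 * F4_beta Q (spin A *m P).
Proof.
move=> hA; rewrite [in RHS]/spin -[in RHS]scalemxAl F4_betaZr mulrA.
have -> : 8 * 4^-1 = 2 :> C by rewrite (natrM _ 2 4) mulfK // pnatr_eq0.
rewrite mulmx_suml (big_morph _ (F4_betaDr Q) (id1 := 0)); last first.
  by rewrite -(scale0r P) F4_betaZr mul0r.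
rewrite mulr_sumr; apply: eq_bigr => i _; rewrite mxE.
rewrite mulmx_suml (big_morph _ (F4_betaDr Q) (id1 := 0)); last first.
  by rewrite -(scale0r P) F4_betaZr mul0r.
rewrite mulr_sumr; apply: eq_bigr => j _.
rewrite -scalemxAl F4_betaZr F4_odd_so7E; case: eqP => [->|_].
  by rewrite (antisym_diag _ hA) !mul0r mulr0.
by rewrite [A i j](congr1 (fun M : 'M_7 => M i j) hA) !mxE; ring.
Qed.

Lemma F4_odd_sl2_tr a Q P : \tr a = 0 ->
  \tr (F4_odd_sl2 Q P *m a) = - 6 * F4_beta Q (P *m a^T).
Proof.
move=> ha; rewrite /F4_odd_sl2 -scalemxAl linearZ /= mulmxDl mulmxDl raddfD /=.
have -> : \tr (P^T *m S *m Q *m w *m a) = - F4_beta Q (P *m a^T).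
  rewrite -mxtrace_tr 4!trmx_mul trmxK spin_form_tr Omega1_tr mulNmx mulmxN raddfN.
  by rewrite /= /F4_beta mulmxA mxtrace_mulC !mulmxA.
have -> : \tr (Q^T *m S *m P *m w *m a) = - F4_beta Q (P *m a^T).
  by rewrite -mulmxA Omega1_sl2 // mulmxN raddfN /= /F4_beta !mulmxA.
by ring.
Qed.

Lemma F4_odd_so7C Q P : F4_odd_so7 P Q = F4_odd_so7 Q P.
Proof.
apply/matrixP => i j; rewrite !F4_odd_so7E; case: eqVneq => // ij; congr (- (2 * _)).
have -> : F4_beta P (g i *m g j *m Q) = F4_beta (g j *m g i *m P) Q.
  have h (T X Y : 'M[C]_8) : X^T *m T = - (T *m X) -> Y^T *m T = - (T *m Y) ->
      \tr (P^T *m T *m (X *m Y *m Q) *m w) = \tr ((Y *m X *m P)^T *m T *m Q *m w).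
    move=> hX hY; rewrite trmx_mul trmx_mul -[in RHS](mulmxA P^T) -(mulmxA X^T).
    by rewrite hY mulmxN [X^T *m _]mulmxA hX mulNmx opprK !mulmxA.
  by apply: h; exact: gamma_spin_form.
rewrite F4_beta_sym -F4_betaNr; congr (F4_beta _ _).
by rewrite (gamma_anticomm C ij) mulNmx.
Qed.

Lemma F4_odd_so7_anti Q P : F4_odd_so7 Q P = - (F4_odd_so7 Q P)^T.
Proof.
apply/matrixP => i j; rewrite [RHS]mxE [X in - X]mxE !F4_odd_so7E [j == i]eq_sym.
case: eqVneq => [_|ij]; first by rewrite oppr0.
by rewrite opprK (gamma_anticomm C ij) mulNmx F4_betaNr mulrN opprK.
Qed.

Lemma F4_odd_sl2_tr0 Q P : \tr (F4_odd_sl2 Q P) = 0.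
Proof.
rewrite /F4_odd_sl2 linearZ /= mulmxDl raddfD /= -!/(F4_beta _ _) F4_beta_sym.
by rewrite addNr mulr0.
Qed.

Lemma F4_odd_sl2C Q P : F4_odd_sl2 P Q = F4_odd_sl2 Q P.
Proof. by rewrite /F4_odd_sl2 addrC. Qed.

Lemma F4_act_linear Q : linear (fun x : 'M[C]_7 * 'M[C]_2 => F4_act x.1 x.2 Q).
Proof.
move=> c x y; rewrite /F4_act /= spin_linear mulmxDl -scalemxAl.
by rewrite linearP mulmxDr -scalemxAr scalerDr addrACA.
Qed.

Lemma F4_act_linearr A a : linear (F4_act A a).
Proof.
move=> c Q P; rewrite /F4_act mulmxDr mulmxDl -scalemxAr -scalemxAl scalerDr.
by rewrite addrACA.
Qed.

Lemma F4_odd_so7_linear Q : linear (F4_odd_so7 Q).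
Proof.
move=> c P P'; apply/matrixP => i j; 
have -> : (c *: F4_odd_so7 Q P + F4_odd_so7 Q P') i j =
    c * F4_odd_so7 Q P i j + F4_odd_so7 Q P' i j by rewrite mxE [X in X + _]mxE.
rewrite !F4_odd_so7E; case: eqP => _; first by rewrite mulr0 addr0.
by rewrite mulmxDr -scalemxAr F4_betaDr F4_betaZr; ring.
Qed.

Lemma F4_odd_sl2_linear Q : linear (F4_odd_sl2 Q).
Proof.
move=> c P P'; rewrite /F4_odd_sl2.
have -> : (c *: P + P')^T = c *: P^T + P'^T by apply/matrixP => i j; rewrite !mxE.
rewrite mulmxDr [(_ + P'^T) *m S]mulmxDl [(_ + _) *m Q]mulmxDl -scalemxAr -2!scalemxAl addrACA -scalerDr.
by rewrite [(_ + (Q^T *m S *m P' + _)) *m w]mulmxDl -scalemxAl scalerDr !scalerA [c * 3]mulrC.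
Qed.

Lemma commutator_linr n (X : 'M[C]_n) : linear (commutator X).
Proof.
move=> c Y Z; rewrite /commutator mulmxDr mulmxDl -scalemxAr -scalemxAl scalerBr.
by rewrite opprD addrACA.
Qed.

Lemma commutator_linl n (X : 'M[C]_n) : linear (fun Y => commutator Y X).
Proof.
move=> c Y Z; rewrite /commutator mulmxDr mulmxDl -scalemxAr -scalemxAl scalerBr.
by rewrite opprD addrACA.
Qed.

Lemma F4_brk_linr X : linear (@F4_brk C X).
Proof.
case: X => [[A a] Q] c [[B b] P] [[B' b'] P'] /=.
rewrite F4_odd_so7_linear F4_odd_sl2_linear F4_act_linearr.
have -> := @F4_act_linear Q c (B, b) (B', b').
congr (_, _, _) => /=.
- by rewrite commutator_linr addrACA -scalerDr.
- by rewrite commutator_linr addrACA -scalerDr.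
by rewrite scalerBr opprD addrACA.
Qed.

Lemma F4_brk_linl Y : linear (fun X => @F4_brk C X Y).
Proof.
case: Y => [[B b] P] c [[A a] Q] [[A' a'] Q'] /=.
rewrite !(F4_odd_so7C P) !(F4_odd_sl2C P) F4_odd_so7_linear F4_odd_sl2_linear.
rewrite F4_act_linearr; have -> := @F4_act_linear P c (A, a) (A', a').
congr (_, _, _) => /=.
- by rewrite commutator_linl addrACA -scalerDr.
- by rewrite commutator_linl addrACA -scalerDr.
by rewrite scalerBr opprD addrACA.
Qed.

Lemma F4_brk_ee A a B b :
  F4_brk (F4_ev A a) (F4_ev B b) = F4_ev (commutator A B) (commutator a b).
Proof.
rewrite /F4_brk /=.
by rewrite (lin0 (F4_odd_so7_linear _)) (lin0 (F4_odd_sl2_linear _))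
  !(lin0 (F4_act_linearr _ _)) subrr !addr0.
Qed.

Lemma F4_act0 Q : F4_act 0 0 Q = 0.
Proof. exact: (lin0 (F4_act_linear Q)). Qed.

Lemma commutator0 n (X : 'M[C]_n) : commutator X 0 = 0 /\ commutator 0 X = 0.
Proof. by rewrite /commutator !mulmx0 !mul0mx subrr. Qed.

Lemma F4_brk_eo A a P : F4_brk (F4_ev A a) (F4_od P) = F4_od (F4_act A a P).
Proof.
rewrite /F4_brk /= !(commutator0 _).1 F4_act0 subr0 !add0r.
by rewrite F4_odd_so7C F4_odd_sl2C (lin0 (F4_odd_so7_linear _)) (lin0 (F4_odd_sl2_linear _)).
Qed.

Lemma F4_brk_oe B b Q : F4_brk (F4_od Q) (F4_ev B b) = F4_od (- F4_act B b Q).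
Proof.
rewrite /F4_brk /= !(commutator0 _).2 F4_act0 sub0r !add0r.
by rewrite (lin0 (F4_odd_so7_linear _)) (lin0 (F4_odd_sl2_linear _)).
Qed.

Lemma F4_brk_oo Q P :
  F4_brk (F4_od Q) (F4_od P) = F4_ev (F4_odd_so7 Q P) (F4_odd_sl2 Q P).
Proof. by rewrite /F4_brk /= !(commutator0 _).1 !F4_act0 subrr !add0r. Qed.

Lemma F4_form_ee A a B b :
  F4_form (F4_ev A a) (F4_ev B b) = 2^-1 * \tr (A *m B) - 2 / 3 * \tr (a *m b).
Proof. by rewrite /F4_form /F4_beta mulmx0 mul0mx raddf0 mulr0 subr0. Qed.

Lemma F4_form_eo A a P : F4_form (F4_ev A a) (F4_od P) = 0.
Proof.
by rewrite /F4_form /F4_beta /= !mulmx0 trmx0 !mul0mx !raddf0 !mulr0 !subr0.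
Qed.

Lemma F4_form_oe A a P : F4_form (F4_od P) (F4_ev A a) = 0.
Proof. by rewrite /F4_form /F4_beta /= !mulmx0 !mul0mx !raddf0 !mulr0 !subr0. Qed.

Lemma F4_form_oo Q P : F4_form (F4_od Q) (F4_od P) = - (4 * F4_beta Q P).
Proof. by rewrite /F4_form /= !mul0mx !raddf0 !mulr0 subr0 sub0r. Qed.

Lemma F4_part0 X : X \in hpart D false <->
  exists A a, [/\ A = - A^T, \tr a = 0 & X = F4_ev A a].
Proof.
rewrite /= /F4_hpart /=; set P := [set X | _]; rewrite (_ : X \in vs_of P <-> P X).
  case: X => [[A a] Q]; split=> [[/= hA ha ->]|[B [b [hB hb [-> -> ->]]]]] //.
  by exists A, a.
apply: vs_ofP => [|c [[A a] Q] [[B b] P'] [/= hA ha ->] [/= hB hb ->]].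
  by split; rewrite /= ?trmx0 ?oppr0 ?raddf0.
split=> /=.
- by rewrite linearP /= opprD -scalerN -hA -hB.
- by rewrite linearP /= ha hb mulr0 addr0.
by rewrite scaler0 addr0.
Qed.

Lemma F4_part1 X : X \in hpart D true <-> exists Q, X = F4_od Q.
Proof.
rewrite /= /F4_hpart /=; set P := [set X | _]; rewrite (_ : X \in vs_of P <-> P X).
  case: X => [[A a] Q]; split=> [[/= -> ->]|[P' [-> -> ->]]] //.
  by exists Q.
apply: vs_ofP => [|c [[A a] Q] [[B b] P'] [/= -> ->] [/= -> ->]]; first by [].
by split; rewrite /= scaler0 addr0.
Qed.

Lemma F4_partP p X : X \in hpart D p ->
  if p then exists Q, X = F4_od Q
  else exists A a, [/\ A = - A^T, \tr a = 0 & X = F4_ev A a].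
Proof. by case: p => [/F4_part1|/F4_part0]. Qed.

Lemma commutator_tr n (X Y : 'M[C]_n) : \tr (commutator X Y) = 0.
Proof. by rewrite raddfB /= mxtrace_mulC subrr. Qed.

Lemma commutator_anti n (X Y : 'M[C]_n) : X = - X^T -> Y = - Y^T ->
  commutator X Y = - (commutator X Y)^T.
Proof.
move=> hX hY; rewrite /commutator raddfB /= !trmx_mul opprB.
by rewrite {1 2}hX {1 2}hY !mulNmx !mulmxN !opprK.
Qed.

Lemma commutatorC n (X Y : 'M[C]_n) : commutator Y X = - commutator X Y.
Proof. by rewrite /commutator opprB. Qed.

Lemma commutator_inv n (X Y Z : 'M[C]_n) :
  \tr (commutator X Y *m Z) = \tr (X *m commutator Y Z).
Proof.
rewrite mulmxBl mulmxBr !raddfB /= !mulmxA; congr (_ - _).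
by rewrite -[Y *m X *m Z]mulmxA mxtrace_mulC.
Qed.

(** Both even components acquire the same constant, 8/2 = 4 and (2/3) 6 = 4, so they combine into
    the action of the whole even part. *)
Lemma F4_form_ooe Q P A a : A = - A^T -> \tr a = 0 ->
  F4_form (F4_ev (F4_odd_so7 Q P) (F4_odd_sl2 Q P)) (F4_ev A a) =
  4 * F4_beta Q (F4_act A a P).
Proof.
move=> hA ha; rewrite F4_form_ee F4_odd_so7_tr // F4_odd_sl2_tr //.
rewrite /F4_act F4_betaDr.
by field.
Qed.

Lemma F4_formC A a B b :
  F4_form (F4_ev A a) (F4_ev B b) = F4_form (F4_ev B b) (F4_ev A a).
Proof. by rewrite !F4_form_ee mxtrace_mulC [\tr (a *m b)]mxtrace_mulC. Qed.

Lemma F4_form_inv p p' p'' X Y Z : X \in hpart D p -> Y \in hpart D p' ->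
  Z \in hpart D p'' -> F4_form (F4_brk X Y) Z = F4_form X (F4_brk Y Z).
Proof.
move=> /F4_partP + /F4_partP + /F4_partP.
case: p => [[Q ->]|[A [a [hA ha ->]]]]; case: p' => [[P ->]|[B [b [hB hb ->]]]];
  case: p'' => [[R ->]|[E [e [hE he ->]]]];
  rewrite ?F4_brk_ee ?F4_brk_eo ?F4_brk_oe ?F4_brk_oo ?F4_form_eo ?F4_form_oe //.
- by rewrite F4_form_ooe // F4_form_oo F4_betaNr mulrN opprK.
- by rewrite !F4_form_oo F4_betaNl F4_beta_act // opprK.
- by rewrite F4_formC F4_form_ooe // F4_form_oo F4_beta_act // mulrN opprK.
by rewrite !F4_form_ee !commutator_inv.
Qed.

Lemma F4_form_linr X : linear (F4_form X : D -> C^o).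
Proof.
move=> c [[A a] Q] [[B b] P]; rewrite /F4_form /=.
rewrite !mulmxDr -!scalemxAr !raddfD /= !linearZ /= F4_betaDr F4_betaZr.
by rewrite -![_ *: _]/(_ * _) /=; ring.
Qed.

Lemma F4_form_linl Y : linear (fun X : D => F4_form X Y : C^o).
Proof.
move=> c [[A a] Q] [[B b] P]; rewrite /F4_form /=.
rewrite !mulmxDl -!scalemxAl !raddfD /= !linearZ /= F4_betaDl F4_betaZl.
by rewrite -![_ *: _]/(_ * _) /=; ring.
Qed.

Lemma mul_deltaE m n k (M : 'M[C]_(k, m)) (i : 'I_m) (j : 'I_n) r t :
  (M *m delta_mx i j) r t = M r i *+ (t == j).
Proof.
rewrite mxE (bigD1 i) //= mxE eqxx big1 ?addr0 => [|l /negPf li].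
  by rewrite /= mulr_natr.
by rewrite mxE li mulr0.
Qed.

Lemma mxtrace_mul_delta m n (M : 'M[C]_(n, m)) i j : \tr (M *m delta_mx i j) = M j i.
Proof.
rewrite /mxtrace (bigD1 j) //= mul_deltaE eqxx mulr1n big1 ?addr0 // => k /negPf kj.
by rewrite mul_deltaE kj.
Qed.

Lemma F4_form_nondeg p X : X \in hpart D p ->
  (forall Y, Y \in hpart D p -> F4_form X Y = 0) -> X = 0.
Proof.
have n2 : 2 != 0 :> C by rewrite pnatr_eq0.
have n3 : 3 != 0 :> C by rewrite pnatr_eq0.
case: p => [/F4_part1[Q ->] h|/F4_part0[A [a [hA ha ->]]] h].
  have wQS : w *m Q^T *m S = 0.
    apply/matrixP => j s; rewrite [RHS]mxE.
    have /h : F4_od (delta_mx s j) \in hpart D true by apply/F4_part1; eexists.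
    rewrite F4_form_oo => /eqP; rewrite oppr_eq0 mulf_eq0 pnatr_eq0 /= => /eqP.
    by rewrite /F4_beta mxtrace_mulC !mulmxA mxtrace_mul_delta.
  suff -> : Q = 0 by [].
  apply: trmx_inj; rewrite trmx0 -[Q^T]mulmx1 -(spin_form_inv C).
  rewrite mulmxA -[Q^T](mul1mx _) -(Omega_trK C 1).2 -[w^T *m w *m _]mulmxA.
  by rewrite -[w^T *m _ *m S]mulmxA wQS mulmx0 mul0mx.
congr (_, _, _).
  apply/matrixP => i j; rewrite mxE; set E := delta_mx j i - delta_mx i j : 'M[C]_7.
  have /h : F4_ev E 0 \in hpart D false.
    by apply/F4_part0; exists E, 0; rewrite !raddf0 /E raddfB /= !trmx_delta opprB.
  rewrite F4_form_ee mulmx0 raddf0 mulr0 subr0 mulmxBr raddfB /= !mxtrace_mul_delta.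
  have -> : A j i = - A i j by rewrite {1}hA !mxE.
  rewrite opprK -mulr2n -[A i j *+ 2]mulr_natl mulrA mulVf // mul1r.
  by [].
apply/matrixP => i j; rewrite mxE.
(* The traceless projection of an elementary matrix; the scalar removed pairs to zero with the
   traceless [a]. *)
set E := delta_mx j i - (2^-1 * (i == j)%:R)%:M : 'M[C]_2.
have /h : F4_ev 0 E \in hpart D false.
  apply/F4_part0; exists 0, E; rewrite !raddf0; split=> //.
  rewrite /E raddfB /= mxtrace_scalar -[delta_mx _ _]mul1mx mxtrace_mul_delta !mxE.
  have h2 : 2^-1 *+ 2 = 1 :> C by rewrite -[LHS]mulr_natr mulVf.
  by case: eqP => _; rewrite ?mulr1 ?mulr0 ?h2 ?mul0rn ?mulr0n ?mulr1n subrr.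
rewrite F4_form_ee mulmx0 raddf0 mulr0 sub0r mulmxBr raddfB /= mxtrace_mul_delta.
rewrite mul_mx_scalar linearZ /= ha mulr0 subr0 => /eqP.
by rewrite oppr_eq0 !mulf_eq0 invr_eq0 (negPf n2) (negPf n3) /= => /eqP.
Qed.

End F4.

(** The family [e] may be linearly dependent: linear functionals that expand every vector of [U]
    suffice. This allows so(7) to be indexed by all pairs and sl(2) by all four matrix positions. *)
Lemma trace_onE (C : numClosedFieldType) (L : vectType C) (U : {vspace L})
    (f : L -> L) (I : finType) (e : I -> L) (h : I -> L -> C) :
  linear f -> (forall i, linear (h i : L -> C^o)) -> (forall i, e i \in U) ->
  (forall X, X \in U -> f X \in U) ->
  (forall X, X \in U -> X = \sum_i h i X *: e i) ->
  trace_on U f = \sum_i h i (f (e i)).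
Proof.
move=> fl hl eU fU span; rewrite /trace_on.
have bU (k : 'I_(\dim U)) : (vbasis U)`_k \in U.
  by apply/vbasis_mem/mem_nth; rewrite size_tuple.
transitivity (\sum_(k < \dim U) \sum_i
    h i (vbasis U)`_k * coord (vbasis U) k (f (e i))).
  apply: eq_bigr => k _; rewrite {1}(span _ (bU k)) (lin_sum fl) linear_sum.
  by apply: eq_bigr => i _; rewrite (linZ fl) linearZ.
rewrite exchange_big; apply: eq_bigr => i _ /=.
rewrite {2}(coord_vbasis (fU _ (eU i))) (lin_sum (hl i)); apply: eq_bigr => k _.
by rewrite (linZ (hl i)) mulrC.
Qed.

(** * The Killing form of F(4) on the Cartan subalgebra *)

Section F4.
Variable C : numClosedFieldType.
Local Notation D := (F4_data C).
Implicit Types (A B : 'M[C]_7) (a b : 'M[C]_2) (Q P : 'M[C]_(8, 2)).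

Lemma mul_delta_mulE m n k l (M : 'M[C]_(k, m)) (N : 'M[C]_(n, l)) (i : 'I_m) (j : 'I_n) r t :
  (M *m delta_mx i j *m N) r t = M r i * N j t.
Proof.
rewrite mxE (bigD1 j) //= mul_deltaE eqxx mulr1n big1 ?addr0 // => s /negPf sj.
by rewrite mul_deltaE sj mulr0n mul0r.
Qed.

Lemma commutatorBr n (X Y Z : 'M[C]_n) :
  commutator X (Y - Z) = commutator X Y - commutator X Z.
Proof. exact: linB (commutator_linr X) Y Z. Qed.

Lemma commutator2_deltaE n (X Y : 'M[C]_n) k l i j :
  commutator X (commutator Y (delta_mx k l)) i j =
  (X *m Y) i k * (l == j)%:R - X i k * Y l j - Y i k * X l j
    + (i == k)%:R * (Y *m X) l j.
Proof.
have -> : commutator X (commutator Y (delta_mx k l)) =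
    X *m Y *m delta_mx k l *m 1%:M - X *m delta_mx k l *m Y -
    Y *m delta_mx k l *m X + 1%:M *m delta_mx k l *m (Y *m X).
  rewrite /commutator mulmxBr mulmxBl mulmx1 mul1mx !mulmxA opprB addrA.
  by rewrite addrAC -addrA [_ - _]addrC addrA.
have E (M1 M2 M3 M4 : 'M[C]_n) : (M1 - M2 - M3 + M4) i j =
  M1 i j - M2 i j - M3 i j + M4 i j by rewrite !mxE.
rewrite E !mul_delta_mulE.
by congr (_ * _ - _ - _ + _ * _); rewrite mxE.
Qed.

(** The left side is the trace of ad X ad Y on all n by n matrices. *)
Lemma sum_commutator2 n (X Y : 'M[C]_n) :
  \sum_(p : 'I_n * 'I_n) commutator X (commutator Y (delta_mx p.1 p.2)) p.1 p.2 =
  2 * (n%:R * \tr (X *m Y)) - 2 * (\tr X * \tr Y).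
Proof.
rewrite -(pair_bigA _ (fun i j => commutator X (commutator Y (delta_mx i j)) i j)) /=.
transitivity (\sum_i \sum_j ((X *m Y) i i - X i i * Y j j - Y i i * X j j + (Y *m X) j j)).
  apply: eq_bigr => i _; apply: eq_bigr => j _.
  by rewrite commutator2_deltaE !eqxx mulr1 mul1r.
transitivity (\sum_i ((X *m Y) i i *+ n - X i i * \tr Y - Y i i * \tr X + \tr (Y *m X))).
  apply: eq_bigr => i _; rewrite big_split /= !sumrB sumr_const card_ord.
  by rewrite -!mulr_sumr.
rewrite big_split /= !sumrB sumr_const card_ord sumrMnl -!mulr_suml.
rewrite -/(\tr X) -/(\tr Y) -/(\tr (X *m Y)) [\tr (Y *m X)]mxtrace_mulC.
rewrite -[\tr (X *m Y) *+ n]mulr_natl.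
by ring.
Qed.

(** The same trace composed with transposition T. Since (1 - T)/2 projects onto antisymmetric
    matrices, half the difference of the two is the trace on so(n). *)
Lemma sum_commutator2_tr n (X Y : 'M[C]_n) : Y = - Y^T ->
  \sum_(p : 'I_n * 'I_n) commutator X (commutator Y (delta_mx p.2 p.1)) p.1 p.2 =
  4 * \tr (X *m Y).
Proof.
move=> hY.
rewrite -(pair_bigA _ (fun i j => commutator X (commutator Y (delta_mx j i)) i j)) /=.
have YE i j : Y i j = - Y j i by rewrite {1}hY !mxE.
transitivity (\sum_i ((X *m Y) i i + 2 * (\sum_j X i j * Y j i) + (Y *m X) i i)).
  apply: eq_bigr => i _.
  transitivity (\sum_j ((X *m Y) i j * (j == i)%:R + 2 * (X i j * Y j i) +
      (j == i)%:R * (Y *m X) i j)).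
    apply: eq_bigr => j _; rewrite commutator2_deltaE (YE i j) [i == j]eq_sym.
    by ring.
  rewrite !big_split /= -mulr_sumr; congr (_ + _ + _).
    by rewrite (bigD1 i) //= eqxx mulr1 big1 ?addr0 // => j /negPf ->; rewrite mulr0.
  by rewrite (bigD1 i) //= eqxx mul1r big1 ?addr0 // => j /negPf ->; rewrite mul0r.
have -> : \sum_i ((X *m Y) i i + 2 * (\sum_j X i j * Y j i) + (Y *m X) i i) =
   \tr (X *m Y) + 2 * \tr (X *m Y) + \tr (Y *m X).
  rewrite !big_split /= -mulr_sumr; congr (_ + 2 * _ + _).
  by apply: eq_bigr => i _; rewrite mxE.
by rewrite [\tr (Y *m X)]mxtrace_mulC; ring.
Qed.

Lemma F4_ev_lin c A B a b :
  F4_ev (c *: A + B) (c *: a + b) = c *: F4_ev A a + F4_ev B b.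
Proof. by rewrite /F4_ev -[RHS]/(_, _, c *: 0 + 0) scaler0 addr0. Qed.

Lemma sum_deltaE m n (M : 'M[C]_(m, n)) :
  \sum_(p : 'I_m * 'I_n) M p.1 p.2 *: delta_mx p.1 p.2 = M.
Proof.
rewrite [RHS]matrix_sum_delta.
exact: esym (pair_bigA _ (fun i j => M i j *: delta_mx i j)).
Qed.

Lemma sum_delta_trE m n (M : 'M[C]_(m, n)) :
  \sum_(p : 'I_m * 'I_n) M p.1 p.2 *: delta_mx p.2 p.1 = M^T.
Proof.
rewrite -{2}[M]sum_deltaE linear_sum; apply: eq_bigr => p _.
by rewrite linearZ /= trmx_delta.
Qed.

Lemma trace_on_even A a B b : A = - A^T -> \tr a = 0 -> B = - B^T -> \tr b = 0 ->
  trace_on (hpart D false) (fun Z => F4_brk (F4_ev A a) (F4_brk (F4_ev B b) Z)) =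
  5 * \tr (A *m B) + 4 * \tr (a *m b).
Proof.
move=> hA ha hB hb; set f := fun Z => _.
have h2 : 2^-1 *+ 2 = 1 :> C by rewrite -[LHS]mulr_natr mulVf // pnatr_eq0.
pose I := (('I_7 * 'I_7) + ('I_2 * 'I_2))%type.
pose e (x : I) : D := match x with
  | inl p => F4_ev (delta_mx p.1 p.2 - delta_mx p.2 p.1) 0
  | inr p => F4_ev 0 (delta_mx p.1 p.2 - (2^-1 * (p.1 == p.2)%:R)%:M) end.
pose h (x : I) (X : D) : C := match x with
  | inl p => 2^-1 * X.1.1 p.1 p.2 | inr p => X.1.2 p.1 p.2 end.
have subE (M N : 'M[C]_7) i j : (M - N) i j = M i j - N i j by rewrite !mxE.
have fE A' a' : f (F4_ev A' a') =
    F4_ev (commutator A (commutator B A')) (commutator a (commutator b a')).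
  by rewrite /f !F4_brk_ee.
have evP A' a' : A' = - A'^T -> \tr a' = 0 -> F4_ev A' a' \in hpart D false.
  by move=> ? ?; apply/F4_part0; exists A', a'.
rewrite (trace_onE (e := e) (h := h)).
- rewrite big_sumType; congr (_ + _).
    (* The constant 5 is (2 * 7 - 4)/2; the product of traces vanishes by antisymmetry. *)
    transitivity (2^-1 * (2 * (7 * \tr (A *m B)) - 2 * (\tr A * \tr B) - 4 * \tr (A *m B))).
      rewrite -sum_commutator2 -sum_commutator2_tr // -sumrB mulr_sumr.
      apply: eq_bigr => p _; rewrite fE [h _ _]/(2^-1 * _) /=.
      congr (_ * _); rewrite (commutatorBr B (delta_mx _ _)).
      by rewrite (commutatorBr A (commutator B (delta_mx _ _))) subE.
    have -> : \tr A = 0 by apply: big1 => i _; apply: antisym_diag.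
    by rewrite mul0r mulr0 subr0; field.
  transitivity (2 * (2 * \tr (a *m b)) - 2 * (\tr a * \tr b)).
    rewrite -sum_commutator2; apply: eq_bigr => p _; rewrite fE [LHS]/=.
    rewrite (commutatorBr b (delta_mx _ _)).
    have -> : commutator b (2^-1 * (p.1 == p.2)%:R)%:M = 0.
      by rewrite /commutator scalar_mxC subrr.
    by rewrite subr0.
  by rewrite ha mul0r mulr0 subr0 mulrA -natrM.
- by move=> c X Y; rewrite /f !F4_brk_linr.
- have E n c (M N : 'M[C]_n) i j : (c *: M + N) i j = c * M i j + N i j by rewrite !mxE.
  move=> [p|p] c [[X1 X2] X3] [[Y1 Y2] Y3]; rewrite /h /= E //.
  by rewrite -[c *: _]/(c * _); ring.
- move=> [p|p]; apply: evP; rewrite ?raddf0 ?trmx0 ?oppr0 //.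
    by rewrite raddfB /= !trmx_delta opprB.
  rewrite raddfB /= mxtrace_scalar -[delta_mx _ _]mul1mx mxtrace_mul_delta !mxE eq_sym.
  by case: eqP => _; rewrite ?mulr1 ?mulr0 ?h2 ?mul0rn ?mulr0n ?mulr1n subrr.
- move=> X /F4_part0[A' [a' [hA' ha' ->]]]; rewrite /f !F4_brk_ee; apply: evP.
    by apply: commutator_anti => //; apply: commutator_anti.
  exact: commutator_tr.
move=> X /F4_part0[A' [a' [hA' ha' ->]]]; rewrite big_sumType /=.
have ev1 : linear (fun M : 'M[C]_7 => F4_ev M 0).
  by move=> c M N; have := F4_ev_lin c M N 0 0; rewrite scaler0 addr0.
have ev2 : linear (F4_ev (0 : 'M[C]_7)).
  by move=> c M N; have := F4_ev_lin c 0 0 M N; rewrite scaler0 addr0.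
have -> : \sum_p h (inl p) (F4_ev A' a') *: e (inl p) = F4_ev A' 0.
  rewrite -(lin_comb ev1); congr (F4_ev _ _).
  rewrite (eq_bigr (fun p => 2^-1 *: (A' p.1 p.2 *: delta_mx p.1 p.2 -
    A' p.1 p.2 *: delta_mx p.2 p.1))); last by move=> p _; rewrite -scalerBr scalerA.
  rewrite -scaler_sumr sumrB sum_deltaE sum_delta_trE -hA' -mulr2n -scaler_nat.
  by rewrite scalerA mulVf ?scale1r // pnatr_eq0.
have -> : \sum_p h (inr p) (F4_ev A' a') *: e (inr p) = F4_ev 0 a'.
  rewrite -(lin_comb ev2); congr (F4_ev _ _).
  rewrite (eq_bigr (fun p => a' p.1 p.2 *: delta_mx p.1 p.2 -
    (a' p.1 p.2 * (2^-1 * (p.1 == p.2)%:R))%:M)); last first.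
    by move=> p _; rewrite scalerBr scale_scalar_mx.
  rewrite sumrB sum_deltaE -(raddf_sum (@scalar_mx C 2)).
  rewrite -(pair_bigA _ (fun i j => a' i j * (2^-1 * (i == j)%:R))) /=.
  rewrite (eq_bigr (fun i => a' i i * 2^-1)) => [|i _].
    by rewrite -mulr_suml -/(\tr a') ha' mul0r raddf0 subr0.
  rewrite (bigD1 i) //= eqxx mulr1 big1 ?addr0 // => j /negPf ji.
  by rewrite eq_sym ji !mulr0.
by congr (_, _, _); rewrite ?addr0 ?add0r.
Qed.

(** The trace on a tensor product of dimensions 8 and 2; the mixed terms contain tr a or tr b. *)
Lemma trace_on_odd A a B b : \tr a = 0 -> \tr b = 0 ->
  trace_on (hpart D true) (fun Z => F4_brk (F4_ev A a) (F4_brk (F4_ev B b) Z)) =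
  2 * \tr (spin A *m spin B) + 8 * \tr (a *m b).
Proof.
move=> ha hb; set f := fun Z => _.
have fE Q : f (F4_od Q) = F4_od (F4_act A a (F4_act B b Q)) by rewrite /f !F4_brk_eo.
pose e (p : 'I_8 * 'I_2) : D := F4_od (delta_mx p.1 p.2).
pose h (p : 'I_8 * 'I_2) (X : D) : C := X.2 p.1 p.2.
have odP Q : F4_od Q \in hpart D true by apply/F4_part1; exists Q.
rewrite (trace_onE (e := e) (h := h)).
- transitivity (\sum_(p : 'I_8 * 'I_2) ((spin A *m spin B) p.1 p.1 +
      spin A p.1 p.1 * b p.2 p.2 + spin B p.1 p.1 * a p.2 p.2 + (a *m b) p.2 p.2)).
    apply: eq_bigr => p _; rewrite fE [LHS]/= /F4_act.
    have -> : spin A *m (spin B *m delta_mx p.1 p.2 + delta_mx p.1 p.2 *m b^T) +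
      (spin B *m delta_mx p.1 p.2 + delta_mx p.1 p.2 *m b^T) *m a^T =
      spin A *m spin B *m delta_mx p.1 p.2 *m 1%:M +
      spin A *m delta_mx p.1 p.2 *m b^T + spin B *m delta_mx p.1 p.2 *m a^T +
      1%:M *m delta_mx p.1 p.2 *m (a *m b)^T.
      by rewrite mulmx1 mul1mx trmx_mul mulmxDr mulmxDl !mulmxA !addrA.
    have E (M1 M2 M3 M4 : 'M[C]_(8, 2)) i j : (M1 + M2 + M3 + M4) i j =
      M1 i j + M2 i j + M3 i j + M4 i j by rewrite !mxE.
    rewrite [h _ _]E !mul_delta_mulE ![_^T _ _]mxE ![1%:M _ _]mxE !eqxx mulr1 mul1r.
    by [].
  rewrite -(pair_bigA _ (fun i j => (spin A *m spin B) i i + spin A i i * b j j +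
      spin B i i * a j j + (a *m b) j j)) /=.
  transitivity (\sum_i ((spin A *m spin B) i i *+ 2 + \tr (a *m b))).
    apply: eq_bigr => i _; rewrite !big_split /= sumr_const card_ord -!mulr_sumr.
    by rewrite -/(\tr b) -/(\tr a) ha hb !mulr0 !addr0.
  by rewrite big_split /= sumr_const card_ord sumrMnl !mulr_natl.
- by move=> c X Y; rewrite /f !F4_brk_linr.
- by move=> p c [[X1 X2] X3] [[Y1 Y2] Y3]; rewrite /h /= !mxE.
- by move=> p; apply: odP.
- by move=> X /F4_part1[Q ->]; rewrite fE; apply: odP.
move=> X /F4_part1[Q ->].
have od_lin : linear (F4_od (C := C)).
  move=> c M N; rewrite /F4_od -[RHS]/(c *: 0 + 0, c *: 0 + 0, _).
  by rewrite !scaler0 !addr0.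
by rewrite -(lin_comb od_lin) /= sum_deltaE.
Qed.

Lemma mxtrace_tens m n (M : 'M[C]_m) (N : 'M[C]_n) : \tr (M *t N) = \tr M * \tr N.
Proof.
rewrite /mxtrace (reindex (@mxtens_index m n)) /=; last first.
  by exists (@mxtens_unindex m n) => k _; rewrite ?mxtens_indexK ?mxtens_unindexK.
rewrite (eq_bigr (fun p => M p.1 p.1 * N p.2 p.2)) => [|[i j] _]; last by rewrite tensmxE.
rewrite -(pair_bigA _ (fun i j => M i i * N j j)) /= mulr_suml.
by apply: eq_bigr => i _; rewrite mulr_sumr.
Qed.

Lemma mxtrace_tens3 (M N T : 'M[C]_2) : \tr (tens3 M N T) = \tr M * \tr N * \tr T.
Proof. by rewrite /tens3 (mxtrace_tens (M *t N) T) mxtrace_tens. Qed.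

(** Mixed terms vanish because [sigma_z] is traceless. The value equals that of [mxtrace_K]: the
    spin and vector representations have the same trace form on the Cartan subalgebra. *)
Lemma mxtrace_spin_K t t' :
  \tr (spin (K_blocks 7 t) *m spin (K_blocks 7 t')) =
  2 * (t 0%N * t' 0%N + t 1%N * t' 1%N + t 2%N * t' 2%N) :> C.
Proof.
have [_ _ zz] := sigma_sqr C.
have z0 : \tr (sigma_z C) = 0 by rewrite mxtrace2 !mx2E subrr.
have tr1 : \tr (1%:M : 'M[C]_2) = 2 by rewrite mxtrace1.
rewrite !spin_K_blocks -scalemxAl -scalemxAr !mulmxDr !mulmxDl.
rewrite -!scalemxAl -!scalemxAr !tens3_mul !mulmx1 !mul1mx zz.
rewrite !linearZ /= !raddfD /= !linearZ /= !mxtrace_tens3 tr1 z0.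
by field.
Qed.

Lemma mxtrace_K t t' : \tr (K_blocks 7 t *m K_blocks 7 t') =
  2 * (t 0%N * t' 0%N + t 1%N * t' 1%N + t 2%N * t' 2%N) :> C.
Proof.
have ii : 'i * 'i = -1 :> C by rewrite -expr2 sqrCi.
have sumE i : (K_blocks 7 t *m K_blocks 7 t') i i =
    (if so_opp i != i then t i./2 * t' i./2 else 0).
  rewrite mxE (bigD1 (so_opp i)) //= big1 ?addr0 => [|j /negPf ji].
    rewrite !K_blocksE !mxE eqxx so_oppK eqxx /= eq_sym half_so_opp.
    case: eqVneq => [_|ni]; first by rewrite mul0r.
    have ni' : so_opp i != i by rewrite /= ?ni // eq_sym.
    rewrite odd_so_opp //; case: (odd i) => /=.
      by rewrite mulrACA mulNr ii opprK mul1r.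
    by rewrite mulrACA mulrN ii opprK mul1r.
  by rewrite K_blocksE mxE ji mul0r.
rewrite /mxtrace (eq_bigr _ (fun i _ => sumE i)) {sumE}.
rewrite !big_ord_recl big_ord0 -!val_eqE /= !val_so_opp /=.
by ring.
Qed.

Lemma K_blocks_anti t : K_blocks 7 t = - (K_blocks 7 t)^T :> 'M[C]_7.
Proof.
apply/matrixP => k l; rewrite !mxE.
case: ifP => [/andP[ok /eqP ->]|_].
  by rewrite /= ok /= mulNr opprK.
by case: ifP => _; rewrite ?mulNr ?oppr0.
Qed.

Lemma mx2_tr0 (c : C) : \tr (mx2 c 0 0 (- c)) = 0.
Proof. by rewrite mxtrace2 !mx2E /= subrr. Qed.

Definition F4_cart t c : F4_space C := F4_ev (K_blocks 7 t) (mx2 c 0 0 (- c)).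

Lemma F4_cartanP X : X \in cartan D <-> exists t c, X = F4_cart t c.
Proof.
apply: vs_ofP.
  exists (fun=> 0), 0; rewrite /F4_cart /F4_ev; congr (_, _, _).
    by apply/matrixP => i j; rewrite !mxE !mulr0 !if_same.
  by apply/matrixP => i j; rewrite mx2E mxE oppr0 !if_same.
move=> z Y Z [t [c ->]] [t' [c' ->]].
exists (fun i => z * t i + t' i), (z * c + c').
rewrite -F4_ev_lin /F4_cart /F4_ev; congr (_, _, _).
  apply/matrixP => i j; rewrite !mxE.
  by case: ifP => _; [ring|case: ifP => _; ring].
have E (M N : 'M[C]_2) i j : (z *: M + N) i j = z * M i j + N i j by rewrite !mxE.
apply/matrixP => i j; rewrite E !mx2E.
by case: ifP => _; case: ifP => _; ring.
Qed.

End F4.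

Section F4.
Variable C : numClosedFieldType.
Local Notation D := (F4_data C).
Local Notation ta := (fun i : 'I_7 => odd i).
Local Notation sg := (@so_opp 7).
Implicit Types (A B : 'M[C]_7) (a b : 'M[C]_2) (Q P : 'M[C]_(8, 2)).

Lemma so7_ta_sg k : sg k != k -> ta (sg k) = ~~ ta k.
Proof. exact: odd_so_opp. Qed.

Lemma so7_ta_fix k : sg k = k -> ta k = false.
Proof. by case/so_opp_fix. Qed.

Lemma so7_fix_uniq k l : sg k = k -> sg l = l -> k = l.
Proof.
move=> /so_opp_fix[_ km] /so_opp_fix[_ lm].
by apply: val_inj; apply: succn_inj; rewrite km lm.
Qed.

Lemma F4_invariant_form : invariant_form (D := D) (@F4_form C).
Proof.
have cartP X : X \in cartan D -> exists t c, X = F4_cart t c by move/F4_cartanP.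
have cart0 t c : F4_cart t c \in hpart D false.
  apply/F4_part0; exists (K_blocks 7 t), (mx2 c 0 0 (- c)).
  by split=> //; [exact: K_blocks_anti | exact: mx2_tr0].
have KK t t' : commutator (K_blocks 7 t) (K_blocks 7 t') = 0 :> 'M[C]_7.
  rewrite /commutator !K_blocksE (pair_cartan_comm (@so_oppK 7) so7_ta_sg so7_ta_fix) ?subrr //.
    by move=> k; rewrite half_so_opp.
  by move=> k; rewrite half_so_opp.
have BE X Y : @brk C D X Y = F4_brk X Y by [].
split.
- exact: F4_brk_linl.
- exact: F4_brk_linr.
- move=> p p' X Y /F4_partP + /F4_partP.
  case: p => [[Q ->]|[A [a [hA ha ->]]]]; case: p' => [[P ->]|[B [b [hB hb ->]]]].
  + rewrite BE F4_brk_oo; apply/F4_part0; eexists; eexists; split; last by [].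
      exact: F4_odd_so7_anti.
    exact: F4_odd_sl2_tr0.
  + by rewrite BE F4_brk_oe; apply/F4_part1; eexists.
  + by rewrite BE F4_brk_eo; apply/F4_part1; eexists.
  rewrite BE F4_brk_ee; apply/F4_part0; eexists; eexists; split; last by [].
    exact: commutator_anti.
  exact: commutator_tr.
- move=> p p' X Y /F4_partP + /F4_partP.
  case: p => [[Q ->]|[A [a [hA ha ->]]]]; case: p' => [[P ->]|[B [b [hB hb ->]]]].
  + rewrite !BE !F4_brk_oo expr1 scaleN1r opprK.
    by rewrite F4_odd_so7C F4_odd_sl2C.
  + rewrite !BE F4_brk_eo F4_brk_oe scale1r.
    by rewrite /F4_od -[RHS]/(- 0, - 0, - - _) !oppr0 opprK.
  + rewrite !BE F4_brk_oe F4_brk_eo scale1r.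
    by rewrite /F4_od -[RHS]/(- 0, - 0, - _) !oppr0.
  rewrite !BE !F4_brk_ee scale1r.
  by rewrite /F4_ev -[RHS]/(- _, - _, - 0) oppr0 -!commutatorC.
- by apply/subvP => X /cartP[t [c ->]].
- move=> X Y /cartP[t [c ->]] /cartP[t' [c' ->]].
  rewrite BE F4_brk_ee KK; congr (_, _, _).
  apply/eqP; rewrite subr_eq0; apply/eqP; rewrite !mx2_mul; congr mx2; ring.
- exact: F4_form_linl.
- exact: F4_form_linr.
- move=> p p' X Y /F4_partP + /F4_partP.
  case: p => [[Q ->]|[A [a [hA ha ->]]]]; case: p' => [[P ->]|[B [b [hB hb ->]]]].
  + by rewrite !F4_form_oo expr1 mulN1r F4_beta_sym mulrN.
  + by rewrite F4_form_oe F4_form_eo mulr0.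
  + by rewrite F4_form_oe F4_form_eo mulr0.
  by rewrite mul1r F4_formC.
- by move=> X Y /F4_part0[A [a [_ _ ->]]] /F4_part1[P ->]; rewrite F4_form_eo.
- exact: F4_form_inv.
- exact: F4_form_nondeg.
move=> X Y /cartP[t [c ->]] /cartP[t' [c' ->]].
(* One sixth of even minus odd trace: (5 - 2)/6 = 1/2 for so(7) and (4 - 8)/6 = -2/3 for sl(2). *)
rewrite F4_form_ee /= (trace_on_even (K_blocks_anti t) (mx2_tr0 c) (K_blocks_anti t') (mx2_tr0 c')).
rewrite (trace_on_odd _ _ (mx2_tr0 c) (mx2_tr0 c')) mxtrace_spin_K -mxtrace_K.
by field.
Qed.

End F4.

(** * Weights and roots of F(4) *)

Section F4.
Variable C : numClosedFieldType.
Local Notation D := (F4_data C).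
Local Notation ta := (fun i : 'I_7 => odd i).
Local Notation sg := (@so_opp 7).
Local Notation sz := (sigma_z C).

Definition spin_index (b1 b2 b3 : 'I_2) : 'I_8 :=
  mxtens_index (mxtens_index (b1, b2), b3).

Lemma spin_indexP (s : 'I_8) : exists b1 b2 b3, s = spin_index b1 b2 b3.
Proof.
rewrite -[s](@mxtens_unindexK 4 2); case: (mxtens_unindex _) => [r b3].
rewrite -[r](@mxtens_unindexK 2 2); case: (mxtens_unindex _) => [b1 b2].
by exists b1, b2, b3.
Qed.

Lemma tens3E (M N T : 'M[C]_2) b1 b2 b3 c1 c2 c3 :
  tens3 M N T (spin_index b1 b2 b3) (spin_index c1 c2 c3) = M b1 c1 * N b2 c2 * T b3 c3.
Proof.
have := tensmxE (M *t N) T (mxtens_index (b1, b2)) b3 (mxtens_index (c1, c2)) c3.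
by rewrite (tensmxE M N).
Qed.

Definition spin_sign (b : 'I_2) : C := if b == 0 then 1 else -1.

Lemma sigma_zE b c : sz b c = (b == c)%:R * spin_sign b.
Proof.
rewrite mx2E /spin_sign; case: b c => [[|[|//]] ?] [[|[|//]] ?] /=;
  by rewrite ?mul1r ?mul0r.
Qed.

Lemma spin_sign_inj : injective spin_sign.
Proof.
have n11 : 1 != -1 :> C by rewrite -subr_eq0 opprK -(natrD _ 1 1) pnatr_eq0.
move=> b c; rewrite /spin_sign; case: eqVneq => b0; case: eqVneq => c0 //.
- by move=> _; rewrite b0 c0.
- by move/eqP; rewrite (negPf n11).
- by move/eqP; rewrite eq_sym (negPf n11).
move=> _; apply: val_inj; move: b0 c0.
by case: b c => [[|[|//]] ?] [[|[|//]] ?].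
Qed.

Definition spin_weight (t : nat -> C) (s : 'I_8) : C := spin (K_blocks 7 t) s s.

Lemma spin_weightE t b1 b2 b3 : spin_weight t (spin_index b1 b2 b3) =
  - 2^-1 * (t 0%N * spin_sign b1 + t 1%N * spin_sign b2 + t 2%N * spin_sign b3).
Proof.
have E (k x y z : C) (X Y Z : 'M[C]_8) i j : (k *: (x *: X + y *: Y + z *: Z)) i j =
  k * (x * X i j + y * Y i j + z * Z i j) by rewrite !mxE.
rewrite /spin_weight spin_K_blocks E !tens3E !sigma_zE ![1%:M _ _]mxE !eqxx.
by rewrite !mul1r !mulr1.
Qed.

Lemma spin_K_diag t s r : spin (K_blocks 7 t) s r = (s == r)%:R * spin_weight t s.
Proof.
case: eqVneq => [<-|]; first by rewrite mul1r.
have [b1 [b2 [b3 ->]]] := spin_indexP s; have [c1 [c2 [c3 ->]]] := spin_indexP r.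
move=> ne; have E (k x y z : C) (X Y Z : 'M[C]_8) i j :
  (k *: (x *: X + y *: Y + z *: Z)) i j = k * (x * X i j + y * Y i j + z * Z i j).
  by rewrite !mxE.
rewrite mul0r spin_K_blocks E !tens3E !sigma_zE ![1%:M _ _]mxE.
case: (eqVneq b1 c1) ne => [->|_ _]; last by rewrite ?(mulr0n, mul0r, mulr0, addr0).
case: (eqVneq b2 c2) => [->|_ _]; last by rewrite ?(mulr0n, mul0r, mulr0, addr0).
case: (eqVneq b3 c3) => [->|_ _]; first by rewrite eqxx.
by rewrite ?(mulr0n, mul0r, mulr0, addr0).
Qed.

(** The weights are half sums of the three coordinates with independent signs, so evaluation at each
    coordinate recovers one sign. *)
Lemma spin_weight_inj s r : (forall t, spin_weight t s = spin_weight t r) -> s = r.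
Proof.
have [b1 [b2 [b3 ->]]] := spin_indexP s; have [c1 [c2 [c3 ->]]] := spin_indexP r.
have n2 : - 2^-1 != 0 :> C by rewrite oppr_eq0 invr_eq0 pnatr_eq0.
move=> h; have h' t := mulfI n2 (etrans (esym (spin_weightE t b1 b2 b3))
  (etrans (h t) (spin_weightE t c1 c2 c3))).
have := h' (fun i => (i == 0%N)%:R); rewrite /= !mul1r !mul0r !addr0 => /spin_sign_inj ->.
have := h' (fun i => (i == 1%N)%:R).
rewrite /= !mul1r !mul0r !addr0 !add0r => /spin_sign_inj ->.
have := h' (fun i => (i == 2%N)%:R).
by rewrite /= !mul1r !mul0r !add0r => /spin_sign_inj ->.
Qed.

Let J := ('I_7 * 'I_7 + bool + 'I_8 * 'I_2)%type.
Let U : 'M[C]_7 := weight_basis C ta sg.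
Let W : 'M[C]_7 := weight_cobasis C ta sg.
Let w (t : nat -> C) : 'I_7 -> C := @pair_weight C 7 ta sg (fun i => t i./2).
Let rv (x : 'I_7 * 'I_7) : 'M[C]_7 := pair_rootv C (fun=> false) ta sg x.1 x.2.

Definition F4_rootv (x : J) : D := match x with
  | inl (inl p) => F4_ev (rv p) 0
  | inl (inr b) => F4_ev 0 (if b then delta_mx 1 0 else delta_mx 0 1)
  | inr p => F4_od (delta_mx p.1 p.2) end.

Definition F4_rootp (x : J) : bool := if x is inr _ then true else false.

Definition F4_rootfun (x : J) (H : F4_space C) : C := match x with
  | inl (inl p) => (W *m H.1.1 *m U) p.1 p.1 + (W *m H.1.1 *m U) p.2 p.2
  | inl (inr b) => (if b then -2 else 2) * H.1.2 0 0
  | inr p => spin H.1.1 p.1 p.1 + H.1.2 p.2 p.2 end.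

Definition F4_rootw (x : J) : weight D := @wt_of C D (F4_rootfun x).

Lemma F4_rootwE x (H : subvs_of (cartan D)) t c : vsval H = F4_cart t c ->
  F4_rootw x H = match x with
  | inl (inl p) => w t p.1 + w t p.2
  | inl (inr b) => (if b then -2 else 2) * c
  | inr p => spin_weight t p.1 + (if p.2 == 0 then c else - c) end.
Proof.
move=> Hc; rewrite /F4_rootw wt_ofE ?Hc => [|k X Y].
  case: x => [[p|b]|p] /=; last 2 first.
  - by rewrite mx2E.
  - by rewrite mx2E; case: (p.2 == 0).
  rewrite K_blocksE -mulmxA (pair_cartan_diag (@so_oppK 7) (@so7_ta_sg)); last first.
    by move=> k; rewrite half_so_opp.
  rewrite mulmxA (weight_basisK C (@so_oppK 7) (@so7_ta_sg) (@so7_ta_fix)) mul1mx.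
  by rewrite !mxE !eqxx !mulr1n.
have E m n z (M N : 'M[C]_(m, n)) i j : (z *: M + N) i j = z * M i j + N i j.
  by rewrite !mxE.
case: X Y => [[X1 X2] X3] [[Y1 Y2] Y3]; case: x => [[p|b]|p] /=.
- by rewrite !mulmxDr !mulmxDl -!scalemxAr -!scalemxAl !E; ring.
- by rewrite E; ring.
by rewrite spin_linear !E; ring.
Qed.

Lemma F4_rootv_weight x (H : subvs_of (cartan D)) :
  brk (vsval H) (F4_rootv x) = F4_rootw x H *: F4_rootv x.
Proof.
have /F4_cartanP[t [c Hc]] := subvsP H; rewrite (F4_rootwE x Hc) Hc.
have BE X Y : @brk C D X Y = F4_brk X Y by [].
rewrite BE {BE}; case: x => [[p|b]|p].
- rewrite -[F4_rootv _]/(F4_ev (rv p) 0) F4_brk_ee (commutator0 _).1.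
  have -> : commutator (K_blocks 7 t) (rv p) = (w t p.1 + w t p.2) *: rv p.
    rewrite K_blocksE; apply: (pair_rootv_weight (@so_oppK 7)) => //.
    - exact: so7_ta_sg.
    by move=> k; rewrite half_so_opp.
  by rewrite /F4_ev -[RHS]/(_, _ *: 0, _ *: 0) !scaler0.
- set d : 'M[C]_2 := if b then delta_mx 1 0 else delta_mx 0 1.
  rewrite -[F4_rootv _]/(F4_ev 0 d) F4_brk_ee (commutator0 _).1.
  have -> : commutator (mx2 c 0 0 (- c)) d = ((if b then -2 else 2) * c) *: d.
    have -> : d = if b then mx2 0 0 1 0 else mx2 0 1 0 0.
      by rewrite /d; case: (b); rewrite [LHS]mx2_eta !mxE.
    apply/eqP; rewrite subr_eq; apply/eqP; case: (b); rewrite !mx2_mul mx2_scale;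
      apply/matrixP => i j; rewrite [RHS]mxE !mx2E;
      case: ifP => _; case: ifP => _; rewrite /=; ring.
  by rewrite /F4_ev -[RHS]/(_ *: 0, _, _ *: 0) !scaler0.
rewrite -[F4_rootv _]/(F4_od (delta_mx p.1 p.2)) F4_brk_eo.
have -> : F4_act (K_blocks 7 t) (mx2 c 0 0 (- c)) (delta_mx p.1 p.2) =
  (spin_weight t p.1 + (if p.2 == 0 then c else - c)) *: delta_mx p.1 p.2.
  apply/matrixP => i j.
  have -> : F4_act (K_blocks 7 t) (mx2 c 0 0 (- c)) (delta_mx p.1 p.2) =
      spin (K_blocks 7 t) *m delta_mx p.1 p.2 *m 1%:M +
      1%:M *m delta_mx p.1 p.2 *m mx2 c 0 0 (- c).
    by rewrite /F4_act mx2_tr mulmx1 mul1mx.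
  have E (M N : 'M[C]_(8, 2)) : (M + N) i j = M i j + N i j by rewrite !mxE.
  rewrite E !mul_delta_mulE spin_K_diag ![1%:M _ _]mxE [RHS]mxE [delta_mx _ _ _ _]mxE mx2E.
  case: (eqVneq i p.1) => [->|_] /=; last by rewrite !mul0r mulr0 addr0.
  rewrite !mul1r {E}; case: p => [s r] /=; case: r j => [[|[|//]] ?] [[|[|//]] ?] /=;
    by rewrite ?mulr1n ?mulr0n ?mulr1 ?mulr0 ?addr0.
by rewrite /F4_od -[RHS]/(_ *: 0, _ *: 0, _) !scaler0.
Qed.


Let so7_par_sg k : (fun=> false) (sg k) = (fun=> false) k :> bool.
Proof. by []. Qed.

Lemma so7_form1 : pair_form C (fun=> false) ta sg = 1%:M.
Proof. by apply/matrixP => i j; rewrite !mxE. Qed.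

Lemma F4_rootv_part x : F4_rootv x \in hpart D (F4_rootp x).
Proof.
case: x => [[p|b]|p]; last by apply/F4_part1; eexists.
  apply/F4_part0; exists (rv p), 0; rewrite raddf0; split=> //.
  have [M Ma ME] := pair_rootv_super C ta so7_par_sg p.1 p.2.
  have -> : rv p = M by rewrite /rv ME so7_form1 mulmx1.
  by apply/matrixP => i j; rewrite !mxE Ma mul1r.
apply/F4_part0; exists 0, (if b then delta_mx 1 0 else delta_mx 0 1).
by rewrite trmx0 oppr0 mxtrace2; split=> //; case: b; rewrite !mxE addr0.
Qed.

Lemma so7_anti (M : 'M[C]_7) : M = - M^T -> superanti (fun=> false) M.
Proof. by move=> hM i j; rewrite {1}hM !mxE mul1r. Qed.

Lemma F4_cart_ex t c : exists H : subvs_of (cartan D), vsval H = F4_cart t c.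
Proof.
have hc : F4_cart t c \in cartan D by apply/F4_cartanP; exists t, c.
by exists (vsproj (cartan D) (F4_cart t c)); rewrite vsprojK.
Qed.

(* The value at the coroot of sl(2) tells so(7), sl(2) and the odd part apart. *)
Definition F4_root_level (x : J) : int := match x with
  | inl (inl p) => 0
  | inl (inr b) => if b then -2 else 2
  | inr p => if p.2 == 0 then 1 else -1 end.

Lemma F4_root_levelE : exists H, forall x, F4_rootw x H = (F4_root_level x)%:~R.
Proof.
have [H HE] := F4_cart_ex (fun=> 0) 1; exists H => x; rewrite (F4_rootwE x HE).
case: x => [[p|b]|p] /=.
- have w0 k : w (fun=> 0) k = 0 by rewrite /w /pair_weight oppr0 !if_same.
  by rewrite !w0 addr0.
- by case: b; rewrite mulr1.
have [b1 [b2 [b3 ->]]] := spin_indexP p.1.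
by rewrite spin_weightE !mul0r !addr0 mulr0 add0r; case: (p.2 == 0).
Qed.

Lemma F4_root_level_eq x y : F4_rootw x = F4_rootw y -> F4_root_level x = F4_root_level y.
Proof.
by have [H HE] := F4_root_levelE; move=> xy; apply: (@intr_inj C); rewrite -!HE xy.
Qed.

Lemma F4_root_level0 x : F4_rootw x = 0 -> F4_root_level x = 0.
Proof.
have [H HE] := F4_root_levelE; move=> x0; apply: (@intr_inj C).
by rewrite -HE x0 zero_lfunE.
Qed.

Lemma w_coord (c : 'I_7 -> C) : (forall k, c (sg k) = c k) ->
  exists t, pair_weight ta sg c =1 w t.
Proof.
by move=> /so_opp_coord[t tE]; exists t => k; rewrite /w /pair_weight tE.
Qed.

(** The level separates so(7), the two roots of sl(2) and the two columns of the odd part. Within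
    so(7) the argument for paired indices applies with all indices orthogonal; within a column the
    spin weights are distinct. *)
Theorem F4_root_datum : exists (I : finType) (a : I -> weight D) e q F,
  root_datum a e q F.
Proof.
suff [I [a [e [q R]]]] : exists (I : finType) (a : I -> weight D) e q,
    root_datum a e q (@F4_form C) by exists I, a, e, q, (@F4_form C).
apply: (root_datum_of_family (a := F4_rootw) (e := F4_rootv) (q := F4_rootp)).
- exact: F4_invariant_form.
- exact: F4_rootv_part.
- exact: F4_rootv_weight.
- move=> x _ ax0; have := F4_root_level0 ax0; case: x ax0 => [[p|b]|p] ax0 /=; last 2 first.
  + by case: b {ax0}.
  + by case: (p.2 == 0).
  move=> _; split=> //.
  have p2 : p.2 = sg p.1.
    apply: (pair_weight0 (C := C) (@so_oppK 7) (@so7_ta_sg) (@so7_fix_uniq)) => c /w_coord[t tE].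
    have [H HE] := F4_cart_ex t 0.
    by rewrite !tE -(F4_rootwE (inl (inl p)) HE) ax0 zero_lfunE.
  apply/F4_cartanP; rewrite /rv p2.
  have [c /so_opp_coord[t tE] ->] := pair_rootv_cartan C 
    (@so_oppK 7) so7_par_sg (@so7_ta_sg) (fun k h => False_ind _ (notF h)) p.1.
  exists t, 0; rewrite /F4_cart K_blocksE; congr (_, _, _).
    by apply/matrixP => i j; rewrite !mxE tE.
  by rewrite oppr0; apply/matrixP => i j; rewrite mx2E mxE !if_same.
- move=> x y _ _ ax0 axy; have := F4_root_level_eq axy.
  case: x ax0 axy => [[p|b]|[s r]] ax0 axy.
  + case: y axy => [[p'|b']|[s' r']] axy; last 2 first.
    * by case: b' {axy}.
    * by rewrite /=; case: (r' == 0).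
    have [||yx|yx] := pair_weight_inj (C := C) (@so_oppK 7) (@so7_ta_sg) (@so7_fix_uniq)
       (x := p.1) (y := p.2) (z := p'.1) (t := p'.2).
    * move=> c /w_coord[t tE]; have [H HE] := F4_cart_ex t 0.
      by rewrite !tE -(F4_rootwE (inl (inl p)) HE) axy (F4_rootwE _ HE).
    * have [H aH] : exists H, F4_rootw (inl (inl p)) H != 0.
        apply: contrapT => /forallNP h; move/eqP: ax0; apply.
        by apply/lfunP => H; rewrite zero_lfunE; apply/eqP/negPn/negP/h.
      have /F4_cartanP[t [c Hc]] := subvsP H.
      exists (fun i => t i./2) => [k|]; first by rewrite half_so_opp.
      by move: aH; rewrite (F4_rootwE _ Hc).
    * have -> : p' = p by rewrite [p']surjective_pairing yx -surjective_pairing.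
      by split=> //; exists 1; rewrite scale1r.
    case: yx => y1 y2; split=> //; exists (-1); rewrite /F4_rootv /rv y1 y2.
    rewrite [X in F4_ev X _](pair_rootv_sym C (fun=> false)) /F4_ev.
    by rewrite -[RHS]/(_, _ *: 0, _ *: 0) !scaler0.
  + case: y axy => [[p'|b']|[s' r']] axy.
    * by case: b {ax0 axy}.
    * move=> bb'; have <- : b = b' by move: bb'; case: (b); case: (b').
      by split=> //; exists 1; rewrite scale1r.
    by rewrite /=; case: (b); case: (r' == 0).
  case: y axy => [[p'|b']|[s' r']] axy.
  + by rewrite /=; case: (r == 0).
  + by rewrite /=; case: (b'); case: (r == 0).
  move=> rr'; have {}rr' : r = r'.
    by apply: val_inj; move: rr'; case: (r) (r') => [[|[|//]] ?] [[|[|//]] ?].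
  subst r'; have <- : s = s'.
    apply: spin_weight_inj => t; have [H HE] := F4_cart_ex t 0.
    have := congr1 (fun f : weight D => f H) axy.
    by rewrite !(F4_rootwE _ HE) /= oppr0 !if_same !addr0.
  by split=> //; exists 1; rewrite scale1r.
move=> p X /F4_partP; case: p => [[Q ->]|[A [a [hA ha ->]]]].
  exists 0, (fun x => if x is inr p then Q p.1 p.2 else 0); split=> //; first exact: mem0v.
  rewrite add0r big_mkcond big_sumType /= [X in X + _]big1 ?add0r //.
  have od_lin : linear (F4_od (C := C)).
    move=> c M N; rewrite /F4_od -[RHS]/(c *: 0 + 0, c *: 0 + 0, _).
    by rewrite !scaler0 !addr0.
  by rewrite -(lin_comb od_lin) sum_deltaE.
(* Only the diagonal of sl(2) is put into the Cartan part; that of so(7) comes from the vectors [rv]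
   of opposite pairs. *)
exists (F4_cart (fun=> 0) (a 0 0)), (fun x => match x with
  | inl (inl p) => 2^-1 * (W *m A *m W^T) p.1 p.2
  | inl (inr b) => if b then a 1 0 else a 0 1
  | inr p => 0 end); split=> //.
  by apply/F4_cartanP; eexists; eexists.
rewrite big_mkcond !big_sumType /= [X in _ + (_ + X)]big1 ?addr0 //.
have ev1 : linear (fun M : 'M[C]_7 => F4_ev M 0).
  by move=> c M N; have := F4_ev_lin c M N 0 0; rewrite scaler0 addr0.
have ev2 : linear (F4_ev (0 : 'M[C]_7)).
  by move=> c M N; have := F4_ev_lin c 0 0 M N; rewrite scaler0 addr0.
rewrite -(lin_comb ev1) -(lin_comb ev2).
have -> : \sum_p (2^-1 * (W *m A *m W^T) p.1 p.2) *: rv p = A.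
  rewrite -(pair_rootv_span (@so_oppK 7) so7_par_sg (@so7_ta_sg) (@so7_ta_fix)
    (so7_anti hA)).
  by rewrite so7_form1 mulmx1.
have K0 : K_blocks 7 (fun=> 0) = 0 :> 'M[C]_7.
  by apply/matrixP => i j; rewrite !mxE !mulr0 !if_same.
have -> : \sum_(b : bool) (if b then a 1 0 else a 0 1) *:
    (if b then delta_mx 1 0 else delta_mx 0 1) = a - mx2 (a 0 0) 0 0 (- a 0 0).
  move: ha; rewrite mxtrace2 => /eqP; rewrite addrC addr_eq0 => /eqP a11.
  have d10 : delta_mx 1 0 = mx2 0 0 1 0 :> 'M[C]_2 by rewrite [LHS]mx2_eta !mxE.
  have d01 : delta_mx 0 1 = mx2 0 1 0 0 :> 'M[C]_2 by rewrite [LHS]mx2_eta !mxE.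
  rewrite big_bool d10 d01 [X in _ = X - _]mx2_eta a11; apply/matrixP => i j.
  have E (k l : C) (M N : 'M[C]_2) : (k *: M + l *: N) i j = k * M i j + l * N i j.
    by rewrite !mxE.
  have E' (M N : 'M[C]_2) : (M - N) i j = M i j - N i j by rewrite !mxE.
  by rewrite E E' !mx2E; case: ifP => _; case: ifP => _; ring.
rewrite /F4_cart K0 /F4_ev; congr (_, _, _) => /=; rewrite ?add0r ?addr0 //.
by rewrite addrC subrK.
Qed.

End F4.

Lemma complex_archimedean (R : realType) (x y : R[i]) : 0 < x -> y \is Num.real ->
  exists n, y < x *+ n.
Proof.
move=> x0 /complex_realP[v ->]; move: x0 (gtr0_real x0) => + /complex_realP[u xu].
rewrite xu -[X in X < _]/(0%:C)%C ltcR => u0 {xu}.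
exists (Num.bound `|v / u|); rewrite -raddfMn /= ltcR -mulr_natl -ltr_pdivrMr //.
exact: le_lt_trans (ler_norm _) (archi_boundP (normr_ge0 _)).
Qed.

Lemma data_root_datum (C : numClosedFieldType) (t : super_type) :
  exists (I : finType) (a : I -> weight (data C t)) e q F, root_datum a e q F.
Proof.
case: t => [m n|m n|].
- exact: sl_root_datum.
- exact: osp_root_datum.
exact: F4_root_datum.
Qed.

Theorem theorem60 (R : realType) (t : super_type) (ht : admissible_type t)
  (D := data R[i] t)
  (omega : D -> D) (homega : antiinvolution omega) (htype : omega_type omega)
  (P : set (weight D)) (hP : positive_system P)
  (hP0 : P `&` sroot false = @even_pos R[i] t)
  (eps : R[i]) (hadapted : adapted omega P eps)
  (k : set D) (hk : maximal_compact omega k)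
  (hcartan : [set H | H \in cartan D] `<=` complexification k)
  (La : weight D) (V : srep D) (hV : simple_hw P La V)
  (hU : unitary_rep omega V)
  (L0 : weight D -> erep D)
  (hL0 : forall nu, simple_hw0 (@even_pos R[i] t) nu (L0 nu))
  (S := LaGam omega P eps k L0 (nc_allowed t) La)
  (m : weight D -> nat) (hm : decomposition V L0 m S)
  (d := fun mu : weight D => fdim (weight_space (@sact _ _ V) mu)) :
  m La = 1%N /\
  forall mu : weight D, S mu -> mu <> La ->
    ((m mu)%:R : R[i]) =
      (d mu)%:R - \sum_(nu \in [set nu | S nu /\ weight_gt P nu mu])
                    ((m nu)%:R * (hw_mult L0 nu mu)%:R : R[i]) /\
    ((m mu)%:R : R[i]) =
      \sum_(nu \in [set nu | S nu /\ weight_gt P nu mu])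
        Bcoef P L0 La mu nu * (m nu)%:R.

Proof.
have [I [a [e [q [F B]]]]] := data_root_datum R[i] t.
have [H0 [H0_real P_pos]] := hP.
apply: (multiplicities B (@complex_archimedean R) (H0 := H0) _ P_pos hV _ hm).
  (* Regularity of [H0] is given on roots in the sense of [sroots]; every weight of the datum is one
     of them. *)
  move=> i; apply: H0_real; have := sroot_rootv B (erefl (q i)).
  by case: (q i); [right | left].
by move=> nu; rewrite hP0; exact: hL0.
Qed.
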